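(* Let $N\in\mathbb N\cup\{\infty\}$. Assume that for every $n$ in the range $0\le n\le N$ (with $n$ finite) the following holds: $\delta\neq0$ if $n$ is even, and either $p=0$, or $p>n$ and $p$ does not divide $m$. Then the algebras $B^m_n(\delta)$ form a tower of recollement, i.e. $A_n=B_n^m(\delta)$ satisfies axioms (A1)–(A6) listed in the context, for all indices in this range.
   Context: $k$ is an algebraically closed field of characteristic $p\ge 0$, $m\ge 1$ is an integer invertible in $k$, and $\delta=(\delta_0,\ldots,\delta_{m-1})\in k^m$. Cyclotomic Brauer algebra $B_n^m=B_n^m(\delta)$. A reduced $(m,n)$-diagram is a perfect matching of $n$ northern nodes $1,\ldots,n$ and $n$ southern nodes $\bar1,\ldots,\bar n$, each strand being oriented and labelled by an element of $\mathbb Z/m\mathbb Z$; reversing the orientation of a strand replaces its label by the negative, and diagrams equal up to such changes are identified. $B_n^m$ has $k$-basis the reduced $(m,n)$-diagrams. The product $x\cdot y$ is obtained by placing $x$ above $y$, identifying southern nodes of $x$ with northern nodes of $y$, choosing compatible orientations, and adding labels along each new strand; each closed loop is oriented so that it points downwards at its leftmost central node, and if its total label is then $i$ it is replaced by the scalar $\delta_i$. $B_0^m=k$. Tower of recollement. A family of finite dimensional $k$-algebras $A_n$ is a tower of recollement if it admits the following data. (A1) For each $n\ge2$ there is an idempotent $e_n\in A_n$ with an isomorphism $A_{n-2}\cong e_nA_ne_n$. (For $n=0,1$ put $e_n=0$.) Set $e_{n,0}=1$ and, for $1\le i\le n/2$, let $e_{n,i}$ be the image of $e_{n-2,i-1}$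 under this isomorphism (so $e_{n,1}=e_n$); put $A_{n,i}=A_n/A_ne_{n,i+1}A_n$, and $A_{n,i}=A_n$ if $i=\lfloor n/2\rfloor$. (A2) (i) $A_n/A_ne_nA_n$ is semisimple for each $n$. (ii) For each $n$ and $0\le i\le n/2$, writing $A=A_{n,i}$ and $e$ for the image of $e_{n,i}$ in $A$, the multiplication map $Ae\otimes_{eAe}eA\to AeA$ is a bijection. These imply that each $A_n$ is quasi-hereditary. Let $\Lambda^n$ index the simple modules of $A_n/A_ne_nA_n$; the simple $A_n$-modules are indexed by $\Lambda_n=\Lambda^n\sqcup\Lambda_{n-2}$, and $\Lambda_n^j$ ($j=n,n-2,\ldots\ge 0$) denotes the subset of $\Lambda_n$ corresponding to $\Lambda^j$ (empty if $j<0$ or $j>n$). The standard module $\Delta_n(\lambda)$ is the corresponding simple $A_n/A_ne_nA_n$-module if $\lambda\in\Lambda^n$, and $A_ne_n\otimes_{A_{n-2}}\Delta_{n-2}(\lambda)$ if $\lambda\in\Lambda_{n-2}$. For a module $M$ with a filtration by standard modules, $\operatorname{supp}(M)$ is the set of labels of the standard modules occurring. (A3) For each $n$, $A_n$ can be identified with a subalgebra of $A_{n+1}$ (giving restriction functors $\operatorname{res}$ from $A_{n+1}$-modules to $A_n$-modules). (A4) For all $n\ge2$, $A_ne_n\cong A_{n-1}$ as a left $A_{n-1}$-, right $A_{n-2}$-bimodule. (A5) For $n\ge 1$ and each $\lambda\in\Lambda_n^j$, $\operatorname{res}\Delta_n(\lambda)$ has a filtration by standard modules and $\operatorname{supp}(\operatorname{res}\Delta_n(\lambda))\subseteq\Lambda_{n-1}^{j-1}\sqcup\Lambda_{n-1}^{j+1}$.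 (A6) For each $n\ge1$ and each $\lambda\in\Lambda_n^n$ there is $\mu\in\Lambda_{n+1}^{n-1}$ with $\lambda\in\operatorname{supp}(\operatorname{res}\Delta_{n+1}(\mu))$.
   Formalization: The algebras B_n^m(δ) are assumed to exist as associative algebras with the stated diagram basis and product; for n ≥ 2 the stated loop rule is associative only when δ_i = δ_{-i} for all i, so for N ≥ 2 the result concerns such symmetric δ. *)

(* Defs.v *)
From HB Require Import structures.
From mathcomp Require Import all_boot all_order all_algebra all_field.

Set Implicit Arguments.
Unset Strict Implicit.
Unset Printing Implicit Defensive.

Import GRing.Theory.
Local Open Scope ring_scope.

Section QuotientSpace.

Variables (k : fieldType) (V : vectType k) (U : {vspace V}).

(* V / U, realised on the complement of U; qproj is the canonical surjection. *)
Definition qspace : vectType k := subvs_of (U^C)%VS.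
Definition qproj (v : V) : qspace := vsproj (U^C)%VS (v - projv U v).

Fact qproj_is_linear : linear qproj.
Proof.
move=> a u v; rewrite /qproj -linearP; apply: (congr1 (vsproj _)).
by rewrite linearP scalerBr opprD addrACA.
Qed.
HB.instance Definition _ := GRing.isSemilinear.Build k V qspace _ qproj
  (GRing.semilinear_linear qproj_is_linear).

Lemma val_qproj v : vsval (qproj v) = v - projv U v.
Proof. by rewrite vsprojK ?memv_projC. Qed.

Lemma qprojK : cancel (@vsval _ _ (U^C)%VS : qspace -> V) qproj.
Proof.
move=> t; apply/val_inj; rewrite /= val_qproj.
have /eqP-> : projv U (vsval t) == 0 by rewrite -memv_ker lker_proj subvsP.
by rewrite subr0.
Qed.

Lemma qproj_eq0 v : (qproj v == 0) = (v \in U).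
Proof.
rewrite -(inj_eq val_inj) /= val_qproj subr_eq0; apply/eqP/idP => [-> | Uv].
  exact: memv_proj.
by rewrite projv_id.
Qed.

Lemma qproj_eq u v : (qproj u == qproj v) = (u - v \in U).
Proof. by rewrite -qproj_eq0 linearB subr_eq0. Qed.

End QuotientSpace.

Section TensorProduct.

(* M (x)_R N for a right action ra of R on M and a left action la of R on N:  *)
(* matrices in the bases vbasis {:M}, vbasis {:N} stand for M (x)_k N, and    *)
(* one divides by the span of the (x r) (x) y - x (x) (r y).                  *)
Variables (k : fieldType) (R M N : vectType k).
Variables (ra : 'Hom(R, 'End(M))) (la : 'Hom(R, 'End(N))).

Local Notation eM := (vbasis {:M}).
Local Notation eN := (vbasis {:N}).

Definition pure_mx (x : M) (y : N) : 'M[k]_(\dim {:M}, \dim {:N}) :=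
  \matrix_(i, j) (coord eM i x * coord eN j y).

Definition balancing : {vspace 'M[k]_(\dim {:M}, \dim {:N})} :=
  (\sum_(r < \dim {:R}) \sum_(i < \dim {:M}) \sum_(j < \dim {:N})
    <[pure_mx (ra (vbasis {:R})`_r eM`_i) eN`_j
      - pure_mx eM`_i (la (vbasis {:R})`_r eN`_j)]>)%VS.

Definition tensor : vectType k := qspace balancing.
Definition tpure (x : M) (y : N) : tensor := qproj balancing (pure_mx x y).

(* The linear map on M (x)_R N induced by a balanced bilinear map b.          *)
Definition tlift (W : vectType k) (b : M -> N -> W) : 'Hom(tensor, W) :=
  linfun (fun t : tensor => \sum_i \sum_j vsval t i j *: b eM`_i eN`_j).

Definition bilinear2 (W : vectType k) (b : M -> N -> W) : Prop :=
  (forall y, linear (b^~ y)) /\ (forall x, linear (b x)).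

Definition balanced (W : vectType k) (b : M -> N -> W) : Prop :=
  forall r x y, b (ra r x) y = b x (la r y).


Section Lift.

Variables (W : vectType k) (b : M -> N -> W).
Hypotheses (bil : bilinear2 b) (bal : balanced b).

Let lift_mx (X : 'M[k]_(\dim {:M}, \dim {:N})) : W :=
  \sum_i \sum_j X i j *: b eM`_i eN`_j.

Let lift_mxP : linear lift_mx.
Proof.
move=> a X Y; rewrite /lift_mx scaler_sumr -big_split; apply: eq_bigr => i _ /=.
rewrite scaler_sumr -big_split; apply: eq_bigr => j _ /=.
by rewrite !mxE scalerDl scalerA.
Qed.

Let liftL := GRing.isLinear.Build _ _ _ _ lift_mx lift_mxP.
HB.instance Definition _ := liftL.

Let b_suml I r (P : pred I) (F : I -> k) (G : I -> M) y :
  b (\sum_(i <- r | P i) F i *: G i) y = \sum_(i <- r | P i) F i *: b (G i) y.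
Proof.
pose L := GRing.isLinear.Build _ _ _ _ (b^~ y) (bil.1 y).
pose f : {linear M -> W} := HB.pack (b^~ y) L.
rewrite -[LHS]/(f _) linear_sum; apply: eq_bigr => i _; exact: linearZ.
Qed.

Let b_sumr I r (P : pred I) (F : I -> k) (G : I -> N) x :
  b x (\sum_(i <- r | P i) F i *: G i) = \sum_(i <- r | P i) F i *: b x (G i).
Proof.
pose L := GRing.isLinear.Build _ _ _ _ (b x) (bil.2 x).
pose f : {linear N -> W} := HB.pack (b x) L.
rewrite -[LHS]/(f _) linear_sum; apply: eq_bigr => i _; exact: linearZ.
Qed.

Let lift_pure x y : lift_mx (pure_mx x y) = b x y.
Proof.
rewrite [in RHS](coord_vbasis (memvf x)) b_suml; apply: eq_bigr => i _.
rewrite [in RHS](coord_vbasis (memvf y)) b_sumr scaler_sumr.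
by apply: eq_bigr => j _; rewrite mxE scalerA.
Qed.

Let lift_bal X : X \in balancing -> lift_mx X = 0.
Proof.
move=> XB; apply/eqP.
have <- : linfun lift_mx X = lift_mx X by rewrite lfunE.
rewrite -memv_ker; apply: subvP XB.
apply/subv_sumP => r _; apply/subv_sumP => i _; apply/subv_sumP => j _.
by rewrite -memvE memv_ker lfunE /= linearB /= !lift_pure bal subrr.
Qed.

Let tliftF (t : tensor) := lift_mx (vsval t).
Let tliftFP : linear tliftF.
Proof. by move=> a t u; rewrite /tliftF linearP. Qed.
Let tliftL := GRing.isLinear.Build _ _ _ _ tliftF tliftFP.
HB.instance Definition _ := tliftL.

Lemma tliftE x y : tlift b (tpure x y) = b x y.
Proof.
rewrite -[LHS]/(linfun tliftF _) lfunE /= /tliftF val_qproj linearB /=.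
by rewrite (lift_bal (memv_proj _ _)) subr0.
Qed.

End Lift.

Lemma tpure_bilinear : bilinear2 tpure.
Proof.
split=> [y|x] a u v; rewrite /tpure -linearP; congr (qproj _ _); apply/matrixP=> i j.
  by rewrite !mxE linearP /= mulrDl mulrA.
by rewrite !mxE linearP /= mulrDr mulrCA.
Qed.

Lemma tensor_ext (W : vectType k) (f g : 'Hom(tensor, W)) :
  (forall x y, f (tpure x y) = g (tpure x y)) -> f = g.
Proof.
move=> fg; apply/lfunP => t; rewrite -[t]qprojK.
rewrite [vsval t]matrix_sum_delta !linear_sum; apply: eq_bigr => i _.
rewrite !linear_sum; apply: eq_bigr => j _; rewrite !linearZ /=; congr (_ *: _).
suff -> : delta_mx i j = pure_mx eM`_i eN`_j by apply: fg.
apply/matrixP => i' j'; rewrite !mxE.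
rewrite !coord_free ?(basis_free (vbasisP _)) //.
by rewrite [i == i']eq_sym [j == j']eq_sym; case: eqP; case: eqP; rewrite ?mulr0 ?mul0r ?mulr1.
Qed.

Lemma tpure_balanced : balanced tpure.
Proof.
have basis0 (V : vectType k) (f : V -> tensor) : linear f ->
    (forall i : 'I_(\dim {:V}), f (vbasis {:V})`_i = 0) -> forall v, f v = 0.
  move=> flin f0 v; pose L := GRing.isLinear.Build _ _ _ _ f flin.
  pose g : {linear V -> tensor} := HB.pack f L.
  rewrite [v](coord_vbasis (memvf v)) -[LHS]/(g _) linear_sum big1 // => i _.
  by rewrite linearZ /= [X in _ *: X]f0 scaler0.
have [linl linr] := tpure_bilinear.
have subP (c : k) (a b d e : tensor) : c *: a + b - (c *: d + e) = c *: (a - d) + (b - e).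
  by rewrite opprD addrACA -scalerBr.
move=> r x y; apply/eqP; rewrite -subr_eq0; apply/eqP; move: r.
apply: (@basis0 _ _) => [c r1 r2|r].
  by rewrite !linearP !add_lfunE !scale_lfunE linl linr subP.
move: x; apply: (@basis0 _ _) => [c x1 x2|i]; first by rewrite linearP !linl subP.
move: y; apply: (@basis0 _ _) => [c y1 y2|j]; first by rewrite linearP !linr subP.
apply/eqP; rewrite subr_eq0 qproj_eq /balancing (bigD1 r) //= (bigD1 i) //= (bigD1 j) //=.
rewrite -[X in X \in _]addr0 memv_add ?mem0v // -[X in X \in _]addr0 memv_add ?mem0v //.
by rewrite -[X in X \in _]addr0 memv_add ?mem0v ?memv_line.
Qed.

End TensorProduct.

Record proper_ideal (k : fieldType) (A : falgType k) := ProperIdeal {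
  ideal_space :> {vspace A};
  ideal_mull : ({:A} * ideal_space <= ideal_space)%VS;
  ideal_mulr : (ideal_space * {:A} <= ideal_space)%VS;
  ideal_proper : 1 \notin ideal_space }.

Section QuotientAlgebra.

Variables (k : fieldType) (A : falgType k) (I : proper_ideal A).

(* A / I, with the product induced from A along the surjection quo.           *)
Definition quoalg : Type := qspace I.
HB.instance Definition _ := Vector.on quoalg.

Definition quo (x : A) : quoalg := qproj I x.
Definition quo_mul (x y : quoalg) : quoalg := quo (vsval x * vsval y).

Fact quo_is_linear : linear quo. Proof. exact: qproj_is_linear. Qed.
HB.instance Definition _ := GRing.isSemilinear.Build k A quoalg _ quo
  (GRing.semilinear_linear quo_is_linear).

Let quoK (x : quoalg) : quo (vsval x) = x. Proof. exact: qprojK. Qed.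

Lemma quo_eq0 x : (quo x == 0) = (x \in (I : {vspace A})).
Proof. exact: qproj_eq0. Qed.

Let quo_mulP x y : quo_mul (quo x) (quo y) = quo (x * y).
Proof.
apply/eqP; rewrite /quo_mul /quo qproj_eq !val_qproj.
set x' := projv I x; set y' := projv I y.
have -> : (x - x') * (y - y') - x * y = - (x * y') - x' * (y - y').
  by rewrite mulrBl mulrBr addrAC [_ * y - _]addrC addrK.
rewrite memvB ?memvN //.
  by apply: (subvP (ideal_mull I)); rewrite memv_mul ?memvf ?memv_proj.
by apply: (subvP (ideal_mulr I)); rewrite memv_mul ?memvf ?memv_proj.
Qed.

Let quo_mulA : associative quo_mul.
Proof.
by move=> x y z; rewrite -[x]quoK -[y]quoK -[z]quoK !quo_mulP mulrA.
Qed.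
Let quo_mul1 : left_id (quo 1) quo_mul.
Proof. by move=> x; rewrite -[x]quoK quo_mulP mul1r. Qed.
Let quo_mulr1 : right_id (quo 1) quo_mul.
Proof. by move=> x; rewrite -[x]quoK quo_mulP mulr1. Qed.
Let quo_mulDl : left_distributive quo_mul +%R.
Proof. by move=> x y z; rewrite /quo_mul linearD /= mulrDl linearD. Qed.
Let quo_mulDr : right_distributive quo_mul +%R.
Proof. by move=> x y z; rewrite /quo_mul linearD /= mulrDr linearD. Qed.
Let quo1_neq0 : quo 1 != 0.
Proof. by rewrite quo_eq0 ideal_proper. Qed.

HB.instance Definition _ := GRing.Zmodule_isNzRing.Build quoalg
  quo_mulA quo_mul1 quo_mulr1 quo_mulDl quo_mulDr quo1_neq0.

Let quo_scaleAl a (x y : quoalg) : a *: (x * y) = (a *: x) * y.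
Proof. by rewrite -[RHS]/(quo_mul _ _) /quo_mul linearZ /= -scalerAl linearZ. Qed.
HB.instance Definition _ := GRing.Lmodule_isLalgebra.Build k quoalg quo_scaleAl.

Let quo_scaleAr a (x y : quoalg) : a *: (x * y) = x * (a *: y).
Proof. by rewrite -[RHS]/(quo_mul _ _) /quo_mul linearZ /= -scalerAr linearZ. Qed.
HB.instance Definition _ := GRing.Lalgebra_isAlgebra.Build k quoalg quo_scaleAr.
HB.instance Definition _ := Algebra_isFalgebra.Build k quoalg.

Lemma quoM x y : quo (x * y) = quo x * quo y.
Proof. by rewrite -quo_mulP. Qed.

Lemma quo_surj (x : quoalg) : exists a, x = quo a.
Proof. by exists (vsval x); rewrite quoK. Qed.

End QuotientAlgebra.

Record lmodule (k : fieldType) (A : falgType k) := LModule {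
  lcar :> vectType k;
  lact : 'Hom(A, 'End(lcar));
  lact1 : lact 1 = \1%VF;
  lactM : forall a b, lact (a * b) = (lact a \o lact b)%VF }.

Section Modules.

Variables (k : fieldType) (A : falgType k).
Implicit Type M : lmodule A.

Definition submodule M (U : {vspace M}) : Prop :=
  forall (a : A) (v : M), v \in U -> lact M a v \in U.

Definition simple_module M : Prop :=
  ({:M} != 0)%VS /\
  forall U : {vspace M}, submodule U -> U = 0%VS \/ U = {:M}%VS.

Definition semisimple_module M : Prop :=
  forall U : {vspace M}, submodule U ->
  exists W : {vspace M}, [/\ submodule W, (U + W = {:M})%VS & (U :&: W = 0)%VS].

(* V2 / V1 is isomorphic to D: there is a surjective homomorphism V2 -> D     *)
(* with kernel V1 (the values of f outside V2 are irrelevant).                *)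
Definition section_iso M (V1 V2 : {vspace M}) (D : lmodule A) : Prop :=
  exists f : 'Hom(M, D), [/\ (f @: V2 = {:D})%VS, (V2 :&: lker f = V1)%VS &
    forall (a : A) (v : M), v \in V2 -> f (lact M a v) = lact D a (f v)].

Definition annihilates (J : {vspace A}) M : Prop :=
  forall (a : A) (v : M), a \in J -> lact M a v = 0.

Definition reg_act (a : A) : 'End(A) := linfun (fun x : A => a * x).
Let reg_actE a x : reg_act a x = a * x.
Proof. exact: (lfunE (a \*o @idfun A)). Qed.
Let reg_act_lin : linear reg_act.
Proof.
move=> c a b; apply/lfunP => x.
by rewrite add_lfunE scale_lfunE !reg_actE mulrDl scalerAl.
Qed.
Let regL := GRing.isLinear.Build _ _ _ _ reg_act reg_act_lin.
HB.instance Definition _ := regL.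
Let reg1 : linfun reg_act 1 = \1%VF.
Proof. by apply/lfunP => x; rewrite lfunE reg_actE mul1r id_lfunE. Qed.
Let regM a b : linfun reg_act (a * b) = (linfun reg_act a \o linfun reg_act b)%VF.
Proof. by apply/lfunP => x; rewrite comp_lfunE !lfunE /= !reg_actE mulrA. Qed.
Definition regular : lmodule A := LModule reg1 regM.

Definition semisimple_algebra : Prop := semisimple_module regular.

Definition lideal (e : A) : {vspace A} := ({:A} * <[e]>)%VS.
Definition rideal (e : A) : {vspace A} := (<[e]> * {:A})%VS.
Definition corner (e : A) : {vspace A} := (<[e]> * {:A} * <[e]>)%VS.
Definition ideal (e : A) : {vspace A} := ({:A} * <[e]> * {:A})%VS.

(* The multiplication map Ae (x)_{eAe} eA -> A. The products below already    *)
(* lie in Ae and eA, where vsproj is the identity.                            *)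
Section MultiplicationMap.
Variable e : A.

Definition lideal_ract : 'Hom(subvs_of (corner e), 'End(subvs_of (lideal e))) :=
  linfun (fun r : subvs_of (corner e) =>
    linfun (fun x : subvs_of (lideal e) =>
      vsproj (lideal e) (vsval x * vsval r)) : 'End(subvs_of (lideal e))).

Definition rideal_lact : 'Hom(subvs_of (corner e), 'End(subvs_of (rideal e))) :=
  linfun (fun r : subvs_of (corner e) =>
    linfun (fun y : subvs_of (rideal e) =>
      vsproj (rideal e) (vsval r * vsval y)) : 'End(subvs_of (rideal e))).

Definition mult_map : 'Hom(tensor lideal_ract rideal_lact, A) :=
  tlift lideal_ract rideal_lact
    (fun (x : subvs_of (lideal e)) (y : subvs_of (rideal e)) =>
       vsval x * vsval y).

Definition mult_bijective : Prop :=
  lker mult_map = 0%VS /\ limg mult_map = ideal e.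

End MultiplicationMap.

End Modules.

Section Restriction.

Variables (k : fieldType) (A B : falgType k) (f : 'AHom(A, B)) (M : lmodule B).

Definition res_act : 'Hom(A, 'End(M)) := (lact M \o f)%VF.
Let res1 : res_act 1 = \1%VF.
Proof. by rewrite comp_lfunE rmorph1 lact1. Qed.
Let resM a b : res_act (a * b) = (res_act a \o res_act b)%VF.
Proof. by rewrite !comp_lfunE rmorphM lactM. Qed.
Definition res : lmodule A := LModule res1 resM.

End Restriction.

Section Globalisation.

(* Be (x)_A M, where A acts on Be on the right through phi : A -> eBe. Thus   *)
(* x . a = x * phi a; the extra factor e does not change this product and     *)
(* makes the definition total.                                                *)
Variables (k : fieldType) (A B : falgType k) (e : B) (phi : 'Hom(A, B)).
Variable M : lmodule A.

Local Notation Be := (subvs_of (lideal e)).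

Definition glob_ract : 'Hom(A, 'End(Be)) :=
  linfun (fun a : A =>
    linfun (fun x : Be => vsproj (lideal e) (vsval x * phi a * e)) : 'End(Be)).

Definition glob_space : vectType k := tensor glob_ract (lact M).
Definition glob_pure : Be -> M -> glob_space := tpure glob_ract (lact M).

Definition glob_act_fun (b : B) : 'End(glob_space) :=
  tlift glob_ract (lact M)
    (fun (x : Be) (v : M) => glob_pure (vsproj (lideal e) (b * vsval x)) v).

Let mulBe b x : x \in lideal e -> b * x \in lideal e.
Proof.
move=> ex; suff sub : ({:B} * lideal e <= lideal e)%VS.
  by apply: (subvP sub); rewrite memv_mul ?memvf.
by rewrite /lideal prodvA prodvSl ?subvf.
Qed.

Let Be_e b : b * e \in lideal e.
Proof. by rewrite memv_mul ?memvf ?memv_line. Qed.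

Let glob_ractE a (x : Be) : vsval (glob_ract a x) = vsval x * phi a * e.
Proof.
pose h a (x : Be) : Be := vsproj (lideal e) (vsval x * phi a * e).
have hl b : linear (h b).
  by move=> c u v; rewrite /h -linearP; apply: congr1; rewrite linearP /= !mulrDl -!scalerAl.
pose hL b : {linear Be -> Be} := HB.pack (h b) (GRing.isLinear.Build _ _ _ _ (h b) (hl b)).
pose g b : 'End(Be) := linfun (h b).
have gE b y : g b y = h b y by rewrite -[g b]/(linfun (hL b)) lfunE.
have gl : linear g.
  move=> c b d; apply/lfunP => y; rewrite add_lfunE scale_lfunE !gE /h -linearP.
  by apply: congr1; rewrite linearP /= mulrDr mulrDl -scalerAr -scalerAl.
pose gL : {linear A -> 'End(Be)} := HB.pack g (GRing.isLinear.Build _ _ _ _ g gl).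
have -> : glob_ract a x = g a x by rewrite -[glob_ract]/(linfun gL) lfunE.
by rewrite gE vsprojK.
Qed.

Let glob_b (b : B) (x : Be) (v : M) : glob_space :=
  glob_pure (vsproj (lideal e) (b * vsval x)) v.

Let glob_bE b x v : glob_act_fun b (glob_pure x v) = glob_b b x v.
Proof.
have [linl linr] := tpure_bilinear glob_ract (lact M).
apply: (@tliftE _ _ _ _ _ _ _ (glob_b b)); first split => [w c y z|w].
- rewrite /glob_b -linl; congr (tpure _ _ _ _); rewrite -linearP.
  by apply: congr1; rewrite linearP /= mulrDr -scalerAr.
- exact: linr.
move=> a y w; rewrite /glob_b -[glob_pure _ (lact _ _ _)]tpure_balanced.
congr (tpure _ _ _ _); apply/val_inj.
rewrite /= vsprojK ?mulBe ?subvsP // !glob_ractE vsprojK ?mulBe ?subvsP //.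
by rewrite !mulrA.
Qed.

Let glob_lin : linear glob_act_fun.
Proof.
have [linl linr] := tpure_bilinear glob_ract (lact M).
move=> c a b; apply: tensor_ext => x v; rewrite add_lfunE scale_lfunE.
rewrite !glob_bE /glob_b -linl; congr (tpure _ _ _ _); rewrite -linearP.
by apply: congr1; rewrite mulrDl -scalerAl.
Qed.
Let globL := GRing.isLinear.Build _ _ _ _ glob_act_fun glob_lin.
HB.instance Definition _ := globL.

Definition glob_act : 'Hom(B, 'End(glob_space)) := linfun glob_act_fun.

Lemma glob_actE b x v :
  glob_act b (glob_pure x v) = glob_pure (vsproj (lideal e) (b * vsval x)) v.
Proof. by rewrite lfunE glob_bE. Qed.

Let glob1 : glob_act 1 = \1%VF.
Proof.
by apply: tensor_ext => x v; rewrite glob_actE mul1r vsvalK id_lfunE.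
Qed.

Let globM a b : glob_act (a * b) = (glob_act a \o glob_act b)%VF.
Proof.
apply: tensor_ext => x v; rewrite comp_lfunE !glob_actE.
by rewrite vsprojK ?mulBe ?subvsP // mulrA.
Qed.

Definition glob : lmodule B := LModule glob1 globM.

End Globalisation.

(* N : option nat stands for an element of nat + {infinity}, None being       *)
(* infinity.                                                                  *)
Definition in_range (N : option nat) (n : nat) : bool :=
  if N is Some b then (n <= b)%N else true.

Section Standard.

(* e and phi are the data of the first condition: phi n : A_n -> A_(n+2) is   *)
(* an isomorphism onto e_(n+2) A_(n+2) e_(n+2).                               *)
Variables (k : fieldType) (A : nat -> falgType k).
Variables (e : forall n, A n) (phi : forall n, 'Hom(A n, A n.+2)).

(* e_(n,i). It is 0 for i > n/2 (as e_0 = e_1 = 0), so that the quotient of   *)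
(* A_n by the ideal of e_(n,i+1) is A_n itself for i = n./2.                  *)
Fixpoint idem (n i : nat) : A n :=
  match i with
  | 0 => 1
  | i'.+1 => match n return A n with
             | n'.+2 => phi n' (idem n' i')
             | _ => 0
             end
  end.

(* Lambda n is the index set of the standard modules of A_n. An element of    *)
(* its new part is a simple module of A_n modulo the ideal of e_n, i.e. a     *)
(* simple A_n-module annihilated by this ideal; isomorphic simple modules     *)
(* represent the same label, and every notion below is invariant under        *)
(* isomorphism.                                                               *)
Inductive Lambda : nat -> Type :=
| Lnew n (L : lmodule (A n)) of simple_module L & annihilates (ideal (e n)) L :
    Lambda n
| Lold n of Lambda n : Lambda n.+2.

Fixpoint layer n (l : Lambda n) : nat :=
  match l with
  | Lnew n _ _ _ => n
  | Lold _ l' => layer l'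
  end.

Fixpoint Delta n (l : Lambda n) : lmodule (A n) :=
  match l in Lambda n return lmodule (A n) with
  | Lnew _ L _ _ => L
  | Lold n l' => glob (e n.+2) (phi n) (Delta l')
  end.

Section Filtrations.
Variables (n : nat) (M : lmodule (A n)).

(* filtered V s: V is a submodule with a filtration by submodules whose       *)
(* successive quotients, from the top, are the standard modules labelled by s.*)
Inductive filtered : {vspace M} -> seq (Lambda n) -> Prop :=
| Filtered0 : filtered 0%VS [::]
| FilteredS V1 V2 l s : filtered V1 s -> submodule V2 -> (V1 <= V2)%VS ->
    section_iso V1 V2 (Delta l) -> filtered V2 (l :: s).

Definition has_std_filtration : Prop := exists s, filtered {:M}%VS s.

Definition supp (l : Lambda n) : Prop :=
  exists s1 s2, filtered {:M}%VS (s1 ++ l :: s2).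

End Filtrations.

End Standard.

Section Tower.

Variables (k : fieldType) (N : option nat) (A : nat -> falgType k).
Variables (e : forall n, A n) (phi : forall n, 'Hom(A n, A n.+2)).
Variable iota : forall n, in_range N n.+1 -> 'AHom(A n, A n.+1).

Definition axiom_A1 : Prop :=
  [/\ e 0%N = 0, e 1%N = 0 &
    forall n, in_range N n.+2 ->
    [/\ e n.+2 * e n.+2 = e n.+2,
        phi n 1 = e n.+2,
        (forall a b, phi n (a * b) = phi n a * phi n b),
        lker (phi n) = 0%VS &
        limg (phi n) = corner (e n.+2)]].

(* If the ideal is the whole of A_n then the quotient is zero, and there is   *)
(* nothing to check.                                                          *)
Definition axiom_A2i : Prop :=
  forall n, in_range N n ->
  forall I : proper_ideal (A n), I = ideal (e n) :> {vspace A n} ->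
  semisimple_algebra (quoalg I).

Definition axiom_A2ii : Prop :=
  forall n i, in_range N n -> (i <= n./2)%N ->
  forall I : proper_ideal (A n),
  I = ideal (idem phi n i.+1) :> {vspace A n} ->
  mult_bijective (quo I (idem phi n i)).

Definition axiom_A3 : Prop :=
  forall n (h : in_range N n.+1), lker (iota h) = 0%VS.

Definition axiom_A4 : Prop :=
  forall n (h1 : in_range N n.+1) (h2 : in_range N n.+2),
  exists f : 'Hom(A n.+1, A n.+2),
  [/\ lker f = 0%VS, limg f = lideal (e n.+2),
      (forall a x, f (a * x) = iota h2 a * f x) &
      (forall x b, f (x * iota h1 b) = f x * phi n b)].

Definition axiom_A5 : Prop :=
  forall n (h : in_range N n.+1) (l : Lambda e n.+1),
  has_std_filtration e phi (res (iota h) (Delta phi l)) /\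
  forall mu : Lambda e n, supp phi (res (iota h) (Delta phi l)) mu ->
  (layer mu).+1 = layer l \/ layer mu = (layer l).+1.

Definition axiom_A6 : Prop :=
  forall n (h : in_range N n.+1) (l : Lambda e n), (0 < n)%N -> layer l = n ->
  exists2 mu : Lambda e n.+1, (layer mu).+1 = n &
  supp phi (res (iota h) (Delta phi mu)) l.

End Tower.

Definition tower_of_recollement (k : fieldType) (N : option nat)
    (A : nat -> falgType k) : Prop :=
  exists (e : forall n, A n) (phi : forall n, 'Hom(A n, A n.+2))
         (iota : forall n, in_range N n.+1 -> 'AHom(A n, A n.+1)),
  [/\ axiom_A1 N e phi,
      axiom_A2i N e /\ axiom_A2ii N phi,
      axiom_A3 iota,
      axiom_A4 e phi iota &
      axiom_A5 e phi iota /\ axiom_A6 e phi iota].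

(* Z/m for m >= 1 ('Z_m would be Z/2 for m = 1).                              *)
Notation Zm m := 'I_m.-1.+1.

(* inl i is the northern node i, inr i the southern node i.                   *)
Notation node n := ('I_n + 'I_n)%type.

Section Diagrams.

Variables (m n : nat).

(* A reduced diagram: d.1 is the perfect matching, and d.2 v is the label of  *)
(* the strand at v when this strand is oriented away from v.                  *)
Definition is_diagram (d : {ffun node n -> node n} * {ffun node n -> Zm m}) :=
  [forall v, [&& d.1 v != v, d.1 (d.1 v) == v & d.2 (d.1 v) == - d.2 v]].

Definition diagram := {d | is_diagram d}.

Definition mate (d : diagram) (v : node n) : node n := (val d).1 v.
Definition label (d : diagram) (v : node n) : Zm m := (val d).2 v.

Lemma mate_neq d v : mate d v != v.
Proof. by have /forallP/(_ v)/and3P[] := valP d. Qed.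
Lemma mateK d : involutive (mate d).
Proof. by move=> v; have /forallP/(_ v)/and3P[_ /eqP] := valP d. Qed.
Lemma label_mate d v : label d (mate d v) = - label d v.
Proof. by have /forallP/(_ v)/and3P[_ _ /eqP] := valP d. Qed.

(* The stack of x above y. (false, v) is the node v of x and (true, v) the    *)
(* node v of y; glue exchanges the two copies (false, inr c) and              *)
(* (true, inl c) of the central node c, and fixes the outer nodes.            *)
Local Notation snode := (bool * node n)%type.

Definition outer (s : snode) : bool :=
  match s with (false, inl _) | (true, inr _) => true | _ => false end.

Definition embed (v : node n) : snode :=
  match v with inl i => (false, inl i) | inr i => (true, inr i) end.

Definition glue (s : snode) : snode :=
  match s with
  | (false, inr c) => (true, inl c)
  | (true, inl c) => (false, inr c)
  | _ => s
  end.

Definition position (s : snode) : 'I_n :=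
  match s.2 with inl i => i | inr i => i end.

Section Stack.

Variables (x y : diagram).

Definition smate (s : snode) : snode :=
  (s.1, mate (if s.1 then y else x) s.2).

Definition slabel (s : snode) : Zm m := label (if s.1 then y else x) s.2.

(* One follows the strand starting at s, then passes to the other copy of its *)
(* end point if this is a central node.                                       *)
Definition step (s : snode) : snode := glue (smate s).

(* The number of strands on the path from an outer node s to the next one.    *)
Definition path_length (s : snode) : nat :=
  (find outer (traject step (step s) (order step s))).+1.

Definition comp_mate (v : node n) : node n :=
  (iter (path_length (embed v)) step (embed v)).2.

Definition comp_label (v : node n) : Zm m :=
  \sum_(s <- traject step (embed v) (path_length (embed v))) slabel s.


Lemma smateK : involutive smate.
Proof. by case=> b v; rewrite /smate /= mateK. Qed.
Lemma smate_neq s : smate s != s.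
Proof. by case: s => b v; rewrite /smate xpair_eqE eqxx mate_neq. Qed.
Lemma slabel_mate s : slabel (smate s) = - slabel s.
Proof. by case: s => b v; rewrite /slabel /= label_mate. Qed.
Lemma glueK : involutive glue. Proof. by case=> [[] []]. Qed.
Lemma glue_outer s : (glue s == s) = outer s.
Proof. by case: s => [[] []] i; rewrite ?eqxx. Qed.
Lemma embedK v : (embed v).2 = v. Proof. by case: v. Qed.
Lemma outer_embed v : outer (embed v). Proof. by case: v. Qed.
Lemma outerK s : outer s -> embed s.2 = s. Proof. by case: s => [[] []]. Qed.
Lemma step_inj : injective step.
Proof. exact: inj_comp (inv_inj glueK) (inv_inj smateK). Qed.

Lemma path_lengthP s : outer s ->
  outer (iter (path_length s) step s) /\
  (forall i, 0 < i < path_length s -> ~~ outer (iter i step s))%N.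
Proof.
move=> os; set p := traject step (step s) (order step s).
have sp : size p = order step s by rewrite size_traject.
have has_p : has outer p.
  apply/hasP; exists s => //; apply/trajectP; exists (order step s).-1.
    by rewrite prednK ?order_gt0.
  by rewrite -iterSr prednK ?order_gt0 // (iter_order step_inj).
have lt_p : (find outer p < order step s)%N by rewrite -sp -has_find.
split=> [|i /andP[]].
  rewrite /path_length -/p iterSr.
  by rewrite -(nth_traject step lt_p) nth_find.
case: i => // i _; rewrite ltnS => lt_i; have lt_i' := ltn_trans lt_i lt_p.
by rewrite iterSr -(nth_traject step lt_i') before_find.
Qed.

Lemma path_length_eq s j : outer s -> (0 < j)%N -> outer (iter j step s) ->
  (forall i, 0 < i < j -> ~~ outer (iter i step s))%N -> path_length s = j.
Proof.
move=> os j0 oj min_j; have [op min_p] := path_lengthP os.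
case: (ltngtP (path_length s) j) => // lt_pj.
  by have := min_j (path_length s); rewrite lt_pj op => /(_ isT).
by have := min_p j; rewrite lt_pj j0 oj => /(_ isT).
Qed.

Section Path.
Variable v : node n.
Let s := embed v.
Let j := path_length s.
Let w := iter j step s.

Let ow : outer w. Proof. by have [] := path_lengthP (outer_embed v). Qed.
Let embed_w : embed (comp_mate v) = w. Proof. exact: outerK ow. Qed.

Let backstep i : (i <= j)%N -> iter i step w = glue (iter (j - i) step s).
Proof.
elim: i => [_|i IH lt_ij].
  by rewrite subn0; apply/eqP; rewrite eq_sym glue_outer.
rewrite iterS IH 1?ltnW // subnS -[in LHS](ltn_predK (m := 0) (n := j - i)) ?subn_gt0 //.
by rewrite iterS /step glueK smateK.
Qed.

Let backlabel i : (i < j)%N ->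
  slabel (iter i step w) = - slabel (iter (j - i.+1) step s).
Proof.
move=> lt_ij; rewrite backstep 1?ltnW // -(subnSK lt_ij).
by rewrite iterS /step glueK slabel_mate.
Qed.

Let length_w : path_length w = j.
Proof.
have os := outer_embed v; have [_ min_j] := path_lengthP os.
apply: path_length_eq => // [|i /andP[i0 lt_ij]].
  rewrite backstep // subnn /= (_ : glue s = s) //.
  by apply/eqP; rewrite glue_outer.
rewrite backstep 1?ltnW //; set u := iter _ _ _.
suff : ~~ outer u by rewrite -!glue_outer glueK eq_sym.
by apply: min_j; rewrite subn_gt0 lt_ij -[X in (_ < X)%N](subn0 j) ltn_sub2l ?(leq_trans _ lt_ij).
Qed.

Lemma comp_mateK : comp_mate (comp_mate v) = v.
Proof.
rewrite {1}/comp_mate embed_w length_w backstep // subnn /=.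
have /eqP-> : glue s == s by rewrite glue_outer outer_embed.
exact: embedK.
Qed.

Lemma comp_label_mate : comp_label (comp_mate v) = - comp_label v.
Proof.
rewrite /comp_label embed_w length_w -/s -/j.
have trE u : \sum_(t <- traject step u j) slabel t = \sum_(i < j) slabel (iter i step u).
  rewrite (big_nth u) size_traject big_mkord; apply: eq_bigr => i _.
  by rewrite nth_traject.
rewrite !trE -sumrN [RHS](reindex_inj rev_ord_inj) /=.
by apply: eq_bigr => i _; rewrite backlabel.
Qed.

Lemma comp_mate_neq : comp_mate v != v.
Proof.
apply/eqP => fix_v; have [_ min_j] := path_lengthP (outer_embed v).
have ws : w = s by rewrite -embed_w fix_v.
have back i : (i <= j)%N -> iter i step s = glue (iter (j - i) step s).
  by move=> le_ij; rewrite -[in LHS]ws backstep.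
have j_halves := odd_double_half j.
case: (boolP (odd j)) j_halves => [_|_] /= ej.
  have le1 : (j./2.+1 <= j)%N by rewrite -[X in (_ <= X)%N]ej -addnn ltnS leq_addr.
  have := back _ le1; rewrite -{2}ej -addnn add1n subSS addKn iterS /step.
  by move/(inv_inj glueK)/eqP; rewrite (negPf (smate_neq _)).
rewrite add0n in ej; have j0 : (0 < j)%N by [].
have h0 : (0 < j./2)%N by rewrite -double_gt0 ej.
have le1 : (j./2 < j)%N by rewrite -[X in (_ < X)%N]ej -addnn -{1}[j./2]addn0 ltn_add2l.
have := back _ (ltnW le1); rewrite -{2}ej -addnn addKn => /esym/eqP.
by rewrite glue_outer (negPf (min_j _ _)) // h0.
Qed.

End Path.

Fact comp_is_diagram :
  is_diagram ([ffun v => comp_mate v], [ffun v => comp_label v]).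
Proof.
apply/forallP => v; rewrite !ffunE /= comp_mate_neq comp_mateK comp_label_mate.
by rewrite !eqxx.
Qed.

Definition dcomp : diagram := Sub _ comp_is_diagram.

(* The orbit of (true, inl c) under step is the strand of the stack through   *)
(* the central node c, oriented downwards at c.                               *)
Definition leftmost_on_loop (c : 'I_n) : bool :=
  let loop := orbit step (true, inl c) in
  ~~ has outer loop && all (fun s => (c <= position s)%N) loop.

Definition loop_label (c : 'I_n) : Zm m :=
  \sum_(s <- orbit step (true, inl c)) slabel s.

Definition loop_scalar (k : fieldType) (delta : {ffun Zm m -> k}) : k :=
  \prod_(c | leftmost_on_loop c) delta (loop_label c).

End Stack.
End Diagrams.

(* B is the cyclotomic Brauer algebra with parameter delta: it has a basis    *)
(* indexed by the reduced diagrams, multiplied by stacking. An explicit B is  *)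
(* constructed in cyclotomic_brauerP at the end of this file when             *)
(* delta (- i) = delta i for all i. For n >= 2 there is no B otherwise, as    *)
(* the product is then not associative: if x has a southern arc joining 1     *)
(* and 2, z the northern one, and y crosses the strands 1 and 2, then the     *)
(* resulting loop has opposite orientations in (x y) z and in x (y z).        *)
Definition is_cyclotomic_brauer (k : fieldType) (m : nat)
    (delta : {ffun Zm m -> k}) (n : nat) (B : falgType k) : Prop :=
  exists2 b : diagram m n -> B, basis_of {:B} (codom b) &
  forall x y, b x * b y = loop_scalar x y delta *: b (dcomp x y).

Definition has_characteristic (k : fieldType) (p : nat) : Prop :=
  if p is 0 then [pchar k] =i pred0 else p \in [pchar k].

(* Associativity of the diagram product. In a stack of any height one follows *)
(* the strands with tu \o sg, where sg exchanges the ends of a strand and tu  *)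
(* the two copies of a central node.                                          *)
Section Net.

Variables (S : finType) (G : zmodType) (sg tu : S -> S) (l : S -> G).
Hypotheses (sgK : involutive sg) (tuK : involutive tu).
Hypothesis l_sg : forall s, l (sg s) = - l s.

Definition net_step (s : S) : S := tu (sg s).
Local Notation pi := net_step.

Lemma net_step_inj : injective pi.
Proof. exact: inj_comp (inv_inj tuK) (inv_inj sgK). Qed.

Lemma net_sym s t : fconnect pi s t = fconnect pi t s.
Proof. exact: (fconnect_sym net_step_inj). Qed.

Lemma net_tu s t : fconnect pi (tu s) (tu t) = fconnect pi s t.
Proof.
suff H u v : fconnect pi u v -> fconnect pi (tu u) (tu v).
  by apply/idP/idP => /H; rewrite ?tuK.
move=> /iter_findex <-; elim: (findex pi u v) => [|i IH]; first exact: connect0.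
apply: connect_trans IH _; rewrite net_sym; apply: connect1; apply/eqP.
by rewrite iterS /pi tuK sgK.
Qed.

Definition net_tot (s : S) : G := \sum_(u | fconnect pi s u) l u.

Lemma net_totE s : \sum_(u <- orbit pi s) l u = net_tot s.
Proof.
rewrite big_uniq ?orbit_uniq //=; apply: eq_bigl => u.
by rewrite fconnect_orbit.
Qed.

Lemma net_tot_iter s : net_tot s = \sum_(i < order pi s) l (iter i pi s).
Proof.
rewrite -net_totE /orbit (big_nth s) size_traject big_mkord.
by apply: eq_bigr => i _; rewrite nth_traject.
Qed.

Lemma net_tot_tu s : net_tot (tu s) = - net_tot s.
Proof.
rewrite /net_tot (reindex_inj (inv_inj sgK)) -sumrN /=.
apply: eq_big => [u|u _]; last exact: l_sg.
rewrite -[sg u]tuK net_tu; apply: same_connect_r; first exact: net_sym.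
by rewrite net_sym; apply: connect1; apply/eqP.
Qed.

Lemma net_tot_eq s t : fconnect pi s t -> net_tot t = net_tot s.
Proof. by move=> st; apply: eq_bigl => u; rewrite (same_connect net_sym st). Qed.

Definition net_conn (s t : S) : bool := fconnect pi s t || fconnect pi (tu s) t.

Lemma net_connC s t : net_conn s t = net_conn t s.
Proof.
by rewrite /net_conn net_sym; congr (_ || _); rewrite -net_tu tuK net_sym.
Qed.

Lemma net_conn_tot s t : net_conn s t -> net_tot t = net_tot s \/ net_tot t = - net_tot s.
Proof. by case/orP=> /net_tot_eq->; [left | right; rewrite net_tot_tu]. Qed.

Lemma net_conn_trans s t u : net_conn s t -> net_conn t u -> net_conn s u.
Proof.
rewrite /net_conn => /orP[] st /orP[] tu'; apply/orP.
- by left; apply: connect_trans tu'.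
- by right; apply: connect_trans tu'; rewrite net_tu.
- by right; apply: connect_trans tu'.
- by left; apply: connect_trans tu'; rewrite -net_tu tuK.
Qed.

Definition net_closed (s : S) : bool := [forall u, fconnect pi s u ==> (tu u != u)].

Lemma net_closedP s : reflect (forall u, fconnect pi s u -> tu u != u) (net_closed s).
Proof. exact: 'forall_implyP. Qed.

Lemma net_closed_conn s t : net_conn s t -> net_closed s -> net_closed t.
Proof.
case/orP=> st /net_closedP cl; apply/net_closedP => u tu'.
  by apply: cl; apply: connect_trans tu'.
rewrite -(inj_eq (inv_inj tuK)); apply: cl.
by rewrite -net_tu tuK; apply: connect_trans tu'.
Qed.

Definition net_path (s t : S) (c : G) : Prop :=
  exists Q, [/\ (0 < Q)%N, iter Q pi s = t, tu t = t,
    forall i, (0 < i < Q)%N -> tu (iter i pi s) != iter i pi s &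
    c = \sum_(i < Q) l (iter i pi s)].

Lemma net_path_uniq s t c t' c' : net_path s t c -> net_path s t' c' ->
  t = t' /\ c = c'.
Proof.
case=> Q [Q0 <- tt minQ ->] [Q' [Q'0 <- tt' minQ' ->]].
suff -> : Q = Q' by [].
case: (ltngtP Q Q') => // lt.
  by have := minQ' Q; rewrite Q0 lt tt eqxx => /(_ isT).
by have := minQ Q'; rewrite Q'0 lt tt' eqxx => /(_ isT).
Qed.

End Net.

Lemma prod_rel (R : comPzRingType) (I J : finType) (P : pred I) (Q : pred J)
    (F : I -> R) (H : J -> R) (rl : I -> J -> bool) :
  (forall i, P i -> exists2 j, Q j & rl i j) ->
  (forall j, Q j -> exists2 i, P i & rl i j) ->
  (forall i j j', P i -> Q j -> Q j' -> rl i j -> rl i j' -> j = j') ->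
  (forall i i' j, P i -> P i' -> Q j -> rl i j -> rl i' j -> i = i') ->
  (forall i j, P i -> Q j -> rl i j -> F i = H j) ->
  \prod_(i | P i) F i = \prod_(j | Q j) H j.
Proof.
move=> exj exi uj ui FH.
rewrite (eq_bigr (fun i => \prod_(j | Q j && rl i j) H j)); last first.
  move=> i Pi; have [j Qj rij] := exj i Pi.
  rewrite (big_pred1 j) ?(FH i j) // => j'; apply/andP/eqP => [[Qj' rij']|-> //].
  exact: (uj i).
rewrite (exchange_big_dep Q) //=; last by move=> i j _ /andP[].
apply: eq_bigr => j Qj; have [i Pi rij] := exi j Qj.
rewrite (big_pred1 i) // => i' /=; apply/andP/eqP => [[Pi' /andP[_ rij']]|->].
  exact: (ui _ _ j).
by rewrite Pi Qj rij.
Qed.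

Section StackNet.

Variables (m n : nat) (x y : diagram m n).
Local Notation snode := (bool * node n)%type.
Local Notation pi := (step x y).
Local Notation conn := (net_conn (smate x y) (@glue n)).
Local Notation closed := (net_closed (smate x y) (@glue n)).
Local Notation tot := (net_tot (smate x y) (@glue n) (slabel x y)).

Lemma stepE : net_step (smate x y) (@glue n) = pi. Proof. by []. Qed.

Lemma outer_glue (s : snode) : outer (glue s) = outer s.
Proof. by case: s => [[] []]. Qed.

Lemma loop_labelE c : loop_label x y c = tot (true, inl c).
Proof. exact: net_totE. Qed.

Lemma leftmostP c : reflect
  (closed (true, inl c) /\
   forall s, fconnect pi (true, inl c) s -> (c <= position s)%N)
  (leftmost_on_loop x y c).
Proof.
apply: (iffP andP) => [[/hasPn no /allP le]|[/net_closedP cl le]].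
  split=> [|s]; last by rewrite fconnect_orbit => /le.
  by apply/net_closedP => u; rewrite stepE fconnect_orbit glue_outer => /no.
split; [apply/hasPn | apply/allP] => s; rewrite -fconnect_orbit => cs.
  by rewrite -glue_outer; apply: cl.
exact: le.
Qed.

Lemma leftmost_ex s : closed s ->
  exists2 c, leftmost_on_loop x y c & conn s (true, inl c).
Proof.
move=> cl; pose P u := conn s u; have Ps : P s by rewrite /P /net_conn connect0.
case: (@arg_minnP _ s P (@position n) Ps) => u Pu min_u.
have [clK smK] := (@glueK n, @smateK _ _ x y).
have clu := net_closed_conn smK clK Pu cl.
have nou : ~~ outer u by rewrite -glue_outer; apply: (net_closedP _ _ _ clu); apply: connect0.
pose w : snode := (true, inl (position u)).
have uw : conn u w.
  move: nou; rewrite /w /net_conn; case: (u) => [[] [] i] //= _; rewrite connect0 ?orbT //.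
have sw := net_conn_trans smK clK Pu uw.
exists (position u) => //; apply/leftmostP; split; first exact: net_closed_conn sw cl.
move=> t wt; apply: min_u; apply: net_conn_trans sw _ => //.
by rewrite /net_conn wt.
Qed.

Lemma leftmost_uniq c c' : leftmost_on_loop x y c -> leftmost_on_loop x y c' ->
  conn (true, inl c) (true, inl c') -> c = c'.
Proof.
have [clK smK] := (@glueK n, @smateK _ _ x y).
have le a a' : leftmost_on_loop x y a -> conn (true, inl a) (true, inl a') -> (a <= a')%N.
  case/leftmostP=> _ min_a /orP[/min_a //|].
  by rewrite -(net_tu smK clK) clK => /min_a.
move=> lc lc' cc'; apply/val_inj/eqP; rewrite eqn_leq le //= le //.
by rewrite net_connC.
Qed.

Lemma comp_net_path v :
  net_path (smate x y) (@glue n) (slabel x y) (embed v) (embed (comp_mate x y v))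
    (comp_label x y v).
Proof.
have [oj min_j] := path_lengthP x y (outer_embed v).
exists (path_length x y (embed v)); split=> //.
- by rewrite /comp_mate outerK.
- by apply/eqP; rewrite glue_outer outer_embed.
- by move=> i /min_j; rewrite glue_outer.
rewrite /comp_label (big_nth (embed v)) size_traject big_mkord.
by apply: eq_bigr => i _; rewrite nth_traject.
Qed.

End StackNet.

(* A net containing a stack of d1 above d2 (embedded by g), and the coarser   *)
(* stack of x above y obtained by composing them (embedded by f).             *)
Record coarsening (m n : nat) (S : finType) (sg tu : S -> S) (l : S -> Zm m)
    (d1 d2 x y : diagram m n) (b : bool) (f g : bool * node n -> S) : Prop :=
  Coarsening {
  _ : involutive sg;
  _ : involutive tu;
  _ : forall s, l (sg s) = - l s;
  _ : injective f;
  _ : injective g;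
  _ : forall v, f (b, v) = g (embed v);
  _ : forall v, sg (f (~~ b, v)) = f (smate x y (~~ b, v));
  _ : forall v, l (f (~~ b, v)) = slabel x y (~~ b, v);
  _ : (if b then y else x) = dcomp d1 d2;
  _ : forall u, tu (f u) = f (glue u);
  _ : forall t, sg (g t) = g (smate d1 d2 t);
  _ : forall t, l (g t) = slabel d1 d2 t;
  _ : forall t, ~~ outer t -> tu (g t) = g (glue t);
  _ : forall s, (exists u, s = f u) \/ (exists2 t, ~~ outer t & s = g t);
  _ : forall u t, ~~ outer t -> f u <> g t }.

Section Coarse.

Variables (m n : nat) (S : finType) (sg tu : S -> S) (l : S -> Zm m).
Variables (d1 d2 x y : diagram m n) (b : bool) (f g : bool * node n -> S).
Hypothesis H : coarsening sg tu l d1 d2 x y b f g.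

Let sgK : involutive sg.
Proof. by case: H. Qed.
Let tuK : involutive tu.
Proof. by case: H. Qed.
Let l_sg : forall s, l (sg s) = - l s.
Proof. by case: H. Qed.
Let f_inj : injective f.
Proof. by case: H. Qed.
Let g_inj : injective g.
Proof. by case: H. Qed.
Let fg_comp : forall v, f (b, v) = g (embed v).
Proof. by case: H. Qed.
Let f_mate : forall v, sg (f (~~ b, v)) = f (smate x y (~~ b, v)).
Proof. by case: H. Qed.
Let f_label : forall v, l (f (~~ b, v)) = slabel x y (~~ b, v).
Proof. by case: H. Qed.
Let comp_layer : (if b then y else x) = dcomp d1 d2.
Proof. by case: H. Qed.
Let f_glue : forall u, tu (f u) = f (glue u).
Proof. by case: H. Qed.
Let g_mate : forall t, sg (g t) = g (smate d1 d2 t).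
Proof. by case: H. Qed.
Let g_label : forall t, l (g t) = slabel d1 d2 t.
Proof. by case: H. Qed.
Let g_glue : forall t, ~~ outer t -> tu (g t) = g (glue t).
Proof. by case: H. Qed.
Let cover : forall s, (exists u, s = f u) \/ (exists2 t, ~~ outer t & s = g t).
Proof. by case: H. Qed.
Let disj : forall u t, ~~ outer t -> f u <> g t.
Proof. by case: H. Qed.

Local Notation pi := (net_step sg tu).
Local Notation pi' := (step x y).
Local Notation pi2 := (step d1 d2).

Let g_pi t : ~~ outer (pi2 t) -> pi (g t) = g (pi2 t).
Proof. by rewrite outer_glue => no; rewrite /net_step g_mate g_glue. Qed.

Let g_iter t i : (forall j, (0 < j <= i)%N -> ~~ outer (iter j pi2 t)) ->
  iter i pi (g t) = g (iter i pi2 t).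
Proof.
elim: i => [//|i IH] no; rewrite iterS IH => [|j /andP[j0 ji]].
  by rewrite g_pi -?iterS ?no ?leqnn.
by rewrite no // j0 leqW.
Qed.

Let coarse u : exists q, [/\ (0 < q)%N, iter q pi (f u) = f (pi' u),
  forall i, (0 < i < q)%N -> exists2 t, ~~ outer t & iter i pi (f u) = g t &
  \sum_(i < q) l (iter i pi (f u)) = slabel x y u].
Proof.
case: (boolP (u.1 == b)) => ub; last first.
  exists 1%N; have -> : u = (~~ b, u.2) by case: u b ub => [[] v] [].
  split=> //; first by rewrite /= /net_step f_mate f_glue.
    by case.
  by rewrite big_ord1 f_label.
have {ub} -> : u = (b, u.2) by case: u ub => [c v] /= /eqP->.
move: (u.2) => v {u}; have [j [j0 jE _ min_j sum_j]] := comp_net_path d1 d2 v.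
have no i : (0 < i < j)%N -> ~~ outer (iter i pi2 (embed v)).
  by move/min_j; rewrite glue_outer.
have gi i : (i < j)%N -> iter i pi (g (embed v)) = g (iter i pi2 (embed v)).
  move=> ij; apply: g_iter => a /andP[a0 ai]; apply: no.
  by rewrite a0 (leq_ltn_trans ai).
exists j; rewrite fg_comp; split=> //.
- rewrite -(prednK j0) iterS gi ?prednK // /net_step g_mate.
  have -> : smate d1 d2 (iter j.-1 pi2 (embed v)) = embed (comp_mate d1 d2 v).
    rewrite -jE -[in RHS](prednK j0) iterS stepE /step.
    apply/esym/eqP; rewrite glue_outer -outer_glue -[glue _]/(pi2 _).
    by rewrite -iterS prednK // -stepE jE outer_embed.
  rewrite -fg_comp f_glue /step /smate /= comp_layer.
  by rewrite /mate /= ffunE.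
- by move=> i /[dup] /andP[_ ij] /no no_i; exists (iter i pi2 (embed v)); rewrite ?gi.
rewrite (eq_bigr (fun i : 'I_j => slabel d1 d2 (iter i pi2 (embed v)))) => [|i _].
  by rewrite -[LHS]sum_j /slabel /= comp_layer /label /= ffunE.
by rewrite gi // g_label.
Qed.

Let coarse_iter u a : exists Q, [/\ iter Q pi (f u) = f (iter a pi' u), (0 < Q)%N = (0 < a)%N,
  forall i, (0 < i < Q)%N -> (exists2 t, ~~ outer t & iter i pi (f u) = g t) \/
    (exists2 c, (0 < c < a)%N & iter i pi (f u) = f (iter c pi' u)) &
  \sum_(i < Q) l (iter i pi (f u)) = \sum_(c < a) slabel x y (iter c pi' u)].
Proof.
elim: a => [|a [Q [QE aQ int sumQ]]].
  by exists 0%N; split=> //; [case | rewrite !big_ord0].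
have [q [q0 qE intq sumq]] := coarse (iter a pi' u).
exists (Q + q)%N; split.
- by rewrite addnC iterD QE qE.
- by rewrite addn_gt0 q0 orbT.
- move=> i /andP[i0 iQ]; case: (ltngtP i Q) => [lt|gt|iQE].
  + have [|[t nt tE]|[c /andP[c0 ca] cE]] := int i; first by rewrite i0.
      by left; exists t.
    by right; exists c => //; rewrite c0 ltnW.
  + have [|t nt tE] := intq (i - Q)%N; first by rewrite subn_gt0 gt ltn_subLR // ltnW.
    by left; exists t => //; rewrite -tE -QE -iterD subnK // ltnW.
  + by right; exists a; rewrite ?iQE // -aQ -iQE i0 ltnSn.
rewrite big_ord_recr /= -sumQ -sumq big_split_ord /=; congr (_ + _).
by apply: eq_bigr => i _; rewrite addnC iterD QE.
Qed.

Let f_outer u : (tu (f u) == f u) = outer u.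
Proof. by rewrite f_glue (inj_eq f_inj) glue_outer. Qed.

Let g_inner t : ~~ outer t -> tu (g t) != g t.
Proof. by move=> nt; rewrite g_glue // (inj_eq g_inj) glue_outer. Qed.

Lemma coarse_path v : net_path sg tu l (f (embed v)) (f (embed (comp_mate x y v)))
  (comp_label x y v).
Proof.
have [j [j0 jE ot min_j sum_j]] := comp_net_path x y v.
have [Q [QE Q0 int sumQ]] := coarse_iter (embed v) j; exists Q; split.
- by rewrite Q0.
- by rewrite QE -jE.
- by apply/eqP; rewrite f_outer outer_embed.
- move=> i /int[[t nt ->]|[c /min_j no ->]]; first exact: g_inner.
  by rewrite f_outer -glue_outer.
by rewrite sum_j -sumQ.
Qed.

Local Notation conn := (net_conn sg tu).
Local Notation conn' := (net_conn (smate x y) (@glue n)).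
Local Notation conn2 := (net_conn (smate d1 d2) (@glue n)).
Local Notation closed := (net_closed sg tu).
Local Notation closed' := (net_closed (smate x y) (@glue n)).
Local Notation closed2 := (net_closed (smate d1 d2) (@glue n)).

(* The orbit of f u consists of the images of the orbit of u and of inner     *)
(* nodes of the stack of d1 above d2.                                         *)
Let f_orbit u : exists Q, [/\ iter Q pi (f u) = f u,
  forall s, fconnect pi (f u) s -> exists2 i, (i < Q)%N & s = iter i pi (f u),
  forall i, (0 < i < Q)%N -> (exists2 t, ~~ outer t & iter i pi (f u) = g t) \/
    (exists2 c, (0 < c < order pi' u)%N & iter i pi (f u) = f (iter c pi' u)) &
  (0 < Q)%N /\ \sum_(i < Q) l (iter i pi (f u))
    = \sum_(c < order pi' u) slabel x y (iter c pi' u)].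
Proof.
have [Q [QE Q0 int sumQ]] := coarse_iter u (order pi' u).
rewrite (iter_order (@step_inj _ _ x y)) order_gt0 in QE Q0.
exists Q; split=> // s /iter_findex <-.
exists (findex pi (f u) s %% Q)%N; first by rewrite ltn_mod Q0.
by rewrite {1}(divn_eq (findex pi (f u) s) Q) addnC iterD iterM (iter_fix _ QE).
Qed.

Let f_fconnect u u' : fconnect pi (f u) (f u') = fconnect pi' u u'.
Proof.
apply/idP/idP => [fu|/iter_findex <-]; last first.
  have [Q [QE _ _ _]] := coarse_iter u (findex pi' u u').
  by rewrite -QE fconnect_iter.
have [Q [_ orb int _]] := f_orbit u.
have [[|i] iQ fi] := orb _ fu; first by rewrite (f_inj fi) connect0.
have [//|[t nt tE]|[c _ cE]] := int i.+1; first by case: (disj nt (etrans fi tE)).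
by rewrite (f_inj (etrans fi cE)) fconnect_iter.
Qed.

Let f_conn u u' : conn (f u) (f u') = conn' u u'.
Proof. by rewrite /net_conn f_glue !f_fconnect. Qed.

Let f_closed u : closed (f u) = closed' u.
Proof.
apply/net_closedP/net_closedP => cl s.
  by rewrite -f_fconnect => /cl; rewrite f_glue (inj_eq f_inj).
case: (cover s) => [[u' ->]|[t nt ->] _]; last exact: g_inner.
by rewrite f_fconnect f_glue (inj_eq f_inj) => /cl.
Qed.

Let f_tot u : net_tot sg tu l (f u) = net_tot (smate x y) (@glue n) (slabel x y) u.
Proof.
have [Q [QE orb int [Q0 sumQ]]] := f_orbit u.
rewrite !net_tot_iter stepE -sumQ; suff -> : order pi (f u) = Q by [].
apply/eqP; rewrite eqn_leq; apply/andP; split.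
  rewrite /order.
  pose h (i : 'I_Q) := iter i pi (f u).
  apply: leq_trans (_ : #|codom h| <= Q)%N; last by rewrite (leq_trans (leq_image_card _ _)) ?card_ord.
  by apply: subset_leq_card; apply/subsetP => s /orb[i iQ ->]; apply/codomP; exists (Ordinal iQ).
rewrite leqNgt; apply/negP => lt.
have io := iter_order (net_step_inj sgK tuK) (f u).
have [|[t nt tE]|[c /andP[c0 clt] cE]] := int (order pi (f u)).
- by rewrite order_gt0.
- by case: (disj nt (etrans (esym io) tE)).
have := f_inj (etrans (esym io) cE); move/(congr1 (findex pi' u)).
by rewrite findex0 findex_iter // => c0'; rewrite -c0' in c0.
Qed.

Let g_fconnect t s : closed2 t -> fconnect pi (g t) s ->
  exists2 t', fconnect pi2 t t' & s = g t'.
Proof.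
move=> /net_closedP cl /iter_findex <-; set i := findex _ _ _.
exists (iter i pi2 t); first exact: fconnect_iter.
apply: g_iter => j _; rewrite -glue_outer; apply: cl; exact: fconnect_iter.
Qed.

Let g_closed t : closed2 t -> closed (g t).
Proof.
move=> clt; apply/net_closedP => s /(g_fconnect clt)[t' tt' ->].
apply: g_inner; rewrite -glue_outer; exact: (net_closedP _ _ _ clt).
Qed.

Let g_tot t : closed2 t ->
  net_tot sg tu l (g t) = net_tot (smate d1 d2) (@glue n) (slabel d1 d2) t.
Proof.
move=> clt; rewrite !net_tot_iter stepE.
have gi i : iter i pi (g t) = g (iter i pi2 t).
  apply: g_iter => j _; rewrite -glue_outer; apply: (net_closedP _ _ _ clt).
  exact: fconnect_iter.
have -> : order pi (g t) = order pi2 t.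
  rewrite /order -(card_image g_inj); apply: eq_card => s.
  apply/idP/imageP => [/(g_fconnect clt)[t' tt' ->]|[t' /iter_findex <- ->]].
    by exists t'.
  by rewrite -gi inE fconnect_iter.
by apply: eq_bigr => i _; rewrite gi g_label.
Qed.

Let g_conn t t' : closed2 t -> conn (g t) (g t') -> conn2 t t'.
Proof.
move=> clt.
have nt : ~~ outer t by rewrite -glue_outer; apply: (net_closedP _ _ _ clt); apply: connect0.
have clt' : closed2 (glue t).
  apply: net_closed_conn clt; try exact: glueK; try exact: smateK.
  by rewrite /net_conn connect0 orbT.
rewrite /net_conn g_glue // => /orP[] /g_fconnect[] // u tu' /g_inj->.
  by rewrite tu'.
by rewrite tu' orbT.
Qed.

Let fg_conn u t : closed2 t -> conn (g t) (f u) -> False.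
Proof.
move=> clt; have nt : ~~ outer t by rewrite -glue_outer; apply: (net_closedP _ _ _ clt); apply: connect0.
have clt' : closed2 (glue t).
  apply: net_closed_conn clt; try exact: glueK; try exact: smateK.
  by rewrite /net_conn connect0 orbT.
rewrite /net_conn g_glue // => /orP[] /g_fconnect[] // s ts.
  by apply: disj; rewrite -glue_outer; apply: (net_closedP _ _ _ clt).
by apply: disj; rewrite -glue_outer; apply: (net_closedP _ _ _ clt').
Qed.

(* The leftmost nodes of the loops of the two stacks represent the loops of   *)
(* the net.                                                                   *)
Definition coarse_loop (i : 'I_n + 'I_n) : bool :=
  match i with
  | inl c => leftmost_on_loop d1 d2 c
  | inr c => leftmost_on_loop x y c
  end.

Definition coarse_rep (i : 'I_n + 'I_n) : S :=
  match i with inl c => g (true, inl c) | inr c => f (true, inl c) end.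

Lemma coarse_rep_closed i : coarse_loop i -> closed (coarse_rep i).
Proof.
case: i => c /leftmostP[cl _]; first exact: g_closed.
by rewrite /= f_closed.
Qed.

Lemma coarse_rep_ex s : closed s -> exists2 i, coarse_loop i & conn s (coarse_rep i).
Proof.
have fcase u : closed (f u) -> exists2 i, coarse_loop i & conn (f u) (coarse_rep i).
  rewrite f_closed => /leftmost_ex[c lc uc]; exists (inr c) => //=.
  by rewrite f_conn.
move=> cls; case: (cover s) cls => [[u ->]|[t nt ->]]; first exact: fcase.
move=> clt; case: (boolP (closed2 t)) => [cl2|].
  have [c lc tc] := leftmost_ex cl2; exists (inl c) => //=.
  move: tc; rewrite /net_conn g_glue //.
  have gf t' t'' : closed2 t' -> fconnect pi2 t' t'' -> fconnect pi (g t') (g t'').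
    move=> cl' /iter_findex <-; rewrite -g_iter ?fconnect_iter // => j _.
    by rewrite -glue_outer; apply: (net_closedP _ _ _ cl'); apply: fconnect_iter.
  case/orP=> [/gf->//|/gf->]; rewrite ?orbT //.
  apply: net_closed_conn cl2; try exact: glueK; try exact: smateK.
  by rewrite /net_conn connect0 orbT.
rewrite negb_forall => /existsP[u]; rewrite negb_imply negbK => /andP[tu' /eqP ou].
have [a oa] : exists a, outer (iter a pi2 t).
  by exists (findex pi2 t u); rewrite iter_findex // -glue_outer ou.
have : exists a, outer (iter a pi2 t) by exists a.
case/ex_minnP=> -[|c] oc min_c; first by rewrite (negPf nt) in oc.
have gc : iter c pi (g t) = g (iter c pi2 t).
  apply: g_iter => j /andP[_ jc]; apply/negP => /min_c; by rewrite leqNgt ltnS jc.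
have gf : iter c.+1 pi (g t) = f (glue (b, (iter c.+1 pi2 t).2)).
  rewrite -f_glue fg_comp outerK // iterS gc /net_step g_mate; congr (tu (g _)).
  by apply/esym/eqP; rewrite iterS /step glue_outer -outer_glue.
have tf : fconnect pi (g t) (f (glue (b, (iter c.+1 pi2 t).2))).
  by rewrite -gf fconnect_iter.
have tf' : conn (g t) (f (glue (b, (iter c.+1 pi2 t).2))) by rewrite /net_conn tf.
have [i li ci] := fcase _ (net_closed_conn sgK tuK tf' clt).
by exists i => //; apply: net_conn_trans tf' ci.
Qed.

Lemma coarse_rep_uniq i i' : coarse_loop i -> coarse_loop i' ->
  conn (coarse_rep i) (coarse_rep i') -> i = i'.
Proof.
case: i i' => c [] c' /= lc lc' cc'.
- have [cl _] := leftmostP _ _ _ lc.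
  by congr inl; apply: leftmost_uniq lc lc' _; apply: g_conn.
- by have [/fg_conn/(_ cc')] := leftmostP _ _ _ lc.
- by have [/fg_conn cl _] := leftmostP _ _ _ lc'; case: (cl (true, inl c)); rewrite net_connC.
- by congr inr; apply: leftmost_uniq lc lc' _; rewrite -f_conn.
Qed.

Lemma coarse_tot s t : conn s t ->
  net_tot sg tu l t = net_tot sg tu l s \/ net_tot sg tu l t = - net_tot sg tu l s.
Proof. exact: net_conn_tot. Qed.

Lemma coarse_scalar (k : fieldType) (delta : {ffun Zm m -> k}) :
  loop_scalar d1 d2 delta * loop_scalar x y delta =
  \prod_(i | coarse_loop i) delta (net_tot sg tu l (coarse_rep i)).
Proof.
rewrite /loop_scalar big_sumType /=; congr (_ * _); apply: eq_bigr => c lc.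
  by rewrite loop_labelE g_tot //; have [] := leftmostP _ _ _ lc.
by rewrite loop_labelE f_tot.
Qed.

End Coarse.

Section Associativity.

Variables (m n : nat) (x y z : diagram m n).

(* The stack of x, y and z, whose layers are None, Some false, Some true.     *)
Local Notation snode := (bool * node n)%type.
Local Notation tnode := (option bool * node n)%type.

Let layer_of (o : option bool) : diagram m n :=
  match o with None => x | Some false => y | Some true => z end.

Let tmate (s : tnode) : tnode := (s.1, mate (layer_of s.1) s.2).
Let tlabel (s : tnode) : Zm m := label (layer_of s.1) s.2.
Let tglue (s : tnode) : tnode :=
  match s with
  | (None, inr c) => (Some false, inl c)
  | (Some false, inl c) => (None, inr c)
  | (Some false, inr c) => (Some true, inl c)
  | (Some true, inl c) => (Some false, inr c)
  | _ => s
  end.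

Let tmateK : involutive tmate.
Proof. by case=> o v; rewrite /tmate /= mateK. Qed.
Let tglueK : involutive tglue. Proof. by case=> [[[]|] []]. Qed.
Let tlabelN s : tlabel (tmate s) = - tlabel s.
Proof. by case: s => o v; rewrite /tlabel /= label_mate. Qed.

Let fl (s : snode) : tnode :=
  match s with
  | (false, inl i) => (None, inl i)
  | (false, inr i) => (Some false, inr i)
  | (true, v) => (Some true, v)
  end.
Let gl (s : snode) : tnode := if s.1 then (Some false, s.2) else (None, s.2).
Let fr (s : snode) : tnode :=
  match s with
  | (false, v) => (None, v)
  | (true, inl i) => (Some false, inl i)
  | (true, inr i) => (Some true, inr i)
  end.
Let gr (s : snode) : tnode := (Some s.1, s.2).

Let cl : coarsening tmate tglue tlabel x y (dcomp x y) z false fl gl.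
Proof.
split=> //.
- by do 2!case=> [[] []] ? //; case=> ->.
- by do 2!case=> [[] ?] //; case=> ->.
- by case.
- by case=> [[] []].
- by case=> [[]].
- by case=> [[]].
- by case=> [[] []].
- case=> [[[]|] [] i].
  + by left; exists (true, inl i).
  + by left; exists (true, inr i).
  + by right; exists (true, inl i).
  + by left; exists (false, inr i).
  + by left; exists (false, inl i).
  + by right; exists (false, inr i).
- by move=> [[] []] ? [[] []].
Qed.

Let cr : coarsening tmate tglue tlabel y z x (dcomp y z) true fr gr.
Proof.
split=> //.
- by do 2!case=> [[] []] ? //; case=> ->.
- by do 2!case=> [? ?]; case=> -> ->.
- by case.
- by case=> [[] []].
- by case=> [[] []].
- case=> [[[]|] [] i].
  + by right; exists (true, inl i).
  + by left; exists (true, inr i).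
  + by left; exists (true, inl i).
  + by right; exists (false, inr i).
  + by left; exists (false, inl i).
  + by left; exists (false, inr i).
- by move=> [[] []] ? [[] []].
Qed.

Lemma dcompA : dcomp x (dcomp y z) = dcomp (dcomp x y) z.
Proof.
have eqv v : comp_mate x (dcomp y z) v = comp_mate (dcomp x y) z v /\
    comp_label x (dcomp y z) v = comp_label (dcomp x y) z v.
  have flr u : fl (embed u) = fr (embed u) by case: u.
  have frK u : (fr (embed u)).2 = u by case: u.
  have := coarse_path cl v; rewrite !flr => /(net_path_uniq (coarse_path cr v)).
  by case=> eq_v ->; split=> //; rewrite -[LHS]frK eq_v frK.
by apply/val_inj; congr (_, _); apply/ffunP => v; rewrite !ffunE; case: (eqv v).
Qed.

Lemma loop_scalarA (k : fieldType) (delta : {ffun Zm m -> k}) :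
  (forall i, delta (- i) = delta i) ->
  loop_scalar y z delta * loop_scalar x (dcomp y z) delta =
  loop_scalar x y delta * loop_scalar (dcomp x y) z delta.
Proof.
move=> delta_sym; rewrite (coarse_scalar cl) (coarse_scalar cr).
apply: (prod_rel (rl := fun i j => net_conn tmate tglue (coarse_rep fr gr i) (coarse_rep fl gl j))).
- by move=> i /(coarse_rep_closed cr)/(coarse_rep_ex cl).
- move=> j /(coarse_rep_closed cl)/(coarse_rep_ex cr)[i Pi ij].
  by exists i => //; rewrite net_connC.
- move=> i j j' _ Qj Qj' ij ij'; apply: (coarse_rep_uniq cl) => //.
  by apply: net_conn_trans ij' => //; rewrite net_connC.
- move=> i i' j Pi Pi' _ ij ij'; apply: (coarse_rep_uniq cr) => //.
  by apply: net_conn_trans ij _ => //; rewrite net_connC.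
by move=> i j _ _ /(coarse_tot cr)[] ->; rewrite ?delta_sym.
Qed.

End Associativity.

Section IdentityDiagram.

Variables (m n : nat).

Definition id_mate (v : node n) : node n :=
  match v with inl i => inr i | inr i => inl i end.

Fact id_is_diagram : is_diagram ([ffun v => id_mate v], [ffun=> 0 : Zm m]).
Proof.
by apply/forallP => v; rewrite /= !ffunE oppr0 eqxx andbT; case: v => i /=.
Qed.

Definition did : diagram m n := Sub _ id_is_diagram.

Let mate_did v : mate did v = id_mate v. Proof. by rewrite /mate ffunE. Qed.
Let label_did v : label did v = 0. Proof. by rewrite /label ffunE. Qed.

Let path_ext (x y d : diagram m n) :
  (forall v, net_path (smate x y) (@glue n) (slabel x y) (embed v)
     (embed (mate d v)) (label d v)) -> dcomp x y = d.
Proof.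
move=> pd; have eqv v := net_path_uniq (comp_net_path x y v) (pd v).
apply/val_inj; case: d {pd} eqv => [[dm dl] dP] /= eqv.
congr (_, _); apply/ffunP => v; rewrite ffunE; have [eqm eql] := eqv v.
  by rewrite -[LHS]embedK eqm embedK.
by rewrite eql.
Qed.

Let smate1 (d : diagram m n) v : smate did d (false, v) = (false, id_mate v).
Proof. by rewrite /smate /= mate_did. Qed.
Let smate2 (d : diagram m n) v : smate d did (true, v) = (true, id_mate v).
Proof. by rewrite /smate /= mate_did. Qed.

Lemma dcomp1 d : dcomp did d = d.
Proof.
apply: path_ext => v.
have s1 i : net_step (smate did d) (@glue n) (false, inl i) = (true, inl i) by rewrite /net_step smate1.
have s1' i : net_step (smate did d) (@glue n) (false, inr i) = (false, inl i) by rewrite /net_step smate1.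
have s2 u : net_step (smate did d) (@glue n) (true, u) = glue (true, mate d u) by [].
have lE u : slabel did d (false, u) = 0 by rewrite /slabel label_did.
have lE' u : slabel did d (true, u) = label d u by [].
case: v => c; rewrite ?[embed (inl c)]/= ?[embed (inr c)]/=; case E: (mate d _) => [c'|c'].
- exists 3%N; rewrite /= s1 s2 E /= s1'; split=> //.
    by case=> [|[|[|i]]] //= _; rewrite s1 ?s2 ?E.
  by rewrite !big_ord_recl big_ord0 /= s1 s2 E /= !lE lE' addr0 add0r addr0.
- exists 2%N; rewrite /= s1 s2 E /=; split=> //.
    by case=> [|[|i]] //= _; rewrite s1.
  by rewrite !big_ord_recl big_ord0 /= s1 lE lE' addr0 add0r.
- exists 2%N; rewrite /= s2 E /= s1'; split=> //.
    by case=> [|[|i]] //= _; rewrite s2 E.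
  by rewrite !big_ord_recl big_ord0 /= s2 E /= lE lE' !addr0.
exists 1%N; rewrite /= s2 E; split=> //; first by case=> [|[]].
by rewrite big_ord1 lE'.
Qed.

Lemma dcompr1 d : dcomp d did = d.
Proof.
apply: path_ext => v.
have s1 i : net_step (smate d did) (@glue n) (true, inr i) = (false, inr i) by rewrite /net_step smate2.
have s1' i : net_step (smate d did) (@glue n) (true, inl i) = (true, inr i) by rewrite /net_step smate2.
have s2 u : net_step (smate d did) (@glue n) (false, u) = glue (false, mate d u) by [].
have lE u : slabel d did (true, u) = 0 by rewrite /slabel label_did.
have lE' u : slabel d did (false, u) = label d u by [].
case: v => c; rewrite ?[embed (inl c)]/= ?[embed (inr c)]/=; case E: (mate d _) => [c'|c'].
- exists 1%N; rewrite /= s2 E; split=> //; first by case=> [|[]].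
  by rewrite big_ord1 lE'.
- exists 2%N; rewrite /= s2 E /= s1'; split=> //.
    by case=> [|[|i]] //= _; rewrite s2 E.
  by rewrite !big_ord_recl big_ord0 /= s2 E /= lE lE' !addr0.
- exists 2%N; rewrite /= s1 s2 E /=; split=> //.
    by case=> [|[|i]] //= _; rewrite s1.
  by rewrite !big_ord_recl big_ord0 /= s1 lE lE' addr0 add0r.
exists 3%N; rewrite /= s1 s2 E /= s1'; split=> //.
  by case=> [|[|[|i]]] //= _; rewrite s1 ?s2 ?E.
by rewrite !big_ord_recl big_ord0 /= s1 s2 E /= !lE lE' addr0 add0r addr0.
Qed.

Lemma loop_scalar1 (k : fieldType) (delta : {ffun Zm m -> k}) d :
  loop_scalar did d delta = 1.
Proof.
rewrite /loop_scalar big_pred0 // => c; apply/negP => /leftmostP[/net_closedP cl _].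
have := cl (false, inl c); rewrite eqxx; suff -> : fconnect (net_step (smate did d) (@glue n)) (true, inl c) (false, inl c) by move/(_ isT).
rewrite net_sym; [|exact: smateK|exact: glueK].
by apply: connect1; rewrite /= /net_step smate1.
Qed.

Lemma loop_scalarr1 (k : fieldType) (delta : {ffun Zm m -> k}) d :
  loop_scalar d did delta = 1.
Proof.
rewrite /loop_scalar big_pred0 // => c; apply/negP => /leftmostP[/net_closedP cl _].
have := cl (true, inr c); rewrite eqxx; suff -> : fconnect (net_step (smate d did) (@glue n)) (true, inl c) (true, inr c) by move/(_ isT).
by apply: connect1; rewrite /= /net_step smate2.
Qed.

End IdentityDiagram.

(* The algebra with basis D and product x y = bp_scalar x y *: bp_mul x y.    *)
Record based_product (k : fieldType) (D : finType) := BasedProduct {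
  bp_mul : D -> D -> D;
  bp_scalar : D -> D -> k;
  bp_one : D;
  bp_mulA : forall x y z, bp_mul x (bp_mul y z) = bp_mul (bp_mul x y) z;
  bp_scalarA : forall x y z, bp_scalar y z * bp_scalar x (bp_mul y z)
    = bp_scalar x y * bp_scalar (bp_mul x y) z;
  bp_mul1 : forall x, bp_mul bp_one x = x;
  bp_mulr1 : forall x, bp_mul x bp_one = x;
  bp_scalar1 : forall x, bp_scalar bp_one x = 1;
  bp_scalarr1 : forall x, bp_scalar x bp_one = 1 }.

Section BasedAlgebra.

Variables (k : fieldType) (D : finType) (P : based_product k D).

Definition based_algebra of based_product k D : Type := {ffun D -> k^o}.
Local Notation B := (based_algebra P).

HB.instance Definition _ := Vector.copy B {ffun D -> k^o}.

Definition based_coef (u : B) (d : D) : k := u d.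

Definition based_basis (d : D) : B := [ffun d' => (d' == d)%:R : k].

Definition based_mul (u v : B) : B :=
  \sum_x \sum_y (based_coef u x * based_coef v y * bp_scalar P x y)
    *: based_basis (bp_mul P x y).

Let coefP u v : (forall d, based_coef u d = based_coef v d) -> u = v.
Proof. by move=> uv; apply/ffunP. Qed.
Let coef_lin d : linear (based_coef^~ d : B -> k^o).
Proof. by move=> a u v; rewrite /based_coef ffunE [X in X + _]ffunE. Qed.
Let coefL d := GRing.isLinear.Build _ _ _ _ (based_coef^~ d : B -> k^o) (coef_lin d).
Let coefF d : {linear B -> k^o} := HB.pack (based_coef^~ d : B -> k^o) (coefL d).
Let coefE a u v d :
  based_coef (a *: u + v) d = a * based_coef u d + based_coef v d.
Proof. exact: coef_lin. Qed.
Let coef0 d : based_coef 0 d = 0. Proof. exact: (linear0 (coefF d)). Qed.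
Let coef_sum I r (Q : pred I) (c : I -> k) (F : I -> B) d :
  based_coef (\sum_(i <- r | Q i) c i *: F i) d
    = \sum_(i <- r | Q i) c i * based_coef (F i) d.
Proof.
rewrite -[LHS]/(coefF d _) linear_sum; apply: eq_bigr => i _.
by rewrite linearZ.
Qed.
Let coef_basis d d' : based_coef (based_basis d) d' = (d' == d)%:R.
Proof. by rewrite /based_coef ffunE. Qed.

Let based_decomp (u : B) : u = \sum_d based_coef u d *: based_basis d.
Proof.
apply: coefP => d; rewrite coef_sum (bigD1 d) //= coef_basis eqxx mulr1.
by rewrite big1 ?addr0 // => d' nd; rewrite coef_basis eq_sym (negPf nd) mulr0.
Qed.

Let mul_linl v : linear (based_mul^~ v).
Proof.
move=> a u u'; rewrite /based_mul scaler_sumr -big_split; apply: eq_bigr => x _ /=.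
rewrite scaler_sumr -big_split; apply: eq_bigr => y _ /=.
by rewrite scalerA -scalerDl coefE !mulrDl !mulrA.
Qed.

Let mul_linr u : linear (based_mul u).
Proof.
move=> a v v'; rewrite /based_mul scaler_sumr -big_split; apply: eq_bigr => x _ /=.
rewrite scaler_sumr -big_split; apply: eq_bigr => y _ /=.
by rewrite scalerA -scalerDl coefE mulrDr mulrDl mulrCA !mulrA.
Qed.

Let ext1 (f g : B -> B) : linear f -> linear g ->
  (forall d, f (based_basis d) = g (based_basis d)) -> f =1 g.
Proof.
move=> fl gl fg u; pose F : {linear B -> B} := HB.pack f (GRing.isLinear.Build _ _ _ _ f fl).
pose G : {linear B -> B} := HB.pack g (GRing.isLinear.Build _ _ _ _ g gl).
rewrite (based_decomp u) -[LHS]/(F _) -[RHS]/(G _) !linear_sum.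
by apply: eq_bigr => d _; rewrite !linearZ /=; congr (_ *: _); apply: fg.
Qed.

Lemma based_mul_basis x y :
  based_mul (based_basis x) (based_basis y) =
  bp_scalar P x y *: based_basis (bp_mul P x y).
Proof.
rewrite /based_mul (bigD1 x) //= (bigD1 y) //= !coef_basis !eqxx !mul1r.
rewrite big1 => [|y' ny]; last first.
  by rewrite coef_basis (negPf ny) mulr0 mul0r scale0r.
rewrite big1 ?addr0 // => x' nx; rewrite big1 // => y' _.
by rewrite coef_basis (negPf nx) !mul0r scale0r.
Qed.

Let mulZl a u v : based_mul (a *: u) v = a *: based_mul u v.
Proof.
have := mul_linl v a u 0; rewrite addr0 => ->.
suff -> : based_mul 0 v = 0 by rewrite addr0.
by rewrite /based_mul big1 // => x _; rewrite big1 // => y _; rewrite coef0 !mul0r scale0r.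
Qed.
Let mulZr a u v : based_mul u (a *: v) = a *: based_mul u v.
Proof.
have := mul_linr u a v 0; rewrite addr0 => ->.
suff -> : based_mul u 0 = 0 by rewrite addr0.
by rewrite /based_mul big1 // => x _; rewrite big1 // => y _; rewrite coef0 mulr0 mul0r scale0r.
Qed.

Let mulA : associative based_mul.
Proof.
move=> u v w; move: u.
apply: (@ext1 _ (fun u => based_mul (based_mul u v) w)) => [|a u u'|x].
- exact: mul_linl.
- by rewrite !mul_linl.
move: v; apply: (@ext1 (fun v => based_mul _ (based_mul v w)) (fun v => based_mul (based_mul _ v) w)) => [a v v'|a v v'|y].
- by rewrite mul_linl mul_linr.
- by rewrite mul_linr mul_linl.
move: w; apply: ext1 => [a w w'||z].
- by rewrite !mul_linr.
- exact: mul_linr.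
by rewrite !based_mul_basis mulZl mulZr !based_mul_basis !scalerA bp_mulA bp_scalarA.
Qed.

Let mul1 : left_id (based_basis (bp_one P)) based_mul.
Proof.
apply: (@ext1 _ id) => [||d]; [exact: mul_linr|by []|].
by rewrite based_mul_basis bp_mul1 bp_scalar1 scale1r.
Qed.
Let mulr1' : right_id (based_basis (bp_one P)) based_mul.
Proof.
apply: (@ext1 (based_mul^~ _) id) => [||d]; [exact: mul_linl|by []|].
by rewrite based_mul_basis bp_mulr1 bp_scalarr1 scale1r.
Qed.
Let mulDl' : left_distributive based_mul +%R.
Proof. by move=> u v w; have := mul_linl w 1 u v; rewrite !scale1r. Qed.
Let mulDr' : right_distributive based_mul +%R.
Proof. by move=> u v w; have := mul_linr u 1 v w; rewrite !scale1r. Qed.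
Let neq0 : based_basis (bp_one P) != 0.
Proof.
apply/eqP => /(congr1 (based_coef^~ (bp_one P)))/eqP.
by rewrite coef_basis coef0 eqxx oner_eq0.
Qed.

HB.instance Definition _ := GRing.Zmodule_isNzRing.Build B
  mulA mul1 mulr1' mulDl' mulDr' neq0.
HB.instance Definition _ := GRing.Lmodule_isLalgebra.Build k B
  (fun a u v => esym (mulZl a u v)).
HB.instance Definition _ := GRing.Lalgebra_isAlgebra.Build k B
  (fun a u v => esym (mulZr a u v)).
HB.instance Definition _ := Algebra_isFalgebra.Build k B.

Lemma based_basisP : basis_of {:B} (codom based_basis).
Proof.
apply/andP; split.
  apply/eqP/vspaceP => u; rewrite memvf (based_decomp u); apply: rpred_sum => d _.
  by apply: rpredZ; apply: memv_span; apply: codom_f.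
have nthE (i : 'I_#|{: D}|) :
    (codom_tuple based_basis)`_i = based_basis (enum_val i).
  by rewrite (nth_map (enum_val i)) -?enum_val_nth // -cardE.
apply/(@freeP _ _ _ (codom_tuple based_basis)) => c c0 i.
have := congr1 (based_coef^~ (enum_val i)) c0; rewrite coef_sum coef0 (bigD1 i) //=.
rewrite nthE coef_basis eqxx mulr1 big1 ?addr0 // => j nj.
by rewrite nthE coef_basis (inj_eq enum_val_inj) eq_sym (negPf nj) mulr0.
Qed.

Lemma based_basisM x y :
  based_basis x * based_basis y = bp_scalar P x y *: based_basis (bp_mul P x y).
Proof. exact: based_mul_basis. Qed.

End BasedAlgebra.

Section CyclotomicBrauer.

Variables (k : fieldType) (m : nat) (delta : {ffun Zm m -> k}).
Hypothesis delta_sym : forall i, delta (- i) = delta i.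
Variable n : nat.

Definition brauer_product : based_product k (diagram m n) :=
  BasedProduct (@dcompA m n)
    (fun x y z => loop_scalarA x y z delta_sym)
    (@dcomp1 m n) (@dcompr1 m n)
    (loop_scalar1 delta) (loop_scalarr1 delta).

Definition cyclotomic_brauer : falgType k := based_algebra brauer_product.

Lemma cyclotomic_brauerP : is_cyclotomic_brauer delta n cyclotomic_brauer.
Proof.
exists (based_basis brauer_product); first exact: based_basisP.
exact: based_basisM.
Qed.

End CyclotomicBrauer.

(* Main.v *)
(** Only the dimension of the algebra and a few relations between diagrams enter.
For a module M over A_n put r_i(M) := dim e_i M - dim e_i A_n e_{i+1} M. Mackey-type
estimates bound the numbers r_i of restricted and induced modules, and an induction
on n gives dim M <= sum_i C(n,i) r_i(M), where C(n,i) counts the half diagrams with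
i labelled arcs on n points. For the regular module r_i <= C(n,i) (n-2i)! m^(n-2i),
and sum_i C(n,i)^2 (n-2i)! m^(n-2i) = (2n-1)!! m^n = dim A_n, so all these
inequalities are equalities. Hence the standard modules and the layers
A_n e_i A_n / A_n e_{i+1} A_n have the expected dimensions. Every module is built by
extensions from quotients of standard modules, with multiplicities bounded by the r_i;
a module attaining the dimension bound is then filtered by the standard modules
themselves, which gives (A5) and (A6), and the multiplication map of (A2)(ii) is a
surjection between spaces of equal dimension. (A2)(i) is Maschke's theorem for
Z/m wr S_n. *)

Require Import Defs.
From HB Require Import structures.
From Stdlib Require Import Classical_Prop Classical_Pred_Type.
From mathcomp Require Import all_boot all_order all_algebra all_field.
From mathcomp Require Import fingroup perm zify.

Set Implicit Arguments.
Unset Strict Implicit.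
Unset Printing Implicit Defensive.

Import GRing.Theory.

(** Tensor products are easy to map out of and hard to embed. Hence the maps built below between
    globalised, induced and restricted modules are surjections, the estimates are upper bounds, and
    injectivity comes out of a count at the end; the only lower bound is the number of diagrams. The
    number r_i(M) is the dimension of e_i (M / A_n e_(i+1) M), a module over A_(n-2i) modulo the
    ideal of its idempotent, which is a quotient of the group algebra of Z/m wr S_(n-2i). A standard
    module obtained from a simple L by i globalisations has r_i at most dim L and no other rank, so
    C(n,i) bounds what one unit of r_i contributes to the dimension. Nothing is lost in the
    induction because the bound for restriction is the transpose of the recursion that defines
    C(n,i). The idempotent is a cup-cap diagram divided by some nonzero delta_j; the label j is put
    on its southern arc, so that its square closes a loop of label j. *)

(** * Numbers of half diagrams *)

Section Counting.

Variable m : nat.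

(* The number of partial matchings of n points with i arcs labelled in Z/m. *)
Fixpoint halfd (n i : nat) : nat :=
  if n is n'.+1 then
    halfd n' i + (if i is i'.+1 then (n' - i'.*2) * m * halfd n' i' else 0)
  else i == 0.

Lemma halfd0 n : halfd n 0 = 1.
Proof. by elim: n => //= n ->. Qed.

Lemma halfdS n i : halfd n.+1 i.+1 = halfd n i.+1 + (n - i.*2) * m * halfd n i.
Proof. by []. Qed.

Lemma halfd_gt n i : n < i.*2 -> halfd n i = 0.
Proof.
elim: n i => [|n IH] [|i] // ni; rewrite halfdS IH; last by lia.
by rewrite (_ : n - i.*2 = 0) //; lia.
Qed.

Lemma halfd_gt0 n i : 0 < m -> i.*2 <= n -> 0 < halfd n i.
Proof.
move=> m0; elim: n i => [|n IH] [|i] //; first by rewrite halfd0.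
move=> ni; rewrite halfdS; case: (leqP i.+1.*2 n) => [/IH ni'|ni']; first by rewrite ltn_addr.
by rewrite ltn_addl // !muln_gt0 m0 IH; lia.
Qed.

(* The same numbers, indexed by the number l of unmatched points. *)
Fixpoint freed (n l : nat) : nat :=
  if n is n'.+1 then (if l is l'.+1 then freed n' l' else 0) + l.+1 * m * freed n' l.+1
  else l == 0.

Lemma freed_gt n l : n < l -> freed n l = 0.
Proof.
elim: n l => [|n IH] [|l] //= nl; rewrite !IH //; try lia.
Qed.

Lemma freed_odd n l : odd (n + l) -> freed n l = 0.
Proof.
elim: n l => [|n IH] [|l] // nl; first by rewrite /= IH ?muln0 //; lia.
by rewrite /= !IH ?muln0 //; lia.
Qed.

Lemma freed_half n i : i.*2 <= n -> freed n (n - i.*2) = halfd n i.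
Proof.
elim: n i => [|n IH] i; first by case: i.
case: i => [|i] ni.
  rewrite subn0 /= (@freed_gt n n.+2) // muln0 !addn0.
  by rewrite -[n in RHS]/n -(IH 0) // subn0.
rewrite halfdS -(IH i); last by lia.
case: (leqP i.+1.*2 n) => [ni'|ni'].
  rewrite -IH //; rewrite (_ : n.+1 - i.+1.*2 = (n - i.+1.*2).+1); last by lia.
  by rewrite /= (_ : (n - i.+1.*2).+2 = n - i.*2) //; lia.
rewrite (halfd_gt ni') (_ : n.+1 - i.+1.*2 = 0); last by lia.
by rewrite /= (_ : n - i.*2 = 1) //; lia.
Qed.

(** Double counting of half diagrams on n + 1 points with one marked unmatched point: the point is
    marked last or chosen first. *)
Lemma freedS n l : l.+1 * freed n.+1 l.+1 = n.+1 * freed n l.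
Proof.
elim: n l => [|n IH] l; first by case: l => [|l] /=; lia.
have -> : freed n.+2 l.+1 = freed n.+1 l + l.+2 * m * freed n.+1 l.+2 by [].
have IH1 := IH l.+1; case: l IH1 => [|l] IH1.
  have E : freed n.+1 0 = m * freed n 1 by rewrite /= mul1n.
  by rewrite E in IH1 *; nia.
have IH0 := IH l.
have E : freed n.+1 l.+1 = freed n l + l.+2 * m * freed n l.+2 by [].
rewrite mulnDr !mulnA [l.+2 * l.+3]mulnC -!mulnA mulSn IH0 (mulnCA l.+3) (mulnCA l.+3) IH1.
by rewrite [RHS]mulSn -addnA; congr (_ + _); rewrite E mulnDr; nia.
Qed.

Let wt l := l`! * m ^ l.

Let wtS l : wt l.+1 = l.+1 * m * wt l.
Proof. by rewrite /wt factS expnS; nia. Qed.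

(** Perfect matchings of a + b points, sorted by the number l of strands across the cut between the
    a points and the b points; l! m^l counts the labelled bijections of the unmatched points. [B]
    only truncates the sum: terms with l > a or l > b vanish. *)
Let pair_sum (B a b : nat) : nat := \sum_(l < B) freed a l * freed b l * wt l.

(* Adding a point is self-adjoint for the weights l! m^l. *)
Let pair_sumS B a b : a < B -> b < B -> pair_sum B a.+1 b = pair_sum B a b.+1.
Proof.
case: B => // B aB bB.
have E c d : d < B.+1 -> pair_sum B.+1 c.+1 d = \sum_(l < B) freed c l * freed d l.+1 * wt l.+1
     + \sum_(l < B.+1) freed c l.+1 * freed d l * wt l.+1.
  move=> dB; rewrite /pair_sum.
  rewrite (eq_bigr (fun l : 'I_B.+1 => (if (l : nat) is l'.+1 then freed c l' else 0) * freed d l * wt l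
    + freed c l.+1 * freed d l * wt l.+1)) => [|l _]; last first.
    rewrite wtS -[freed c.+1 l]/(_ + l.+1 * m * freed c l.+1) mulnDl mulnDl; congr (_ + _).
    by rewrite [RHS]mulnCA !mulnA.
  rewrite big_split /=; congr (_ + _); rewrite big_ord_recl /= !mul0n add0n.
  by apply: eq_bigr => i _.
rewrite E // (_ : pair_sum B.+1 a b.+1 = pair_sum B.+1 b.+1 a); last first.
  by apply: eq_bigr => l _; rewrite (mulnC (freed a l)).
rewrite E // addnC; congr (_ + _).
  rewrite big_ord_recr /= (@freed_gt a) // ?mul0n ?addn0.
  by apply: eq_bigr => l _; rewrite (mulnC (freed a _)).
rewrite [RHS]big_ord_recr /= (@freed_gt b) // ?mul0n ?addn0.
by apply: eq_bigr => l _; rewrite (mulnC (freed a _)).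
Qed.

Let sum_even n (f : nat -> nat) : (forall l, odd (n + l) -> f l = 0) ->
  \sum_(l < n.+1) f l = \sum_(i < n.+1 | i.*2 <= n) f (n - i.*2).
Proof.
elim/ltn_ind: n f => -[|[|n]] IH f f0.
- by rewrite [RHS]big_mkcond !big_ord_recr !big_ord0 /= sub0n.
- rewrite [RHS]big_mkcond !big_ord_recr !big_ord0 /=.
  by rewrite (f0 0) // subn0 !addn0.
rewrite 2!big_ord_recr /= (f0 n.+1); last by rewrite addSn /= addnS /= addnn odd_double.
rewrite addn0 IH => [||l nl]; [|by lia|by apply: f0; rewrite !addSn /= negbK].
rewrite [RHS]big_mkcond big_ord_recl /= subn0 addnC; congr (_ + _).
rewrite big_ord_recr /= [X in _ + X](_ : _ = 0) ?addn0; last by rewrite ifN // /bump /=; lia.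
rewrite big_mkcond /=; apply: eq_bigr => i _.
by rewrite /bump /= add1n doubleS !ltnS subSS.
Qed.

(** The points of one half are moved across the cut one at a time by [pair_sumS], until 2n points
    face none. *)
Lemma halfd_sum n :
  \sum_(i < n.+1) halfd n i * (halfd n i * ((n - i.*2)`! * m ^ (n - i.*2))) = freed n.*2 0.
Proof.
have shift a b B : a + b < B -> pair_sum B (a + b) 0 = pair_sum B a b.
  elim: b a => [|b IH] a aB; first by rewrite addn0.
  by rewrite -pair_sumS; [rewrite -IH ?addSnnS // addSnnS | lia | lia].
transitivity (pair_sum n.*2.+1 n n); last first.
  rewrite -shift ?addnn // /pair_sum big_ord_recl /= muln1 /wt fact0 expn0 !muln1.
  by rewrite big1 ?addn0 // => i _; rewrite muln0.
(* The larger bound leaves room for the shift; with n points on each side the terms above n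
   vanish. *)
transitivity (pair_sum n.+1 n n); last first.
  rewrite /pair_sum -!(big_mkord xpredT (fun l => freed n l * freed n l * wt l)).
  rewrite [RHS](@big_cat_nat _ _ _ n.+1) //=; last by lia.
  rewrite [X in _ + X]big1_seq ?addn0 // => l; rewrite mem_index_iota => /and3P[_ nl _].
  by rewrite freed_gt // !mul0n.
rewrite /pair_sum (@sum_even n (fun l => freed n l * freed n l * wt l)) => [|l nl]; last first.
  by rewrite freed_odd // !mul0n.
rewrite [RHS]big_mkcond; apply: eq_bigr => i _.
by case: ifP => [ni|/negbT ni]; [rewrite !freed_half // /wt; nia | rewrite halfd_gt; lia].
Qed.

(** A given point among 2n + 2 has 2n + 1 possible partners, and its strand m labels. *)
Lemma freed_double n : freed n.+1.*2 0 = n.*2.+1 * m * freed n.*2 0.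
Proof.
have := freedS n.*2 0; rewrite mul1n doubleS => E.
by rewrite -[LHS]/(0 + 1 * m * freed n.*2.+1 1) E; nia.
Qed.

End Counting.

Arguments halfd : simpl never.

Local Open Scope ring_scope.

(** * Linear maps and quotient spaces *)

Section LinearTools.

Variable k : fieldType.
Implicit Types V W X : vectType k.

(** Serves functions that come with a proof of linearity but no canonical structure. The equation
    with [linfun] yields [linfunE], which evaluates the actions that are defined by a bare
    [linfun]. *)
Fact mkhom_subproof V W (f : V -> W) : linear f ->
  {h : 'Hom(V, W) | h = linfun f & forall v, h v = f v}.
Proof.
move=> fl; pose g : {linear V -> W} := HB.pack f (GRing.isLinear.Build _ _ _ _ f fl).
by exists (linfun g) => // v; rewrite lfunE.
Qed.

Definition mkhom V W (f : V -> W) (fl : linear f) : 'Hom(V, W) :=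
  s2val (mkhom_subproof fl).

Lemma mkhomE V W (f : V -> W) (fl : linear f) v : mkhom fl v = f v.
Proof. exact: (s2valP' (mkhom_subproof fl)). Qed.

Lemma linfunE V W (f : V -> W) (fl : linear f) v : linfun f v = f v.
Proof. by rewrite -(s2valP (mkhom_subproof fl)) [LHS]mkhomE. Qed.

Lemma dim_limg_le V W (f : 'Hom(V, W)) U : (\dim (f @: U) <= \dim U)%N.
Proof. by rewrite -(limg_ker_dim f U) leq_addl. Qed.

Lemma limg_subP V W (f : 'Hom(V, W)) (U : {vspace V}) (Y : {vspace W}) :
  (forall v, v \in U -> f v \in Y) -> (f @: U <= Y)%VS.
Proof. by move=> fX; apply/subvP => w /memv_imgP[v Uv ->]; apply: fX. Qed.

Lemma limg_eq V W (f : 'Hom(V, W)) (U : {vspace V}) (Y : {vspace W}) :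
  (forall v, v \in U -> f v \in Y) ->
  (forall w, w \in Y -> exists2 v, v \in U & w = f v) -> (f @: U = Y)%VS.
Proof.
move=> fX Xf; apply/vspaceP => w; apply/memv_imgP/idP => [[v Uv ->]|/Xf //].
exact: fX.
Qed.

Lemma limg_fullP V W (f : 'Hom(V, W)) w : limg f = fullv -> exists v, w = f v.
Proof. by move=> fT; have := memvf w; rewrite -fT => /memv_imgP[v _ ->]; exists v. Qed.

Lemma eq_fullv V (U : {vspace V}) : (forall v, v \in U) -> U = fullv.
Proof. by move=> Uv; apply/vspaceP => v; rewrite Uv memvf. Qed.

Lemma limg_qproj V (U : {vspace V}) : limg (linfun (qproj U)) = fullv.
Proof.
apply: eq_fullv => t; rewrite -[t]qprojK; apply/memv_imgP.
by exists (vsval t); rewrite ?memvf ?lfunE.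
Qed.

Lemma lker_qproj V (U : {vspace V}) : lker (linfun (qproj U)) = U.
Proof. by apply/vspaceP => v; rewrite memv_ker lfunE /= qproj_eq0. Qed.

Lemma lfun_factor V W X (g : 'Hom(V, W)) (h : 'Hom(V, X)) :
  limg g = fullv -> (lker g <= lker h)%VS ->
  exists h' : 'Hom(W, X), forall v, h' (g v) = h v.
Proof.
move=> gT gh; exists (h \o g^-1)%VF => v; rewrite comp_lfunE.
apply/eqP; rewrite -subr_eq0 -linearB -memv_ker; apply: (subvP gh).
by rewrite memv_ker linearB /= limg_lfunVK ?subrr // gT memvf.
Qed.

Lemma dim_limg_full V W (f : 'Hom(V, W)) : limg f = fullv -> (\dim {:W} <= \dim {:V})%N.
Proof. by move=> <-; apply: dim_limg_le. Qed.

End LinearTools.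

(** * One-sided ideals, corners and two-sided ideals *)

Section AlgebraSubspaces.

Variables (k : fieldType) (A : falgType k).
Implicit Types a b e x : A.

Lemma lidealP e x : reflect (exists y, x = y * e) (x \in lideal e).
Proof.
apply: (iffP memv_cosetP) => [[y _ ->]|[y ->]]; first by exists y.
by exists y; rewrite ?memvf.
Qed.

Lemma limg_amull e : limg (amull e) = rideal e.
Proof.
apply: limg_eq => [v _|w]; first by rewrite lfunE memv_mul ?memv_line ?memvf.
have sub : (rideal e <= limg (amull e))%VS.
  apply/prodvP => u v /vlineP[c ->] _; rewrite -scalerAl; apply: memvZ.
  by apply/memv_imgP; exists v; rewrite ?memvf ?lfunE.
by move/(subvP sub)/memv_imgP.
Qed.

Lemma ridealP e x : reflect (exists y, x = e * y) (x \in rideal e).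
Proof.
rewrite -limg_amull; apply: (iffP memv_imgP) => [[y _ ->]|[y ->]].
  by exists y; rewrite lfunE.
by exists y; rewrite ?memvf ?lfunE.
Qed.

Lemma cornerP e x : reflect (exists y, x = e * y * e) (x \in corner e).
Proof.
apply: (iffP memv_cosetP) => [[y /ridealP[z ->] ->]|[y ->]]; first by exists z.
by exists (e * y) => //; apply/ridealP; exists y.
Qed.

Lemma mem_ideal e a b : a * e * b \in ideal e.
Proof. by rewrite !memv_mul ?memvf ?memv_line. Qed.

Lemma ideal_subP e (W : {vspace A}) :
  (forall a b, a * e * b \in W) -> (ideal e <= W)%VS.
Proof.
by move=> eW; apply/prodvP => u v /lidealP[a ->] _; apply: eW.
Qed.

Lemma ideal_mull_closed e a x : x \in ideal e -> a * x \in ideal e.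
Proof.
move=> xe; suff : (ideal e <= amull a @^-1: ideal e)%VS.
  by move/subvP/(_ _ xe); rewrite -memv_preim lfunE.
by apply: ideal_subP => b c; rewrite -memv_preim lfunE /= !mulrA mem_ideal.
Qed.

Lemma ideal_mulr_closed e a x : x \in ideal e -> x * a \in ideal e.
Proof.
move=> xe; suff : (ideal e <= amulr a @^-1: ideal e)%VS.
  by move/subvP/(_ _ xe); rewrite -memv_preim lfunE.
by apply: ideal_subP => b c; rewrite -memv_preim lfunE /= -!mulrA mulrA mem_ideal.
Qed.

Lemma mem_ideal_id e : e \in ideal e.
Proof. by have := mem_ideal e 1 1; rewrite mul1r mulr1. Qed.

End AlgebraSubspaces.

(** * Modules, generated submodules and relative ranks *)

Section ModuleTools.

Variables (k : fieldType) (A : falgType k).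
Implicit Type M : lmodule A.

Lemma lact1E M v : lact M 1 v = v.
Proof. by rewrite lact1 id_lfunE. Qed.

Lemma lactME M a b v : lact M (a * b) v = lact M a (lact M b v).
Proof. by rewrite lactM comp_lfunE. Qed.

Section MakeModule.

Variables (W : vectType k) (act : A -> W -> W).
Hypotheses (actL : forall a, linear (act a)) (actA : forall v, linear (act^~ v)).
Hypotheses (act1 : forall v, act 1 v = v).
Hypotheses (actM : forall a b v, act (a * b) v = act a (act b v)).

Let fact_linear : linear (fun a => mkhom (actL a)).
Proof.
move=> c a b; apply/lfunP => v; rewrite add_lfunE scale_lfunE !mkhomE.
exact: actA.
Qed.

Let fact := mkhom fact_linear.
Let factE a v : fact a v = act a v. Proof. by rewrite /fact !mkhomE. Qed.

Let fact1 : fact 1 = \1%VF.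
Proof. by apply/lfunP => v; rewrite factE act1 id_lfunE. Qed.
Let factM a b : fact (a * b) = (fact a \o fact b)%VF.
Proof. by apply/lfunP => v; rewrite comp_lfunE !factE actM. Qed.

Definition mklmod : lmodule A := LModule fact1 factM.

Lemma mklmodE a (v : W) : lact mklmod a v = act a v.
Proof. exact: factE. Qed.

End MakeModule.

Section SubModule.

Variables (M : lmodule A) (V : {vspace M}) (hV : submodule V).

Let act a (v : subvs_of V) : subvs_of V := vsproj V (lact M a (vsval v)).
Let actL a : linear (act a).
Proof. by move=> c u v; rewrite /act !linearP. Qed.
Let actA v : linear (act^~ v).
Proof. by move=> c a b; rewrite /act linearP add_lfunE scale_lfunE linearP. Qed.
Let act1 v : act 1 v = v.
Proof. by rewrite /act lact1E vsvalK. Qed.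
Let actM a b v : act (a * b) v = act a (act b v).
Proof. by rewrite /act lactME vsprojK // hV ?subvsP. Qed.

Definition submod : lmodule A := mklmod actL actA act1 actM.

Lemma submodE a (v : submod) :
  (vsval (lact submod a v : subvs_of V) : M) = lact M a (vsval (v : subvs_of V)).
Proof. by rewrite mklmodE vsprojK // hV ?subvsP. Qed.

End SubModule.

Section QuotientModule.

Variables (M : lmodule A) (U : {vspace M}) (hU : submodule U).

Let act a (t : qspace U) : qspace U := qproj U (lact M a (vsval t)).
Let actL a : linear (act a).
Proof. by move=> c u v; rewrite /act !linearP. Qed.
Let actA v : linear (act^~ v).
Proof. by move=> c a b; rewrite /act linearP add_lfunE scale_lfunE linearP. Qed.
Let act_proj a v : act a (qproj U v) = qproj U (lact M a v).
Proof.
apply/eqP; rewrite /act qproj_eq -linearB hU // val_qproj addrAC subrr sub0r.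
by rewrite memvN memv_proj.
Qed.
Let act1 v : act 1 v = v.
Proof. by rewrite /act lact1E qprojK. Qed.
Let actM a b v : act (a * b) v = act a (act b v).
Proof. by rewrite -[v]qprojK !act_proj lactME. Qed.

Definition quomod : lmodule A := mklmod actL actA act1 actM.
Definition quomap : 'Hom(M, quomod) := linfun (qproj U).

Lemma quomapE v : quomap v = qproj U v. Proof. by rewrite lfunE. Qed.
Lemma limg_quomap : limg quomap = fullv. Proof. exact: limg_qproj. Qed.
Lemma lker_quomap : lker quomap = U. Proof. exact: lker_qproj. Qed.
Lemma quomapP a v : quomap (lact M a v) = lact quomod a (quomap v).
Proof. by rewrite !quomapE mklmodE act_proj. Qed.

End QuotientModule.

Definition homon (M M' : lmodule A) (V : {vspace M}) (f : 'Hom(M, M')) : Prop :=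
  forall (a : A) (v : M), v \in V -> f (lact M a v) = lact M' a (f v).

Definition mhom (M M' : lmodule A) (f : 'Hom(M, M')) : Prop :=
  forall (a : A) (v : M), f (lact M a v) = lact M' a (f v).

Lemma mhom_homon M M' V (f : 'Hom(M, M')) : mhom f -> homon V f.
Proof. by move=> fh a v _; apply: fh. Qed.

Lemma mhom_comp (M1 M2 M3 : lmodule A) (f : 'Hom(M1, M2)) (g : 'Hom(M2, M3)) :
  mhom f -> mhom g -> mhom (g \o f)%VF.
Proof. by move=> fh gh a v; rewrite !comp_lfunE fh gh. Qed.

Lemma mhom_factor (M1 M2 M3 : lmodule A) (g : 'Hom(M1, M2)) (h : 'Hom(M1, M3)) :
  mhom g -> mhom h -> limg g = fullv -> (lker g <= lker h)%VS ->
  exists2 h' : 'Hom(M2, M3), mhom h' & forall v, h' (g v) = h v.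
Proof.
move=> gh hh gT gK; have [h' h'E] := lfun_factor gT gK; exists h' => // a w.
by have [v ->] := limg_fullP w gT; rewrite -gh !h'E hh.
Qed.

(** This is the submodule A U: by linearity in the acting element, a basis of A suffices. *)
Definition gen M (U : {vspace M}) : {vspace M} :=
  (\sum_(i < \dim {:A}) (lact M (vbasis {:A})`_i @: U))%VS.

Lemma mem_gen M (U : {vspace M}) a u : u \in U -> lact M a u \in gen U.
Proof.
move=> Uu; rewrite (coord_vbasis (memvf a)) linear_sum sum_lfunE.
apply: memv_suml => i _; rewrite linearZ scale_lfunE; apply: memvZ.
by apply: (subvP (sumv_sup i _ (subvv _))) => //; apply: memv_img.
Qed.

Lemma gen_sub M (U W : {vspace M}) :
  (forall a u, u \in U -> lact M a u \in W) -> (gen U <= W)%VS.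
Proof. by move=> h; apply/subv_sumP => i _; apply: limg_subP => u; apply: h. Qed.

Lemma sub_gen M (U : {vspace M}) : (U <= gen U)%VS.
Proof. by apply/subvP => u Uu; rewrite -[u](lact1E (M := M)) mem_gen. Qed.

Lemma gen_submodule M (U : {vspace M}) : submodule (gen U).
Proof.
move=> a v Uv; rewrite memv_preim; apply: subvP Uv; apply: gen_sub => b u Uu.
by rewrite -memv_preim -lactME mem_gen.
Qed.

Lemma gen_min M (U W : {vspace M}) : submodule W -> (U <= W)%VS -> (gen U <= W)%VS.
Proof. by move=> hW UW; apply: gen_sub => a u /(subvP UW); apply: hW. Qed.

Lemma genS M (U W : {vspace M}) : (U <= W)%VS -> (gen U <= gen W)%VS.
Proof.
move=> UW; apply: gen_min; first exact: gen_submodule.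
exact: subv_trans (sub_gen _).
Qed.

Lemma gen0 M : gen (0 : {vspace M})%VS = 0%VS.
Proof.
apply/eqP; rewrite -subv0; apply: gen_sub => a u; rewrite memv0 => /eqP->.
by rewrite linear0 mem0v.
Qed.

Lemma fullv_submodule M : submodule (fullv : {vspace M}).
Proof. by move=> a v _; rewrite memvf. Qed.

Lemma lker_submodule M M' (f : 'Hom(M, M')) : mhom f -> submodule (lker f).
Proof. by move=> fh a v; rewrite !memv_ker fh => /eqP->; rewrite linear0. Qed.

Lemma limg_submodule M M' V (f : 'Hom(M, M')) :
  submodule V -> homon V f -> submodule (f @: V)%VS.
Proof.
move=> hV fh a w /memv_imgP[v Vv ->]; rewrite -fh //.
by apply: memv_img; apply: hV.
Qed.

Lemma limg_lact M M' V (f : 'Hom(M, M')) x : homon V f ->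
  (f @: (lact M x @: V) = lact M' x @: (f @: V))%VS.
Proof.
move=> fh; rewrite -!limg_comp; apply: eq_in_limg => v Vv.
by rewrite !comp_lfunE fh.
Qed.

Lemma limg_gen M M' V U (f : 'Hom(M, M')) : homon V f -> (U <= V)%VS ->
  (f @: gen U = gen (f @: U))%VS.
Proof.
move=> fh UV; rewrite limg_sum; apply: eq_bigr => i _.
by rewrite (@limg_lact M M' U) // => a v /(subvP UV); apply: fh.
Qed.

Lemma lact_sub M V x : submodule V -> (lact M x @: V <= V)%VS.
Proof. by move=> hV; apply: limg_subP => v; apply: hV. Qed.

(** For an idempotent x and a submodule V, this is the dimension of x (V / A y V). It is attached to
    subspaces of a fixed module so that it applies directly to the members of a filtration. *)
Definition rkg (x y : A) M (V : {vspace M}) : nat :=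
  (\dim (lact M x @: V) - \dim (lact M x @: gen (lact M y @: V)))%N.

Lemma gen_lact_sub M V y : submodule V -> (gen (lact M y @: V) <= V)%VS.
Proof. by move=> hV; apply: gen_min (lact_sub _ _). Qed.

(** f maps x V onto x f(V) and x A y V onto x A y f(V), so it induces a surjection of the
    quotients. *)
Lemma rkg_img x y M M' V (f : 'Hom(M', M)) : submodule V -> homon V f ->
  (rkg x y (f @: V) <= rkg x y V)%N.
Proof.
move=> hV fh; rewrite /rkg -!(limg_lact _ fh) -(limg_gen fh (lact_sub _ hV)).
have sub := gen_lact_sub y hV.
rewrite -(@limg_lact _ _ (gen (lact M' y @: V))); last first.
  by move=> a v /(subvP sub); apply: fh.
set P := (lact M' x @: V)%VS; set Q := (lact M' x @: _)%VS.
have QP : (Q <= P)%VS by apply: limgS.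
have := limg_ker_dim f P; have := limg_ker_dim f Q.
have := dimvS (capvS QP (subvv (lker f))); have := dimvS (limgS f QP).
lia.
Qed.

(** V -> x V is exact for an idempotent x, but A y V1 may be smaller than the intersection of A y V2
    with V1; hence an inequality. *)
Lemma rkg_ext x y M (D : lmodule A) (V1 V2 : {vspace M}) (f : 'Hom(M, D)) : x * x = x ->
  submodule V1 -> submodule V2 -> (V1 <= V2)%VS -> homon V2 f ->
  (V2 :&: lker f = V1)%VS ->
  (rkg x y V2 <= rkg x y V1 + rkg x y (f @: V2))%N.
Proof.
move=> xx hV1 hV2 V12 fh V1E; rewrite /rkg -!(limg_lact _ fh).
rewrite -(limg_gen fh (lact_sub _ hV2)).
have sub2 := gen_lact_sub y hV2; have sub1 := gen_lact_sub y hV1.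
rewrite -(@limg_lact _ _ (gen (lact M y @: V2))); last first.
  by move=> a v /(subvP sub2); apply: fh.
set P2 := (lact M x @: V2)%VS; set Q2 := (lact M x @: gen (lact M y @: V2))%VS.
set P1 := (lact M x @: V1)%VS; set Q1 := (lact M x @: gen (lact M y @: V1))%VS.
(* An element x w that lies in V1 equals x (x w), hence lies in x V1. *)
have PK : (P2 :&: lker f <= P1)%VS.
  apply/subvP => v /memv_capP[/memv_imgP[w Vw ->] kv].
  have : lact M x w \in V1 by rewrite -V1E memv_cap kv hV2.
  by move/(memv_img (lact M x)); rewrite -lactME xx.
have QK : (Q1 <= Q2 :&: lker f)%VS.
  rewrite subv_cap; apply/andP; split; first by do !apply: limgS || apply: genS.
  apply: subv_trans (limgS _ sub1) _; apply: subv_trans (lact_sub _ hV1) _.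
  by rewrite -V1E capvSr.
have QP1 : (Q1 <= P1)%VS by apply: limgS.
have QP2 : (Q2 <= P2)%VS by apply: limgS.
have := limg_ker_dim f P2; have := limg_ker_dim f Q2.
have := dimvS PK; have := dimvS QK; have := dimvS QP1; have := dimvS QP2.
have := dimvS (limgS f QP2); lia.
Qed.

End ModuleTools.

Lemma res_actE (k : fieldType) (A B : falgType k) (f : 'AHom(A, B)) (M : lmodule B) a v :
  lact (res f M) a v = lact M (f a) v.
Proof. by rewrite /res /= /res_act comp_lfunE. Qed.

(** * The corner e M as a module over e B e *)

Section CornerModule.

Variables (k : fieldType) (A B : falgType k) (e : B) (phi : 'Hom(A, B)).
Hypotheses (phi1 : phi 1 = e) (phiM : forall a b, phi (a * b) = phi a * phi b).
Variable M : lmodule B.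

Let V := (lact M e @: fullv)%VS.

Let phi_sub a (v : M) : v \in V -> lact M (phi a) v \in V.
Proof.
move=> /memv_imgP[w _ ->]; rewrite -[a]mul1r phiM phi1 lactME.
exact: memv_img (memvf _).
Qed.

Let act a (v : subvs_of V) : subvs_of V := vsproj V (lact M (phi a) (vsval v)).
Let actL a : linear (act a).
Proof. by move=> c u v; rewrite /act !linearP. Qed.
Let actA v : linear (act^~ v).
Proof.
by move=> c a b; rewrite /act !linearP /= add_lfunE scale_lfunE linearP.
Qed.
Let act1 v : act 1 v = v.
Proof.
rewrite /act phi1; have /memv_imgP[w _ vE] := subvsP v.
by rewrite vE -lactME -phi1 -phiM mulr1 phi1 -vE vsvalK.
Qed.
Let actM a b v : act (a * b) v = act a (act b v).
Proof. by rewrite /act phiM lactME vsprojK // phi_sub ?subvsP. Qed.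

Definition cormod : lmodule A := mklmod actL actA act1 actM.
Definition corval : 'Hom(cormod, M) := linfun (@vsval _ _ V).

Lemma corvalE (v : cormod) : corval v = vsval (v : subvs_of V).
Proof. by rewrite lfunE. Qed.

Lemma corval_lact a v : corval (lact cormod a v) = lact M (phi a) (corval v).
Proof. by rewrite !corvalE mklmodE vsprojK // phi_sub ?subvsP. Qed.

Lemma limg_corval : limg corval = (lact M e @: fullv)%VS.
Proof.
apply: limg_eq => [v _|w wV]; first by rewrite corvalE subvsP.
by exists (vsproj V w); rewrite ?memvf // corvalE vsprojK.
Qed.

Lemma lker_corval : lker corval = 0%VS.
Proof.
apply/vspaceP => v; rewrite memv_ker memv0 corvalE.
by apply/eqP/eqP => [v0|-> //]; apply: val_inj.
Qed.

Lemma corval_inj : injective corval.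
Proof. by apply/lker0P; rewrite lker_corval. Qed.

End CornerModule.

(** * Generators and universal property of globalisation *)

Section GlobTools.

Variables (k : fieldType) (A B : falgType k) (e : B) (phi : 'Hom(A, B)).
Variable M : lmodule A.
Hypotheses (ee : e * e = e) (ephi : forall a, e * phi a = phi a).

Local Notation G := (glob e phi M).

(** The tensor b e (x) v, written for every b in B so that no membership in B e has to be carried
    along. *)
Definition gp (b : B) (v : M) : G :=
  glob_pure phi (vsproj (lideal e) (b * e) : subvs_of (lideal e)) v.

Let Be b : b * e \in lideal e. Proof. by apply/lidealP; exists b. Qed.

Lemma glob_ractE a (x : subvs_of (lideal e)) :
  vsval (glob_ract e phi a x) = vsval x * phi a * e.
Proof.
have hl b : linear (fun x : subvs_of (lideal e) => vsproj (lideal e) (vsval x * phi b * e)).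
  by move=> c u v; rewrite -linearP; apply: congr1; rewrite linearP /= !mulrDl -!scalerAl.
rewrite /glob_ract linfunE => [|c b d]; first by rewrite linfunE // vsprojK.
apply/lfunP => y; rewrite add_lfunE scale_lfunE !linfunE // -linearP.
by apply: congr1; rewrite linearP /= mulrDr mulrDl -scalerAr -scalerAl.
Qed.

Lemma gp_linl v : linear (gp^~ v).
Proof.
have [linl _] := tpure_bilinear (glob_ract e phi) (lact M).
move=> c a b; rewrite /gp -linl; congr (glob_pure _ _ _); rewrite -linearP.
by apply: congr1; rewrite mulrDl scalerAl.
Qed.

Lemma gp_linr b : linear (gp b).
Proof. by have [_ linr] := tpure_bilinear (glob_ract e phi) (lact M); apply: linr. Qed.

Lemma pure_gp (x : subvs_of (lideal e)) v : glob_pure phi x v = gp (vsval x) v.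
Proof.
rewrite /gp; congr (glob_pure _ _ _); apply: val_inj; rewrite /= vsprojK //.
by have /lidealP[y ->] := subvsP x; rewrite -mulrA ee.
Qed.

Lemma gp_act a b v : gp b (lact M a v) = gp (b * phi a) v.
Proof.
rewrite /gp /glob_pure -[LHS]tpure_balanced; congr tpure; apply: val_inj.
by rewrite /= glob_ractE !vsprojK // -(mulrA b) ephi.
Qed.

Lemma gpe b v : gp (b * e) v = gp b v.
Proof. by rewrite /gp -mulrA ee. Qed.

Lemma lact_gp c b v : lact G c (gp b v) = gp (c * b) v.
Proof. by rewrite /gp /= glob_actE vsprojK // mulrA. Qed.

(** The projection to the quotient by W vanishes on pure tensors, hence everywhere. *)
Lemma glob_span (W : {vspace G}) : (forall b v, gp b v \in W) -> W = fullv.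
Proof.
move=> gW; apply: eq_fullv => t; rewrite -qproj_eq0.
have /lfunP/(_ t) : linfun (qproj W) = (0 : 'Hom(tensor (glob_ract e phi) (lact M), qspace W)).
  apply: tensor_ext => x v; rewrite lfunE zero_lfunE; apply/eqP.
  by rewrite qproj_eq0 -[tpure _ _ _ _]/(glob_pure phi x v) pure_gp.
by rewrite lfunE zero_lfunE => ->.
Qed.

Lemma glob_ext (W : vectType k) (f g : 'Hom(G, W)) :
  (forall b v, f (gp b v) = g (gp b v)) -> f = g.
Proof.
by move=> fg; apply: tensor_ext => x v; rewrite -[tpure _ _ _ _]/(glob_pure phi x v) pure_gp.
Qed.

Lemma glob_lift (W : vectType k) (beta : B -> M -> W) :
  (forall v, linear (beta^~ v)) -> (forall b, linear (beta b)) ->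
  (forall b v, beta (b * e) v = beta b v) ->
  (forall a b v, beta (b * phi a) v = beta b (lact M a v)) ->
  exists f : 'Hom(G, W), forall b v, f (gp b v) = beta b v.
Proof.
move=> bl br be ba.
pose b' (x : subvs_of (lideal e)) (v : M) := beta (vsval x) v.
exists (tlift (glob_ract e phi) (lact M) b') => b v.
rewrite [LHS]tliftE /b' ?vsprojK ?be //.
  by split=> [w c x y|x]; [rewrite linearP bl | apply: br].
by move=> a x w; rewrite glob_ractE be ba.
Qed.

Lemma glob_liftM (W : lmodule B) (f : 'Hom(G, W)) (beta : B -> M -> W) :
  (forall b v, f (gp b v) = beta b v) ->
  (forall c b v, beta (c * b) v = lact W c (beta b v)) -> mhom f.
Proof.
move=> fE bM c t.
suff /lfunP/(_ t) : (f \o lact G c = lact W c \o f)%VF by rewrite !comp_lfunE.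
by apply: glob_ext => b v; rewrite !comp_lfunE lact_gp !fE bM.
Qed.

End GlobTools.

Lemma in_rangeS N n : in_range N n.+1 -> in_range N n.
Proof. by case: N => //= b /ltnW. Qed.

(* In the Brauer tower [td_cosets] comes from the cosets of Z/m wr S_n in
   Z/m wr S_(n+1), and [freed m n.*2 0] is (2n-1)!! m^n. *)
Record tower_data (k : fieldType) (m : nat) (N : option nat) (A : nat -> falgType k)
    (e : forall n, A n) (phi : forall n, 'Hom(A n, A n.+2))
    (iota : forall n, in_range N n.+1 -> 'AHom(A n, A n.+1)) : Prop := TowerData {
  td_m : (0 < m)%N;
  td_A1 : axiom_A1 N e phi;
  td_phi : forall n (h1 : in_range N n.+1) (h2 : in_range N n.+2) b,
    phi n b = iota _ h2 (iota _ h1 b) * e n.+2;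
  td_comm : forall n (h1 : in_range N n.+1) (h2 : in_range N n.+2) b,
    iota _ h2 (iota _ h1 b) * e n.+2 = e n.+2 * iota _ h2 (iota _ h1 b);
  td_left : forall n (h : in_range N n.+2) x, exists y, x * e n.+2 = iota _ h y * e n.+2;
  td_left_inj : forall n (h : in_range N n.+2) y, iota _ h y * e n.+2 = 0 -> y = 0;
  td_right : forall n (h : in_range N n.+2) x, exists y, e n.+2 * x = e n.+2 * iota _ h y;
  td_iota_e : forall n (h : in_range N n.+1), iota _ h (e n) \in ideal (e n.+1);
  td_cosets : forall n (h : in_range N n.+1), exists g : 'I_(n.+1 * m) -> A n.+1,
    forall x, exists y : 'I_(n.+1 * m) -> A n,
    x - \sum_a g a * iota _ h (y a) \in ideal (e n.+1);
  td_dim0 : (\dim {: A 0%N} <= 1)%N;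
  td_dim : forall n, in_range N n -> (freed m n.*2 0 <= \dim {: A n})%N }.

(** * Mackey-type estimates and the dimension bound *)

Section Tower.

Variables (k : fieldType) (m : nat) (N : option nat) (A : nat -> falgType k).
Variables (e : forall n, A n) (phi : forall n, 'Hom(A n, A n.+2)).
Variable iota : forall n, in_range N n.+1 -> 'AHom(A n, A n.+1).
Hypothesis td : tower_data m e phi iota.

Local Notation idem := (idem phi).
Local Notation R := (in_range N).

Lemma e_idem n : R n.+2 -> e n.+2 * e n.+2 = e n.+2.
Proof. by have [_ _ h] := td_A1 td => /h[]. Qed.
Lemma phi_1 n : R n.+2 -> phi n 1 = e n.+2.
Proof. by have [_ _ h] := td_A1 td => /h[]. Qed.
Lemma phi_mul n : R n.+2 -> forall a b, phi n (a * b) = phi n a * phi n b.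
Proof. by have [_ _ h] := td_A1 td => /h[]. Qed.
Lemma phi_inj n : R n.+2 -> injective (phi n).
Proof. by have [_ _ h] := td_A1 td => /h[_ _ _ /eqP/lker0P]. Qed.
Lemma e_corner n x : R n.+2 -> exists y, e n.+2 * x * e n.+2 = phi n y.
Proof.
have [_ _ h] := td_A1 td => /h[_ _ _ _ phiT].
have : e n.+2 * x * e n.+2 \in limg (phi n) by rewrite phiT; apply/cornerP; exists x.
by case/memv_imgP=> y _ ->; exists y.
Qed.
Lemma e_phi n : R n.+2 -> forall a, e n.+2 * phi n a = phi n a.
Proof. by move=> h a; rewrite -phi_1 // -phi_mul // mul1r. Qed.
Lemma phi_e n : R n.+2 -> forall a, phi n a * e n.+2 = phi n a.
Proof. by move=> h a; rewrite -phi_1 // -phi_mul // mulr1. Qed.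

Lemma idem0 n : idem n 0 = 1. Proof. by case: n. Qed.

Lemma idem1 n : R n -> idem n 1 = e n.
Proof.
have [e0 e1 _] := td_A1 td.
by case: n => [|[|n]] h; rewrite ?e0 ?e1 //= idem0; apply: phi_1.
Qed.

Lemma idem_gt n i : (n < i.*2)%N -> idem n i = 0.
Proof.
elim: i n => [|i IH] [|[|n]] //= ni; rewrite IH ?linear0 //; lia.
Qed.

Lemma idem_mul n i j : R n -> (i <= j)%N ->
  idem n i * idem n j = idem n j /\ idem n j * idem n i = idem n j.
Proof.
elim: i n j => [|i IH] n j h; first by rewrite idem0 mul1r mulr1.
case: j => // j ij; case: n h => [|[|n]] h /=; rewrite ?mulr0 ?mul0r //.
have [E1 E2] := IH n j (in_rangeS (in_rangeS h)) ij.
by rewrite -!phi_mul // E1 E2.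
Qed.

Lemma idem_idem n i : R n -> idem n i * idem n i = idem n i.
Proof. by move=> h; have [] := idem_mul h (leqnn i). Qed.

Definition rkm n (M : lmodule (A n)) (i : nat) : nat :=
  rkg (idem n i) (idem n i.+1) (fullv : {vspace M}).

Lemma rkm_gt n (M : lmodule (A n)) i : (n < i.*2)%N -> rkm M i = 0%N.
Proof. by move=> ni; rewrite /rkm /rkg idem_gt // linear0 lim0g dimv0. Qed.

Lemma rkm_surj n (M M' : lmodule (A n)) (f : 'Hom(M', M)) i :
  mhom f -> limg f = fullv -> (rkm M i <= rkm M' i)%N.
Proof.
move=> fh fT; rewrite /rkm -fT; apply: rkg_img; last exact: mhom_homon.
exact: fullv_submodule.
Qed.

Lemma lact1_img n (M : lmodule (A n)) (V : {vspace M}) : (lact M 1 @: V = V)%VS.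
Proof. by rewrite lact1 lim1g. Qed.

Lemma rkm0 n (M : lmodule (A n)) : R n ->
  rkm M 0 = (\dim {:M} - \dim (gen (lact M (e n) @: fullv)))%N.
Proof. by move=> h; rewrite /rkm /rkg idem0 !lact1_img idem1. Qed.

Lemma lact_ideal0 n (M : lmodule (A n)) x y : (forall v, lact M x v = 0) ->
  y \in ideal x -> forall v, lact M y v = 0.
Proof.
move=> x0 yx v; suff sub : (ideal x <= lker (lact M))%VS.
  by have := subvP sub _ yx; rewrite memv_ker => /eqP->; rewrite zero_lfunE.
apply: ideal_subP => a b; rewrite memv_ker; apply/eqP/lfunP => w.
by rewrite !lactME x0 linear0 zero_lfunE.
Qed.

Lemma rkm_killed n (M : lmodule (A n)) i : R n -> (forall v, lact M (e n) v = 0) ->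
  (rkm M i <= (i == 0) * \dim {:M})%N.
Proof.
move=> h e0; case: i => [|i]; first by rewrite rkm0 // eqxx mul1n leq_subr.
rewrite /rkm /rkg (_ : lact M (idem n i.+1) = 0) ?lim0g ?dimv0 //.
apply/lfunP => v; have [E _] := @idem_mul n 1 i.+1 h isT.
by rewrite -E lactME idem1 // e0 zero_lfunE.
Qed.

Definition cor n (h : R n.+2) (M : lmodule (A n.+2)) : lmodule (A n) :=
  cormod (phi_1 h) (phi_mul h) M.
Definition cval n (h : R n.+2) (M : lmodule (A n.+2)) : 'Hom(cor h M, M) :=
  corval (phi_1 h) (phi_mul h) M.

Lemma cval_act n (h : R n.+2) M a v :
  cval h M (lact (cor h M) a v) = lact M (phi n a) (cval h M v).
Proof. exact: corval_lact. Qed.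

Lemma limg_cval n (h : R n.+2) M : limg (cval h M) = (lact M (e n.+2) @: fullv)%VS.
Proof. exact: limg_corval. Qed.

Lemma lker_cval n (h : R n.+2) M : lker (cval h M) = 0%VS.
Proof. exact: lker_corval. Qed.

Lemma cval_inj n (h : R n.+2) M : injective (cval h M).
Proof. exact: corval_inj. Qed.

Lemma e_cval n (h : R n.+2) M v : lact M (e n.+2) (cval h M v) = cval h M v.
Proof. by rewrite -(phi_1 h) -cval_act lact1E. Qed.

Lemma cval_surj n (h : R n.+2) M v : exists w, lact M (e n.+2) v = cval h M w.
Proof.
have : lact M (e n.+2) v \in limg (cval h M).
  by rewrite limg_cval; apply: memv_img (memvf _).
by case/memv_imgP=> w _ ->; exists w.
Qed.

(** The idempotents of positive index are images under [phi], and x A y = x (e A e) y for x and y in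
    e A e; so both sides are computed inside e M. *)
Lemma rkm_cor n (h : R n.+2) M i : rkm M i.+1 = rkm (cor h M) i.
Proof.
have img x (V : {vspace cor h M}) :
    (cval h M @: (lact (cor h M) x @: V) = lact M (phi n x) @: (cval h M @: V))%VS.
  by rewrite -!limg_comp; apply: eq_in_limg => v _; rewrite !comp_lfunE cval_act.
have imgT x : (cval h M @: (lact (cor h M) x @: fullv) = lact M (phi n x) @: fullv)%VS.
  rewrite img limg_cval; apply/vspaceP => w; apply/memv_imgP/memv_imgP => -[v _ ->].
    by exists v; rewrite ?memvf.
  exists (lact M (e n.+2) v); first exact: memv_img (memvf _).
  by rewrite -lactME phi_e.
have dimC (V : {vspace cor h M}) : \dim V = \dim (cval h M @: V).
  by rewrite limg_dim_eq // lker_cval capv0.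
rewrite /rkm /rkg !dimC imgT; congr (_ - \dim _)%N; rewrite img /=.
set x := idem n i; set y := idem n i.+1.
apply/eqP; rewrite eqEsubv; apply/andP; split; apply: limg_subP => v vg.
  suff: v \in (lact M (phi n x) @^-1:
      (lact M (phi n x) @: (cval h M @: gen (lact (cor h M) y @: fullv))))%VS.
    by rewrite -memv_preim.
  apply: subvP vg; apply: gen_sub => a u /memv_imgP[{}v _ ->]; rewrite -memv_preim.
  (* Between two elements of the corner, a may be replaced by e a e, which is [phi n b]. *)
  have [b bE] := e_corner a h; have [w wE] := cval_surj h v.
  have -> : lact M (phi n x) (lact M a (lact M (phi n y) v)) =
      lact M (phi n x) (cval h M (lact (cor h M) b (lact (cor h M) y w))).
    rewrite !cval_act -wE -bE -!lactME !mulrA phi_e // -(mulrA _ (e _)) e_phi //.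
    by rewrite -(mulrA _ (phi n y)) phi_e.
  do 2!apply: memv_img; apply: mem_gen; exact: memv_img (memvf _).
case/memv_imgP: vg => {}w wg ->; move: wg; rewrite -cval_act => wg.
have : w \in (lact (cor h M) x @^-1: (cval h M @^-1:
    (lact M (phi n x) @: gen (lact M (phi n y) @: fullv))))%VS.
  apply: subvP wg; apply: (@gen_sub _ _ (cor h M)) => a u /memv_imgP[v' _ ->].
  rewrite -!memv_preim.
  rewrite !cval_act; apply: memv_img; apply: mem_gen.
  exact: memv_img (memvf _).
by rewrite -!memv_preim.
Qed.

Local Notation G n Y := (glob (e n.+2) (phi n) Y).

Lemma glob_gen n (h : R n.+2) (Y : lmodule (A n)) :
  gen (lact (G n Y) (e n.+2) @: fullv) = fullv.
Proof.
apply: (glob_span (e_idem h)) => b v; rewrite -(gpe _ (e_idem h)) -[gp _ _ _ _]lact_gp.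
by apply: mem_gen; rewrite -[X in gp _ _ X _]mulr1 -lact_gp memv_img ?memvf.
Qed.

Lemma rkm_glob0 n (h : R n.+2) (Y : lmodule (A n)) : rkm (G n Y) 0 = 0%N.
Proof. by rewrite rkm0 // glob_gen // subnn. Qed.

Lemma to_cor n (h : R n.+2) (Y : vectType k) (M : lmodule (A n.+2)) (f : 'Hom(Y, M)) :
  (forall v, lact M (e n.+2) (f v) = f v) ->
  exists g : 'Hom(Y, cor h M), forall v, cval h M (g v) = f v.
Proof.
move=> ef; exists ((cval h M)^-1 \o f)%VF => v; rewrite comp_lfunE limg_lfunVK //.
by rewrite limg_cval -ef memv_img ?memvf.
Qed.

(** The map is v -> e (x) v. It is onto since e b e = phi(c) for some c, whence e (b e (x) v) = e
    (x) c v. *)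
Lemma glob_to_cor n (h : R n.+2) (Y : lmodule (A n)) :
  exists2 f : 'Hom(Y, cor h (G n Y)), mhom f & limg f = fullv.
Proof.
have ee := e_idem h; have ep := e_phi h.
have [|f fE] := @to_cor n h Y (G n Y) (mkhom (gp_linr (e n.+2) (phi n) (e n.+2))) => [v|].
  by rewrite mkhomE lact_gp ee.
exists f => [a v|].
  by apply: cval_inj; rewrite cval_act !fE !mkhomE gp_act // ep lact_gp phi_e.
apply/eqP; rewrite -(@eq_limg_ker0 _ _ _ (cval h (G n Y))) ?lker_cval // limg_cval.
rewrite eqEsubv; apply/andP; split.
  by apply: limg_subP => _ /memv_imgP[v _ ->]; rewrite -e_cval memv_img ?memvf.
apply: limg_subP => t _; rewrite memv_preim (_ : (_ @^-1: _)%VS = fullv) ?memvf //.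
apply: (glob_span ee) => b v; rewrite -memv_preim lact_gp -(gpe _ ee).
have [c ->] := e_corner b h; rewrite -[phi n c]ep -gp_act //.
by rewrite -[gp _ _ _ _](mkhomE (gp_linr (e n.+2) (phi n) (e n.+2))) -fE !memv_img ?memvf.
Qed.

Lemma rkm_glob n (h : R n.+2) (Y : lmodule (A n)) i : (rkm (G n Y) i.+1 <= rkm Y i)%N.
Proof.
by have [f fh fT] := glob_to_cor h Y; rewrite (rkm_cor h); apply: rkm_surj fh fT.
Qed.

(** Induction is globalisation at the idempotent 1, so the same tools serve both. *)
Definition ind n (h : R n.+1) (X : lmodule (A n)) : lmodule (A n.+1) := glob 1 (iota h) X.

Let m1 n : (1 : A n) * 1 = 1. Proof. exact: mulr1. Qed.

(** The map sends b (x) v to iota(b) e (x) v. It is onto because A_(n+2) e = iota(A_(n+1)) e. *)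
Lemma ind_glob n (h1 : R n.+1) (h2 : R n.+2) (Y : lmodule (A n)) :
  exists2 f : 'Hom(ind h1 Y, res (iota h2) (G n Y)), mhom f & limg f = fullv.
Proof.
have ee := e_idem h2; have ep := e_phi h2.
have [f fE] : exists f : 'Hom(ind h1 Y, res (iota h2) (G n Y)),
    forall b v, f (gp 1 (iota h1) b v) = (gp (e n.+2) (phi n) (iota h2 b) v : G n Y).
  apply: glob_lift => [v c a b|b|b v|a b v].
  - by rewrite linearP gp_linl.
  - exact: gp_linr.
  - by rewrite mulr1.
  by rewrite rmorphM gp_act // (td_phi td h1 h2) mulrA gpe.
exists f.
  apply: (glob_liftM (m1 _) fE) => c b v.
  by rewrite rmorphM res_actE; apply/esym/lact_gp.
apply: (glob_span ee) => b v; rewrite -(gpe _ ee).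
have [y ->] := td_left td h2 b; rewrite gpe //.
by rewrite -[gp _ _ _ _]fE memv_img ?memvf.
Qed.

(** The counit b e (x) v -> b v of the adjunction between globalisation and passage to the
    corner. *)
Lemma cor_glob n (h : R n.+2) (M : lmodule (A n.+2)) :
  exists2 f : 'Hom(G n (cor h M), M), mhom f & limg f = gen (lact M (e n.+2) @: fullv).
Proof.
have ee := e_idem h; have ep := e_phi h.
have [f fE] : exists f : 'Hom(G n (cor h M), M),
    forall b v, f (gp (e n.+2) (phi n) b v) = lact M b (cval h M v).
  apply: glob_lift => [v c a b|b c u v|b v|a b v].
  - by rewrite linearP add_lfunE scale_lfunE.
  - by rewrite !linearP.
  - by rewrite lactME e_cval.
  by rewrite lactME cval_act.
have fh : mhom f by apply: (glob_liftM ee fE) => c b v; rewrite lactME.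
exists f => //; apply/eqP; rewrite eqEsubv; apply/andP; split.
  apply: limg_subP => t _; rewrite memv_preim (_ : (_ @^-1: _)%VS = fullv) ?memvf //.
  apply: (glob_span ee) => b v; rewrite -memv_preim fE mem_gen //.
  by rewrite -e_cval memv_img ?memvf.
apply: gen_sub => a _ /memv_imgP[v _ ->]; have [w ->] := cval_surj h v.
by rewrite -fE memv_img ?memvf.
Qed.

(** The map v -> e (x) v is A_n-linear because e commutes with A_n, and onto because e A_(n+2) = e
    iota(A_(n+1)). *)
Lemma res_cor_ind n (h1 : R n.+1) (h2 : R n.+2) (X : lmodule (A n.+1)) :
  exists2 f : 'Hom(res (iota h1) X, cor h2 (ind h2 X)), mhom f & limg f = fullv.
Proof.
have i1 a : 1 * iota h2 a = iota h2 a by rewrite mul1r.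
have [|f fE] := @to_cor n h2 X (ind h2 X) (mkhom (gp_linr 1 (iota h2) (e n.+2))) => [v|].
  by rewrite mkhomE [LHS]lact_gp e_idem.
exists f => [a v|].
  apply: cval_inj; rewrite cval_act !fE !mkhomE res_actE.
  rewrite gp_act // [RHS]lact_gp (td_phi td h1 h2) -(mulrA _ (e _)) e_idem //.
  by rewrite (td_comm td).
apply/eqP; rewrite -(@eq_limg_ker0 _ _ _ (cval h2 _)) ?lker_cval // limg_cval.
rewrite eqEsubv; apply/andP; split.
  by apply: limg_subP => _ /memv_imgP[v _ ->]; rewrite -e_cval memv_img ?memvf.
apply: limg_subP => t _; rewrite memv_preim (_ : (_ @^-1: _)%VS = fullv) ?memvf //.
apply: (glob_span (m1 _)) => b v; rewrite -memv_preim [lact _ _ _]lact_gp.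
have [y ->] := td_right td h2 b; rewrite -gp_act //.
by rewrite -[gp _ _ _ _](mkhomE (gp_linr 1 (iota h2) (e n.+2))) -fE !memv_img ?memvf.
Qed.

Lemma ideal_gen n (M : lmodule (A n)) x y (v : M) :
  y \in ideal x -> lact M y v \in gen (lact M x @: fullv).
Proof.
have fl : linear (fun z => lact M z v).
  by move=> c a b; rewrite linearP add_lfunE scale_lfunE.
move=> yx; rewrite -[lact M y v](mkhomE fl) memv_preim; apply: subvP yx.
apply: ideal_subP => a b; rewrite -memv_preim mkhomE -mulrA !lactME mem_gen //.
by rewrite memv_img ?memvf.
Qed.

(** Modulo the ideal of e_(n+1), the algebra A_(n+1) is the sum of the (n+1) m translates g_a A_n,
    and g_a (x) A_n e_n X falls into the part generated by e_(n+1). What remains is spanned by (n+1)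
    m copies of a complement of A_n e_n X. *)
Lemma rkm_ind0 n (h : R n.+1) (X : lmodule (A n)) :
  (rkm (ind h X) 0 <= n.+1 * m * rkm X 0)%N.
Proof.
have [g gP] := td_cosets td h; have hn := in_rangeS h.
have i1 a : 1 * iota h a = iota h a by rewrite mul1r.
rewrite !rkm0 //; set U := gen (lact X (e n) @: fullv).
set V := gen (lact (ind h X) _ @: fullv).
pose G a := mkhom (gp_linr (M := X) 1 (iota h) (g a)).
pose W := (\sum_a (G a @: U^C) + V)%VS.
have VE x v : x \in ideal (e n.+1) -> gp 1 (iota h) x v \in V.
  by move=> xe; rewrite -[x]mulr1 -[gp _ _ _ _]lact_gp; apply: ideal_gen.
have WT : W = fullv.
  apply: (glob_span (m1 _)) => b v; have [y yP] := gP b.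
  have -> : gp 1 (iota h) b v = gp 1 (iota h) (b - \sum_a g a * iota h (y a)) v +
      \sum_a gp 1 (iota h) (g a * iota h (y a)) v.
    have E x : gp 1 (iota h) x v = mkhom (gp_linl 1 (iota h) v) x by rewrite mkhomE.
    by rewrite E (eq_bigr _ (fun a _ => E _)) -linear_sum E -linearD subrK.
  apply: memvD; first by apply: (subvP (addvSr _ _)); apply: VE.
  apply: memv_suml => a _; rewrite -gp_act //.
  have /memv_addP[u Uu [z Zz ->]] : lact X (y a) v \in (U + U^C)%VS by rewrite addv_complf memvf.
  rewrite -[gp _ _ _ _](mkhomE (gp_linr (M := X) 1 (iota h) (g a))) linearD /=; apply: memvD.
    apply: (subvP (addvSr _ _)); rewrite memv_preim; apply: subvP Uu.
    apply: gen_sub => c _ /memv_imgP[w _ ->]; rewrite -memv_preim mkhomE.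
    rewrite !gp_act //; apply: VE; apply: ideal_mull_closed.
    exact: (td_iota_e td).
  apply: (subvP (addvSl _ _)); apply: (subvP (sumv_sup a _ (subvv _))) => //.
  exact: memv_img.
rewrite leq_subLR -{1}WT; apply: leq_trans (dimv_add_leqif _ _).1 _.
rewrite addnC leq_add2l; apply: leq_trans (dimv_leq_sum _ _ _) _.
apply: leq_trans (_ : \sum_(a < n.+1 * m) \dim U^C <= _)%N.
  by apply: leq_sum => a _; apply: dim_limg_le.
by rewrite sum_nat_const card_ord dimv_compl.
Qed.

(** The first term is the part of X with one arc fewer, restricted. The second is the part with i
    arcs, induced; (n+1-2i) m is the index of Z/m wr S_(n-2i) in Z/m wr S_(n+1-2i). *)
Definition ind_bound n (X : lmodule (A n)) i : nat :=
  ((if i is i'.+1 then rkm X i' else 0) + (n.+1 - i.*2) * m * rkm X i)%N.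

(** The induction hypothesis of [rkm_ind], isolated because two estimates are intertwined: induction
    from A_n uses restriction to A_(n-1), which uses induction from A_(n-2). *)
Let bounded_below n := forall n' (h' : R n'.+1) (Y : lmodule (A n')) j, (n' < n)%N ->
  (rkm (ind h' Y) j <= ind_bound Y j)%N.

(** A e X is a quotient of the globalisation of e X, whose restriction is a quotient of an induced
    module; the ranks of e X are those of X shifted by one. *)
Let rkg_res_gen n (h : R n.+1) (X : lmodule (A n.+1)) i : bounded_below n ->
  (rkg (idem n i) (idem n i.+1)
     (gen (lact X (e n.+1) @: fullv) : {vspace res (iota h) X})
    <= (i != 0) * rkm X i + (n - i.*2) * m * rkm X i.+1)%N.
Proof.
case: n h X => [|n] h X IH.
  have [_ e1 _] := td_A1 td; rewrite e1 linear0 lim0g gen0.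
  by rewrite /rkg !limg0 gen0 !limg0 dimv0.
have hn := in_rangeS h.
have [p ph pT] := cor_glob h X; have [p' ph' pT'] := ind_glob hn h (cor h X).
pose p2 : 'Hom(ind hn (cor h X), res (iota h) X) := (p \o p')%VF.
have p2h : mhom p2 by move=> a v; rewrite !comp_lfunE ph' !res_actE ph.
have p2T : limg p2 = gen (lact X (e n.+2) @: fullv) by rewrite limg_comp pT'.
rewrite -p2T; apply: leq_trans (rkg_img _ _ (@fullv_submodule _ _ _) (mhom_homon p2h)) _.
apply: leq_trans (IH n hn (cor h X) i (leqnn _)) _.
by rewrite /ind_bound -!rkm_cor; case: (i) => [|j] //=; rewrite -?rkm_cor; lia.
Qed.

(** X is cut into A e X and D = X / A e X. The restriction of D is killed by e_n, so D contributes
    to the rank at i = 0 only. *)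
Let rkm_res_step n (h : R n.+1) (X : lmodule (A n.+1)) i : bounded_below n ->
  (rkm (res (iota h) X) i <= rkm X i + (n - i.*2) * m * rkm X i.+1)%N.
Proof.
move=> IH; have hn := in_rangeS h; have rU := rkg_res_gen h X i IH.
have hU := @gen_submodule _ _ X (lact X (e n.+1) @: fullv)%VS.
move: rU hU; set U := gen _ => rU hU.
pose D := quomod hU; pose q := quomap hU.
pose f : 'Hom(res (iota h) X, res (iota h) D) := q.
have hU' : @submodule _ _ (res (iota h) X) U by move=> a v; rewrite res_actE; apply: hU.
have fh : @mhom _ _ (res (iota h) X) (res (iota h) D) f.
  by move=> a v; rewrite !res_actE; apply: quomapP.
have fT : limg f = fullv by apply: limg_quomap.
have := rkg_ext (idem n i.+1) (idem_idem i hn) hU' (@fullv_submodule _ _ _)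
  (subvf _) (mhom_homon fh); rewrite [limg f]fT capfv => /(_ (lker_quomap hU)).
move/leq_trans; apply; rewrite -/(rkm (res (iota h) D) i).
have rD : (rkm (res (iota h) D) i <= (i == 0) * rkm X 0)%N.
  apply: leq_trans (rkm_killed _ hn _) _ => [v|].
    rewrite res_actE; apply: (lact_ideal0 (x := e n.+1)) => [w|]; last exact: (td_iota_e td).
    have [w' ->] := limg_fullP w (limg_quomap hU); rewrite -quomapP.
    apply/eqP; rewrite -memv_ker lker_quomap; apply: (subvP (sub_gen _)).
    by rewrite memv_img ?memvf.
  rewrite leq_mul2l; apply/orP; right; rewrite rkm0 //.
  have := limg_ker_dim q fullv; rewrite lker_quomap capfv [limg q]limg_quomap.
  by move: (\dim U) (\dim {:X}) (\dim {:D}) => a b c; lia.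
by move: rU rD; case: (i) => [|j] /=; lia.
Qed.

(** The ranks of positive index of an induced module are ranks of its corner, which is a quotient of
    a restriction. *)
Lemma rkm_ind n (h : R n.+1) (X : lmodule (A n)) i : (rkm (ind h X) i <= ind_bound X i)%N.
Proof.
elim/ltn_ind: n h X i => n IH h X [|i]; first by rewrite /ind_bound subn0 add0n rkm_ind0.
case: n h X IH => [|n] h X IH; first by rewrite rkm_gt.
have hn := in_rangeS h; have [f fh fT] := res_cor_ind hn h X.
rewrite (rkm_cor h); apply: leq_trans (rkm_surj i fh fT) _.
apply: leq_trans (@rkm_res_step n hn X i _) _ => [n' h' Y j nn'|]; first by apply: IH; lia.
by rewrite /ind_bound doubleS !subSS.
Qed.

Lemma rkm_res n (h : R n.+1) (X : lmodule (A n.+1)) i :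
  (rkm (res (iota h) X) i <= rkm X i + (n - i.*2) * m * rkm X i.+1)%N.
Proof. by apply: rkm_res_step => n' h' Y j _; apply: rkm_ind. Qed.

Local Notation C := (halfd m).

Lemma sum_shift (n : nat) (f : nat -> nat) :
  (\sum_(i < n.+1) f i = f 0%N + \sum_(i < n) f i.+1)%N.
Proof. by rewrite big_ord_recl. Qed.

(** Summation by parts: the operator in the restriction bound is the transpose of the recursion
    [halfdS]. *)
Lemma halfd_adjoint n (r : nat -> nat) :
  (\sum_(i < n.+1) C n i * (r i + (n - i.*2) * m * r i.+1) =
   \sum_(i < n.+2) C n.+1 i * r i)%N.
Proof.
rewrite (sum_shift n.+1 (fun i => C n.+1 i * r i)%N) halfd0 mul1n.
rewrite (eq_bigr (fun i : 'I_n.+1 => C n i * r i + (n - i.*2) * m * C n i * r i.+1)%N) => [|i _].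
  rewrite big_split /= (sum_shift n (fun i => C n i * r i)%N) halfd0 mul1n -addnA; congr (_ + _)%N.
  rewrite [X in (X + _)%N](_ : _ = \sum_(i < n.+1) C n i.+1 * r i.+1)%N.
    by rewrite -big_split; apply: eq_bigr => i _; rewrite halfdS mulnDl.
  by rewrite [RHS]big_ord_recr /= halfd_gt ?addn0 //; lia.
by rewrite mulnDr; congr (_ + _)%N; nia.
Qed.

Lemma dim_glob_le n (h1 : R n.+1) (h2 : R n.+2) (Y : lmodule (A n)) :
  (\dim {: ind h1 Y} <= \sum_(i < n.+2) C n.+1 i * rkm (ind h1 Y) i)%N ->
  (\dim {: G n Y} <= \sum_(i < n.+2) C n.+2 i.+1 * rkm Y i)%N.
Proof.
move=> bnd; have [f fh fT] := ind_glob h1 h2 Y.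
have le : (\dim {: G n Y} <= \dim {: ind h1 Y})%N := dim_limg_full fT.
apply: leq_trans le _; apply: leq_trans bnd _.
(* After a shift of the ranks of Y by one arc, the induction bound has the shape of the restriction
   bound, so that [halfd_adjoint] applies. *)
pose r i := if i is i'.+1 then rkm Y i' else 0%N.
have := halfd_adjoint n.+1 r; rewrite (sum_shift n.+2 (fun i => C n.+2 i * r i)%N) muln0 add0n => <-.
by apply: leq_sum => i _; rewrite leq_mul2l rkm_ind orbT.
Qed.

(** M is an extension of M / A e M, of dimension r_0, by A e M. The latter is a quotient of the
    globalisation of e M, whose dimension is controlled by a module induced to A_(n-1). *)
Lemma dim_bound n (h : R n) (M : lmodule (A n)) :
  (\dim {:M} <= \sum_(i < n.+1) C n i * rkm M i)%N.
Proof.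
elim/ltn_ind: n h M => n IH h M.
have gb : (\dim (gen (lact M (e n) @: fullv)) <= \sum_(i < n) C n i.+1 * rkm M i.+1)%N.
  have [e0 e1 _] := td_A1 td; case: n h M IH => [|[|n]] h M IH.
  - by rewrite e0 linear0 lim0g gen0 dimv0.
  - by rewrite e1 linear0 lim0g gen0 dimv0.
  have [p ph <-] := cor_glob h M; have h1 := in_rangeS h.
  apply: leq_trans (dim_limg_le _ _) _.
  apply: leq_trans (dim_glob_le h (IH n.+1 (ltnSn _) h1 (ind h1 (cor h M)))) _.
  by apply: leq_sum => i _; rewrite (rkm_cor h).
rewrite (sum_shift n (fun i => C n i * rkm M i)%N) halfd0 mul1n rkm0 //.
by move: gb; lia.
Qed.

End Tower.

(** * Simple submodules and quotients *)

Section SimpleModules.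

Variables (k : fieldType) (A : falgType k).
Implicit Types M L : lmodule A.

Lemma regularE a (x : A) : lact (regular A) a x = a * x.
Proof.
have rE b y : reg_act b y = b * y
  by rewrite /reg_act linfunE // => c u v; rewrite mulrDr scalerAr.
have rl : linear (@reg_act _ A).
  move=> c b d; apply/lfunP => y.
  by rewrite add_lfunE scale_lfunE !rE mulrDl scalerAl.
by rewrite /regular /= linfunE // rE.
Qed.

(** Descent on the dimension. Minimality of K quantifies over all its subspaces, so excluded middle
    decides whether to stop. *)
Lemma simple_submodule_ex M (K : {vspace M}) : submodule K -> K != 0%VS ->
  exists2 W : {vspace M}, [/\ submodule W, (W <= K)%VS & W != 0%VS] &
  forall U : {vspace M}, submodule U -> (U <= W)%VS -> U = 0%VS \/ U = W.
Proof.
move: {-1}(\dim K) (leqnn (\dim K)) => d; elim: d K => [|d IH] K dK hK K0.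
  by move: dK; rewrite leqn0 dimv_eq0 (negPf K0).
case: (classic (forall U : {vspace M}, submodule U -> (U <= K)%VS -> U = 0%VS \/ U = K)).
  by exists K.
move=> nsK; have [U nU] := not_all_ex_not _ _ nsK.
have [hU nU'] := imply_to_and _ _ nU; have [UK nU''] := imply_to_and _ _ nU'.
have [U0 UnK] := not_or_and _ _ nU''.
have dU : (\dim U <= d)%N.
  rewrite -ltnS; apply: leq_trans _ dK; rewrite ltn_neqAle dimvS // andbT.
  apply/eqP => dE; apply: UnK; apply/eqP; rewrite eqEdim UK /= dE; exact: leqnn.
have [|W [hW WU W0] Wm] := IH U dU hU; first exact/eqP.
by exists W => //; split => //; apply: subv_trans UK.
Qed.

Lemma simple_submod M (W : {vspace M}) (hW : submodule W) : W != 0%VS ->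
  (forall U : {vspace M}, submodule U -> (U <= W)%VS -> U = 0%VS \/ U = W) ->
  simple_module (submod hW).
Proof.
pose v : 'Hom(submod hW, M) := linfun (@vsval _ _ W).
have vE w : v w = vsval w by rewrite lfunE.
have vh : mhom v by move=> a w; rewrite !vE submodE.
have v0 : lker v == 0%VS by apply/lker0P => x y; rewrite !vE => /val_inj.
have vT : limg v = W.
  apply: limg_eq => [w _|w wW]; first by rewrite vE subvsP.
  by exists (vsproj W w); rewrite ?memvf // vE vsprojK.
move=> W0 Wm; split=> [|U hU].
  by apply: contraNneq W0 => E; rewrite -vT E limg0.
have vUW : (v @: U <= W)%VS by apply: limg_subP => w _; rewrite vE subvsP.
have [E|E] := Wm (v @: U)%VS (limg_submodule hU (mhom_homon vh)) vUW; [left | right]; apply/eqP.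
  by rewrite -(eq_limg_ker0 _ _ v0) E limg0.
by rewrite -(eq_limg_ker0 _ _ v0) E vT.
Qed.

Lemma simple_surj M L (f : 'Hom(M, L)) : simple_module L -> mhom f -> f != 0 ->
  limg f = fullv.
Proof.
move=> [_ sL] fh f0; have := sL _ (limg_submodule (@fullv_submodule _ _ M) (mhom_homon fh)).
case=> // E; case/negP: f0; apply/eqP/lfunP => v; rewrite zero_lfunE.
by apply/eqP; rewrite -memv0 -E memv_img ?memvf.
Qed.

End SimpleModules.

(** * Depths and weights of labels *)

Section Labels.

Variables (k : fieldType) (A : nat -> falgType k) (e : forall n, A n).

Fixpoint top n (l : Lambda e n) : nat :=
  match l with Lnew _ L _ _ => \dim {:L} | Lold _ l' => top l' end.

Fixpoint depth n (l : Lambda e n) : nat :=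
  match l with Lnew _ _ _ _ => 0 | Lold _ l' => (depth l').+1 end.

Lemma layer_depth n (l : Lambda e n) : (layer l + (depth l).*2 = n)%N.
Proof. by elim: l => [*|{}n l IH] /=; lia. Qed.

Lemma top_gt0 n (l : Lambda e n) : (0 < top l)%N.
Proof. by elim: l => [{}n L [L0 _] _ /=|//]; rewrite lt0n dimv_eq0. Qed.

(** Multiplicities are weighted by the dimension of the simple module, since this is the unit in
    which r_i measures a standard module of depth i. *)
Definition wts n (s : seq (Lambda e n)) i : nat :=
  (\sum_(l <- s) (depth l == i) * top l)%N.

Lemma wts_cons n (l : Lambda e n) s i : wts (l :: s) i = ((depth l == i) * top l + wts s i)%N.
Proof. by rewrite /wts big_cons. Qed.

Lemma wts_cat n (s t : seq (Lambda e n)) i : wts (s ++ t) i = (wts s i + wts t i)%N.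
Proof. by rewrite /wts big_cat. Qed.

Lemma wts_nil n i : wts ([::] : seq (Lambda e n)) i = 0%N.
Proof. by rewrite /wts big_nil. Qed.

Lemma wts_old n (s : seq (Lambda e n)) i :
  wts (map (@Lold _ _ e n) s) i = if i is i'.+1 then wts s i' else 0%N.
Proof.
rewrite /wts big_map; case: i => [|i]; first by rewrite big1.
by apply: eq_bigr => l _; rewrite /= eqSS.
Qed.

Lemma sum_wts n (s : seq (Lambda e n)) (c : nat -> nat) :
  (\sum_(l <- s) c (depth l) * top l = \sum_(i < n.+1) c i * wts s i)%N.
Proof.
elim: s => [|l s IH]; first by rewrite big_nil big1 // => i _; rewrite wts_nil muln0.
rewrite big_cons IH [RHS](eq_bigr (fun i : 'I_n.+1 =>
  (c i * ((depth l == i) * top l) + c i * wts s i)%N)) => [|i _]; last first.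
  by rewrite wts_cons mulnDr.
rewrite big_split /=; congr (_ + _)%N.
have dl : (depth l < n.+1)%N by have := layer_depth l; lia.
rewrite (bigD1 (Ordinal dl)) //= eqxx mul1n big1 ?addn0 // => i ni.
rewrite (_ : (depth l == i) = false) ?muln0 //.
by apply: contraNF ni => /eqP E; apply/eqP/val_inj.
Qed.

End Labels.

(** * Extensions of quotients of standard modules *)

Section Filtrations.

Variables (k : fieldType) (m : nat) (N : option nat) (A : nat -> falgType k).
Variables (e : forall n, A n) (phi : forall n, 'Hom(A n, A n.+2)).
Variable iota : forall n, in_range N n.+1 -> 'AHom(A n, A n.+1).
Hypothesis td : tower_data m e phi iota.

Local Notation idem := (idem phi).
Local Notation R := (in_range N).
Local Notation C := (halfd m).
Local Notation rkm := (rkm phi).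
Local Notation Delta := (Delta phi).
Local Notation G n Y := (glob (e n.+2) (phi n) Y).

(* Extensions of quotients of standard modules; the labels are listed from the
   bottom of M upwards. *)
Inductive qf n : lmodule (A n) -> seq (Lambda e n) -> Prop :=
| qf0 (M : lmodule (A n)) : \dim {:M} = 0%N -> qf M [::]
| qfS (M M' : lmodule (A n)) (l : Lambda e n) s (f : 'Hom(Delta l, M))
    (g : 'Hom(M, M')) : mhom f -> mhom g -> lker g = limg f ->
    limg g = fullv -> qf M' s -> qf M (l :: s).

(** Closure under quotients is the reason for allowing quotients of standard modules as layers: the
    bottom layer is replaced by its image, and the rest by a quotient of the rest. *)
Lemma qf_surj n (M M' : lmodule (A n)) s (p : 'Hom(M, M')) :
  mhom p -> limg p = fullv -> qf M s -> qf M' s.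
Proof.
move=> ph pT qM; elim: qM M' p ph pT => {M s} [M M0|M M1 l s f g fh gh gk gT _ IH] M' p ph pT.
  by apply: qf0; have := dim_limg_full pT; rewrite M0; lia.
have pfh := mhom_comp fh ph.
have hU : submodule (limg (p \o f)) := limg_submodule (@fullv_submodule _ _ _) (mhom_homon pfh).
have gpk : (lker g <= lker (quomap hU \o p))%VS.
  rewrite gk; apply: limg_subP => v _; rewrite memv_ker comp_lfunE -memv_ker lker_quomap.
  by rewrite -comp_lfunE memv_img ?memvf.
have [p' p'h p'E] := mhom_factor gh (mhom_comp ph (@quomapP _ _ _ _ hU)) gT gpk.
apply: (qfS pfh (@quomapP _ _ _ _ hU)) => //; first exact: lker_quomap.
  exact: limg_quomap.
apply: IH p'h _; apply: eq_fullv => t; have [w ->] := limg_fullP t (limg_quomap hU).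
have [v ->] := limg_fullP w pT; rewrite -[quomap hU _]comp_lfunE -p'E.
by rewrite memv_img ?memvf.
Qed.

Lemma qf_dim n (M : lmodule (A n)) s : qf M s ->
  (\dim {:M} <= \sum_(l <- s) \dim {: Delta l})%N.
Proof.
elim=> {M s} [M ->|M M' l s f g fh gh gk gT _ IH]; first by rewrite big_nil.
rewrite big_cons; have := limg_ker_dim g fullv; rewrite capfv gT gk => <-.
exact: leq_add (dim_limg_le _ _) IH.
Qed.

(** The filtration of M', pulled back along p, is stacked on top of that of the kernel. *)
Lemma filtered_pull n (M M' : lmodule (A n)) (p : 'Hom(M, M')) s0 :
  mhom p -> limg p = fullv -> filtered phi (lker p) s0 ->
  forall V s, @filtered _ _ e phi _ M' V s -> filtered phi (p @^-1: V) (s ++ s0).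
Proof.
move=> ph pT F0 V s; elim=> {V s} [|V1 V2 l s _ IH hV2 V12 [f [fT fK fh]]].
  by rewrite lpreim0.
rewrite cat_cons; apply: FilteredS IH _ _ _.
- by move=> a v; rewrite -!memv_preim ph; apply: hV2.
- exact: lpreimS.
exists (f \o p)%VF; split.
- by rewrite limg_comp lpreimK // pT subvf.
- apply/vspaceP => v; rewrite memv_cap -!memv_preim memv_ker comp_lfunE.
  by rewrite -fK memv_cap memv_ker.
by move=> a v; rewrite -memv_preim !comp_lfunE ph; apply: fh.
Qed.

(** When the dimensions add up, each map from a standard module is injective. The list is reversed
    because [filtered] reads it from the top. *)
Lemma qf_filtered n (M : lmodule (A n)) s : qf M s ->
  \dim {:M} = (\sum_(l <- s) \dim {: Delta l})%N -> filtered phi (fullv : {vspace M}) (rev s).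
Proof.
elim=> {M s} [M M0 _|M M' l s f g fh gh gk gT qM' IH].
  have -> : (fullv : {vspace M}) = 0%VS by apply/eqP; rewrite -dimv_eq0 M0.
  exact: Filtered0.
rewrite big_cons => dM.
have dM' := limg_ker_dim g fullv; rewrite capfv gT gk in dM'.
have df := limg_ker_dim f fullv; rewrite capfv in df.
have bM' := qf_dim qM'.
have f0 : lker f = 0%VS.
  apply/eqP; rewrite -dimv_eq0; move: dM dM' df bM'.
  by move: (\dim {:M}) (\dim (limg f)) (\dim (lker f)) (\dim {:M'}); lia.
have fI : lker f == 0%VS by rewrite f0.
rewrite rev_cons -cats1.
have -> : (fullv : {vspace M}) = (g @^-1: fullv)%VS.
  by apply/vspaceP => v; rewrite -memv_preim !memvf.
apply: (filtered_pull gh gT); last first.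
  by apply: IH; move: dM dM' df bM'; rewrite f0 dimv0; lia.
rewrite gk; apply: (FilteredS (V1 := 0%VS)); first exact: Filtered0.
- exact: limg_submodule (@fullv_submodule _ _ _) (mhom_homon fh).
- exact: sub0v.
exists (f^-1)%VF; split.
- by rewrite -limg_comp lker0_compVf // lim1g.
- apply/eqP; rewrite -subv0; apply/subvP => v; rewrite memv_cap memv_ker memv0.
  case/andP=> /memv_imgP[w _ ->]; rewrite (lker0_lfunK fI) => /eqP->.
  by rewrite linear0.
by move=> a v /memv_imgP[w _ ->]; rewrite -fh !(lker0_lfunK fI).
Qed.

(** Simple submodules of the kernel of p are split off one at a time. As e_n kills M, each of them
    is a label of depth 0, whose standard module is the simple module itself. *)
Lemma qf_peel n (M Q : lmodule (A n)) (p : 'Hom(M, Q)) t :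
  (forall v, lact M (e n) v = 0) -> mhom p -> limg p = fullv -> qf Q t ->
  exists2 s, qf M (s ++ t) & forall i, (wts s i <= (i == 0) * \dim (lker p))%N.
Proof.
have [d dp] : exists d, (\dim (lker p) <= d)%N by exists (\dim (lker p)).
elim: d M p dp => [|d IH] M p dp Me ph pT qQ.
  have p0 : lker p == 0%VS by rewrite -dimv_eq0 -leqn0.
  exists [::] => [|i]; last by rewrite wts_nil.
  apply: (qf_surj (p := (p^-1)%VF)) qQ => [a v|].
    have [w ->] := limg_fullP v pT; by rewrite -ph !(lker0_lfunK p0).
  by apply: eq_fullv => v; rewrite -(lker0_lfunK p0 v) memv_img ?memvf.
case: (eqVneq (lker p) 0%VS) => [p0|p0].
  have [|s qM sP] := IH M p _ Me ph pT qQ; first by rewrite p0 dimv0.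
  by exists s.
have [W [hW WK W0] Wm] := simple_submodule_ex (lker_submodule ph) p0.
have sW := simple_submod hW W0 Wm.
have aW : annihilates (ideal (e n)) (submod hW).
  move=> a v ae; apply: (lact_ideal0 (x := e n)) ae _ => {}v.
  by apply: val_inj; rewrite /= submodE Me.
pose l := Lnew sW aW.
pose f : 'Hom(Delta l, M) := linfun (@vsval _ _ W).
have fh : mhom f by move=> a v; rewrite !lfunE /= submodE.
have fT : limg f = W.
  apply: limg_eq => [w _|w wW]; first by rewrite lfunE /= subvsP.
  by exists (vsproj W w); rewrite ?memvf // lfunE /= vsprojK.
pose q := quomap hW; have qh := @quomapP _ _ _ _ hW.
have qT := limg_quomap hW; have qK := lker_quomap hW.
have [|p' p'h p'E] := mhom_factor qh ph qT; first by rewrite qK.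
have p'T : limg p' = fullv.
  apply: eq_fullv => t'; have [v ->] := limg_fullP t' pT; rewrite -p'E.
  by rewrite memv_img ?memvf.
have dK : (\dim (lker p') + \dim W = \dim (lker p))%N.
  have := limg_ker_dim q (lker p); rewrite qK (capv_idPr WK) => <-.
  rewrite addnC; congr (_ + \dim _)%N; apply/esym/limg_eq => [v|w].
    by rewrite !memv_ker p'E.
  have [v ->] := limg_fullP w qT; rewrite memv_ker p'E => pv.
  by exists v; rewrite ?memv_ker.
have dW : (0 < \dim W)%N by rewrite lt0n dimv_eq0.
have [||s qM' sP] := IH (quomod hW) p' _ _ p'h p'T qQ; clear IH.
- by move: dK dW dp; lia.
- move=> w; have [v ->] := limg_fullP w qT; rewrite -qh Me; exact: linear0.
exists (l :: s) => [|i].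
  by apply: (qfS fh qh) qM' => //; rewrite qK fT.
have E : \dim {: submod hW} = \dim W.
  rewrite -[in RHS]fT limg_dim_eq // capfv; apply/eqP/lker0P => x y.
  by rewrite !lfunE => /val_inj.
by rewrite wts_cons /= E; move: (sP i); rewrite -dK; case: i => [|i] /=; lia.
Qed.

End Filtrations.

(** * Labels of an arbitrary module, and occurrence of a given label *)

Section Standards.

Variables (k : fieldType) (m : nat) (N : option nat) (A : nat -> falgType k).
Variables (e : forall n, A n) (phi : forall n, 'Hom(A n, A n.+2)).
Variable iota : forall n, in_range N n.+1 -> 'AHom(A n, A n.+1).
Hypothesis td : tower_data m e phi iota.

Local Notation idem := (idem phi).
Local Notation R := (in_range N).
Local Notation C := (halfd m).
Local Notation rkm := (rkm phi).
Local Notation Delta := (Delta phi).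
Local Notation qf := (@qf _ _ e phi _).
Local Notation old := (@Lold _ _ e _).
Local Notation G n Y := (glob (e n.+2) (phi n) Y).

(* j identifies Y with the corner e M. *)
Lemma qf_lift n (h : R n.+2) (Y : lmodule (A n)) s : qf Y s ->
  forall (M M' : lmodule (A n.+2)) (j : 'Hom(Y, M)) (p : 'Hom(M, M')) t,
  lker j == 0%VS -> limg j = (lact M (e n.+2) @: fullv)%VS ->
  (forall a y, j (lact Y a y) = lact M (phi n a) (j y)) ->
  mhom p -> limg p = fullv -> lker p = gen (lact M (e n.+2) @: fullv) ->
  qf M' t -> qf M (map old s ++ t).
Proof.
have ee := e_idem td h; have ep := e_phi td h.
elim=> {Y s} [Y Y0|Y Y' l s f g fh gh gk gT _ IH] M M' j p t j0 jT jh ph pT pk qM'.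
  have eM0 : (lact M (e n.+2) @: fullv = 0)%VS.
    apply/eqP; rewrite -jT -dimv_eq0 -leqn0 -Y0; exact: dim_limg_le.
  have p0 : lker p == 0%VS by rewrite pk eM0 gen0.
  apply: (qf_surj (p := (p^-1)%VF)) qM' => [a v|].
    by have [w ->] := limg_fullP v pT; rewrite -ph !(lker0_lfunK p0).
  by apply: eq_fullv => v; rewrite -(lker0_lfunK p0 v) memv_img ?memvf.
have ej y : lact M (e n.+2) (j y) = j y by rewrite -(phi_1 td h) -jh lact1E.
(* The adjoint of j composed with f: the bottom layer of the corner generates a quotient of a
   globalised standard module in M. *)
have [F FE] : exists F : 'Hom(G n (Delta l), M),
    forall b v, F (gp (e n.+2) (phi n) b v) = lact M b (j (f v)).
  apply: glob_lift => [v c a b|b c u v|b v|a b v].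
  - by rewrite linearP add_lfunE scale_lfunE.
  - by rewrite !linearP.
  - by rewrite lactME ej.
  by rewrite lactME fh jh.
have Fh : mhom F by apply: (glob_liftM ee FE) => c b v; rewrite lactME.
have hW : submodule (limg F) := limg_submodule (@fullv_submodule _ _ _) (mhom_homon Fh).
have qh := @quomapP _ _ _ _ hW; have qT := limg_quomap hW; have qK := lker_quomap hW.
have FW : (limg F <= lker p)%VS.
  rewrite pk; apply: limg_subP => t' _; rewrite memv_preim.
  rewrite (_ : (_ @^-1: _)%VS = fullv) ?memvf //.
  apply: (glob_span ee) => b v; rewrite -memv_preim FE mem_gen //.
  by rewrite -ej memv_img ?memvf.
have [|p' p'h p'E] := mhom_factor qh ph qT; first by rewrite qK.
have gk' : (lker g <= lker (quomap hW \o j))%VS.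
  rewrite gk; apply: limg_subP => v _; rewrite memv_ker comp_lfunE -memv_ker qK.
  by rewrite -ej -FE memv_img ?memvf.
have [j' j'E] := lfun_factor gT gk'.
have eM' : (lact (quomod hW) (e n.+2) @: fullv = quomap hW @: (lact M (e n.+2) @: fullv))%VS.
  by rewrite (limg_lact (M' := quomod hW) _ (mhom_homon qh)) qT.
apply: (qfS (l := old l) (f := F) (g := quomap hW)) => //.
apply: IH (j') (p') _ _ _ _ p'h _ _ qM'.
(* Injectivity of [j']: if j v lies in the image of F, then j v = e (j v) lies in e F(G), which is j
   of the image of f because e b e is in the image of [phi]. *)
- rewrite -subv0; apply/subvP => y; rewrite memv_ker memv0.
  have [v ->] := limg_fullP y gT; rewrite j'E comp_lfunE.
  rewrite -memv_ker qK => jW; rewrite -memv_ker gk.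
  suff : j v \in (j @: limg f)%VS.
    by case/memv_imgP=> w wf /(lker0P j0) ->.
  rewrite -ej; move: jW; case/memv_imgP=> t' _ ->; rewrite memv_preim memv_preim.
  rewrite (_ : (_ @^-1: _)%VS = fullv) ?memvf //.
  apply: (glob_span ee) => b w; rewrite -!memv_preim FE -lactME -ej -lactME.
  have [c ->] := e_corner td b h; rewrite -jh -fh.
  by apply: memv_img; rewrite memv_img ?memvf.
- rewrite eM' -jT -limg_comp; apply/vspaceP => w; apply/memv_imgP/memv_imgP => -[v _ ->].
    by have [y ->] := limg_fullP v gT; exists y; rewrite ?memvf // j'E.
  by exists (g v); rewrite ?memvf // j'E.
- move=> a y; have [v ->] := limg_fullP y gT; rewrite -gh !j'E !comp_lfunE jh qh.
  by [].
- by apply: eq_fullv => t'; have [v ->] := limg_fullP t' pT; rewrite -p'E memv_img ?memvf.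
rewrite eM' -(limg_gen (M' := quomod hW) (V := fullv) (mhom_homon qh)) ?subvf // -pk.
apply/esym/limg_eq => [v|w]; first by rewrite !memv_ker p'E.
by have [v ->] := limg_fullP w qT; rewrite memv_ker p'E => pv; exists v; rewrite ?memv_ker.
Qed.

Definition head n (M : lmodule (A n)) : lmodule (A n) :=
  quomod (@gen_submodule _ _ M (lact M (e n) @: fullv)%VS).
Definition to_head n (M : lmodule (A n)) : 'Hom(M, head M) := quomap _.

Lemma to_headP n (M : lmodule (A n)) : mhom (to_head M).
Proof. exact: quomapP. Qed.
Lemma limg_to_head n (M : lmodule (A n)) : limg (to_head M) = fullv.
Proof. exact: limg_quomap. Qed.
Lemma lker_to_head n (M : lmodule (A n)) :
  lker (to_head M) = gen (lact M (e n) @: fullv).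
Proof. exact: lker_quomap. Qed.

Lemma head_killed n (M : lmodule (A n)) v : lact (head M) (e n) v = 0.
Proof.
have [w ->] := limg_fullP v (limg_to_head M); rewrite -to_headP.
apply/eqP; rewrite -memv_ker lker_to_head; apply: (subvP (sub_gen _)).
by rewrite memv_img ?memvf.
Qed.

Lemma dim_head n (M : lmodule (A n)) : R n -> \dim {: head M} = rkm M 0.
Proof.
move=> h; rewrite (rkm0 td) //; have := limg_ker_dim (to_head M) fullv.
by rewrite lker_to_head limg_to_head capfv => <-; rewrite addKn.
Qed.

(** The labels of the corner, taken as old labels, account for A e M, and those of the head for M /
    A e M. *)
Lemma qf_cor_head n (h : R n.+2) (M : lmodule (A n.+2)) (s : seq (Lambda e n)) t :
  qf (cor td h M) s -> (forall i, (wts s i <= rkm (cor td h M) i)%N) ->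
  qf (head M) t -> (forall i, (wts t i <= (i == 0) * \dim {: head M})%N) ->
  qf M (map old s ++ t) /\ forall i, (wts (map old s ++ t) i <= rkm M i)%N.
Proof.
move=> qs ws qt wt; split=> [|i].
  apply: (qf_lift h qs (j := cval td h M) (p := to_head M)) => //.
  - by rewrite lker_cval.
  - by rewrite limg_cval.
  - by move=> a y; rewrite cval_act.
  - exact: to_headP.
  - exact: limg_to_head.
  exact: lker_to_head.
have := wt i; rewrite dim_head // wts_cat wts_old; case: i => [|i].
  by rewrite add0n mul1n.
by rewrite mul0n leqn0 => /eqP->; rewrite addn0 (rkm_cor td h).
Qed.

Lemma qf_head_small n (M : lmodule (A n)) t : R n -> (n < 2)%N ->
  qf (head M) t -> (forall i, (wts t i <= (i == 0) * \dim {: head M})%N) ->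
  qf M t /\ forall i, (wts t i <= rkm M i)%N.
Proof.
move=> h n2 qt wt; split=> [|i]; last first.
  apply: leq_trans (wt i) _; rewrite dim_head //.
  by case: i => [|i]; rewrite ?mul1n ?mul0n.
have p0 : lker (to_head M) == 0%VS.
  rewrite lker_to_head; have [e0 e1 _] := td_A1 td.
  have -> : e n = 0 by case: (n) n2 => [|[|]].
  by rewrite linear0 lim0g gen0.
apply: (qf_surj (p := ((to_head M)^-1)%VF)) qt => [a v|].
  have [w ->] := limg_fullP v (limg_to_head M).
  by rewrite -to_headP !(lker0_lfunK p0).
by apply: eq_fullv => v; rewrite -(lker0_lfunK p0 v) memv_img ?memvf.
Qed.

Lemma qf_head_ex n (M : lmodule (A n)) : exists2 t : seq (Lambda e n),
  qf (head M) t & forall i, (wts t i <= (i == 0) * \dim {: head M})%N.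
Proof.
pose Z := quomod (@fullv_submodule _ _ (head M)).
have qZ : qf Z [::].
  apply: qf0; have := limg_ker_dim (quomap (@fullv_submodule _ _ (head M))) fullv.
  by rewrite lker_quomap limg_quomap capfv; move: (\dim _) (\dim _); lia.
have [t qt wt] := qf_peel (@head_killed _ M) (@quomapP _ _ _ _ _) (limg_quomap _) qZ.
by rewrite cats0 lker_quomap in qt wt; exists t.
Qed.

Lemma qf_ex n (h : R n) (M : lmodule (A n)) : exists2 s : seq (Lambda e n),
  qf M s & forall i, (wts s i <= rkm M i)%N.
Proof.
elim/ltn_ind: n h M => n IH h M; have [t qt wt] := qf_head_ex M.
case: (ltnP n 2) => n2; first by have [] := qf_head_small h n2 qt wt; exists t.
case: n n2 IH h M t qt wt => [|[|n]] // _ IH h M t qt wt.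
have [||s qs ws] := IH n _ _ (cor td h M); [by [] | exact: in_rangeS (in_rangeS h) |].
by have [] := qf_cor_head qs ws qt wt; exists (map old s ++ t).
Qed.

(* The simple head of the standard module of l occurs as a quotient of the corner of M
   at its layer. *)
Fixpoint occ n (l : Lambda e n) : lmodule (A n) -> Prop :=
  match l in Lambda _ n return lmodule (A n) -> Prop with
  | Lnew _ L _ _ => fun M => exists2 f : 'Hom(M, L), mhom f & limg f = fullv
  | Lold n l' => fun M => exists h : R n.+2, occ l' (cor td h M)
  end.

Lemma qf_new n (L : lmodule (A n)) sL aL : qf L [:: @Lnew _ _ e n L sL aL].
Proof.
have hL := @fullv_submodule _ _ L.
apply: (qfS (l := Lnew sL aL) (f := \1%VF) (g := quomap hL)).
- by move=> a v; rewrite !id_lfunE.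
- exact: quomapP.
- by rewrite lker_quomap lim1g.
- exact: limg_quomap.
apply: qf0; have := limg_ker_dim (quomap hL) fullv.
by rewrite lker_quomap limg_quomap capfv; move: (\dim _) (\dim _); lia.
Qed.

(** As in [qf_ex], except that in the layer of l the kernel of the surjection onto the simple module
    is peeled off first; this module is left as the last label of the head. *)
Lemma qf_occ n (l : Lambda e n) (M : lmodule (A n)) : R n -> occ l M ->
  exists s1 s2, qf M (s1 ++ l :: s2) /\
    forall i, (wts (s1 ++ l :: s2) i <= rkm M i)%N.
Proof.
elim: l M => {n} [n L sL aL|n l IH] M h /=; last first.
  case=> h' /(IH _ (in_rangeS (in_rangeS h')))[s1 [s2 [qs ws]]].
  have [t qt wt] := qf_head_ex M; have [qM wM] := qf_cor_head qs ws qt wt.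
  exists (map old s1), (map old s2 ++ t).
  by rewrite map_cat -catA in qM wM.
case=> f fh fT.
have fk : (lker (to_head M) <= lker f)%VS.
  rewrite lker_to_head; apply: gen_min; first exact: lker_submodule.
  apply: limg_subP => v _; rewrite memv_ker fh aL //; exact: mem_ideal_id.
have [p ph pE] := mhom_factor (@to_headP _ M) fh (limg_to_head M) fk.
have pT : limg p = fullv.
  by apply: eq_fullv => w; have [v ->] := limg_fullP w fT; rewrite -pE memv_img ?memvf.
have [t qt wt] := qf_peel (@head_killed _ M) ph pT (qf_new sL aL).
have wt' i : (wts (t ++ [:: Lnew sL aL]) i <= (i == 0) * \dim {: head M})%N.
  rewrite wts_cat wts_cons wts_nil addn0 /=; have := wt i.
  have := limg_ker_dim p fullv; rewrite capfv pT => <-.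
  by case: i => [|i] /=; lia.
have [s qs ws] : exists2 s, qf M (s ++ (t ++ [:: Lnew sL aL])) &
    forall i, (wts (s ++ (t ++ [:: Lnew sL aL])) i <= rkm M i)%N.
  case: (ltnP n 2) => n2; first by have [] := qf_head_small h n2 qt wt'; exists [::].
  clear pT pE fk; case: n n2 h M L sL aL f fh fT p ph t qt wt wt' => [|[|n]] // _ h M L sL aL f fh fT p ph t qt wt wt'.
  have [s qs ws] := qf_ex (in_rangeS (in_rangeS h)) (cor td h M).
  by have [] := qf_cor_head qs ws qt wt'; exists (map old s).
by exists (s ++ t), [::]; rewrite -catA.
Qed.

Lemma occ_surj n (l : Lambda e n) (M M' : lmodule (A n)) (f : 'Hom(M, M')) :
  mhom f -> limg f = fullv -> occ l M' -> occ l M.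
Proof.
elim: l M M' f => {n} [n L sL aL|n l IH] M M' f fh fT /=.
  case=> g gh gT; exists (g \o f)%VF; first exact: mhom_comp.
  by rewrite limg_comp fT.
case=> h oM'; exists h.
have [|g gE] := @to_cor _ _ _ _ _ _ _ td n h (cor td h M) M' (f \o cval td h M)%VF => [v|].
  by rewrite comp_lfunE -fh e_cval.
apply: (IH _ _ g) oM' => [a v|].
  by apply: (cval_inj (td := td)); rewrite cval_act !gE !comp_lfunE cval_act fh.
apply: eq_fullv => w; have [v wE] := limg_fullP (cval td h M' w) fT.
have [u uE] := cval_surj td h v.
suff -> : w = g u by rewrite memv_img ?memvf.
by apply: (cval_inj (td := td)); rewrite gE comp_lfunE -uE fh -wE e_cval.
Qed.

(** A simple module is a quotient of the regular one by a -> a v. One layer further down, x -> x e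
    maps the corner e A onto e A e, which is A_n. *)
Lemma occ_regular n (l : Lambda e n) : R n -> occ l (regular (A n)).
Proof.
elim: l => {n} [n L sL aL|n l IH] h /=.
  have [L0 _] := sL; pose v := vpick {:L}.
  have fl : linear (fun a : regular (A n) => lact L (a : A n) v).
    by move=> c a b; rewrite linearP add_lfunE scale_lfunE.
  have fh : mhom (mkhom fl : 'Hom(regular (A n), L)).
    by move=> a x; rewrite !mkhomE regularE lactME.
  exists (mkhom fl) => //; apply: (simple_surj (M := regular (A n)) sL fh).
  apply/eqP => /lfunP/(_ (1 : A n)); rewrite mkhomE lact1E zero_lfunE => /eqP.
  by rewrite vpick0 (negPf L0).
exists h; have hn := in_rangeS (in_rangeS h).
set M := regular (A n.+2).
have corP (x : cor td h M) : exists y, (cval td h M x : A n.+2) * e n.+2 = phi n y.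
  have [y yE] := e_corner td (cval td h M x : A n.+2) h; exists y; rewrite -yE.
  by rewrite -[e n.+2 * _](regularE (e n.+2)) e_cval.
have fl : linear (fun x : cor td h M =>
    ((phi n)^-1%VF ((cval td h M x : A n.+2) * e n.+2) : regular (A n))).
  by move=> c x y; rewrite linearP mulrDl -scalerAl linearP.
have ker0 : lker (phi n) == 0%VS by apply/lker0P; apply: (phi_inj td).
have fh : mhom (mkhom fl).
  move=> a x; rewrite 2!(mkhomE fl) cval_act [lact M _ _]regularE regularE -mulrA.
  by have [y ->] := corP x; rewrite -(phi_mul td h) !(lker0_lfunK ker0).
apply: occ_surj fh _ (IH hn); apply: eq_fullv => b.
have [x xE] := cval_surj td h (phi n b : M).
suff -> : b = mkhom fl x by rewrite memv_img ?memvf.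
rewrite (mkhomE fl) -xE [lact M _ _]regularE (e_phi td h) (phi_e td h).
by rewrite (lker0_lfunK ker0).
Qed.

End Standards.

(** * Equality in the dimension bound; axioms (A5) and (A6) *)

Section Restrictions.

Variables (k : fieldType) (m : nat) (N : option nat) (A : nat -> falgType k).
Variables (e : forall n, A n) (phi : forall n, 'Hom(A n, A n.+2)).
Variable iota : forall n, in_range N n.+1 -> 'AHom(A n, A n.+1).
Hypothesis td : tower_data m e phi iota.

Local Notation idem := (idem phi).
Local Notation R := (in_range N).
Local Notation C := (halfd m).
Local Notation rkm := (rkm phi).
Local Notation Delta := (Delta phi).
Local Notation qf := (@qf _ _ e phi _).
Local Notation old := (@Lold _ _ e _).
Local Notation G n Y := (glob (e n.+2) (phi n) Y).

(** Multiplication makes A_(n+1) a quotient of the module induced from A_n, and the stated bound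
    satisfies the recursion of [ind_bound]. *)
Lemma rkm_regular n i : R n -> (i.*2 <= n)%N ->
  (rkm (regular (A n)) i <= C n i * ((n - i.*2)`! * m ^ (n - i.*2)))%N.
Proof.
elim: n i => [|n IH] i h ni.
  have -> : i = 0%N by lia.
  rewrite halfd0 (rkm0 td) //; have := td_dim0 td.
  by move: (\dim _) (\dim _) => a b; rewrite subn0 fact0 expn0; lia.
have hn := in_rangeS h.
have [f fE] : exists f : 'Hom(ind iota h (regular (A n)), regular (A n.+1)),
    forall b v, f (gp 1 (iota h) b v) = b * iota h v.
  apply: glob_lift => [v c a b|b c u v|b v|a b v].
  - by rewrite mulrDl scalerAl.
  - by rewrite linearP mulrDr scalerAr.
  - by rewrite mulr1.
  by rewrite [lact _ _ _]regularE rmorphM mulrA.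
have fh : mhom f.
  by apply: (glob_liftM (mulr1 _) fE) => c b v; rewrite [RHS]regularE mulrA.
have fT : limg f = fullv.
  apply: eq_fullv => b; suff -> : b = f (gp 1 (iota h) b ((1 : A n) : regular (A n))) by rewrite memv_img ?memvf.
  by rewrite fE rmorph1 mulr1.
apply: leq_trans (rkm_surj phi i fh fT) _; apply: leq_trans (rkm_ind td h _ i) _.
rewrite /ind_bound; case: i ni => [|i] ni.
  have := IH 0%N hn isT; rewrite !halfd0 !double0 !subn0 !mul1n factS expnS => r0.
  by rewrite add0n -mulnACA leq_mul2l r0 orbT.
rewrite halfdS mulnDl addnC; apply: leq_add.
  case: (leqP i.+1.*2 n) => [ni'|ni']; last by rewrite rkm_gt // muln0.
  have := IH _ hn ni'; rewrite subSn // factS expnS => ri.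
  by rewrite -mulnACA mulnCA leq_mul2l ri orbT.
have := IH i hn; rewrite doubleS subSS => /(_ _)/leq_trans; apply; first by lia.
have [d dE] : exists d, (n - i.*2 = d.+1)%N by exists (n - i.*2).-1; lia.
have -> : (n - i.*2.+1 = d)%N by lia.
by rewrite dE factS expnS; move: (C n i) (d`!) (m ^ d)%N => a b c; nia.
Qed.

(* The inequality of [dim_bound] is an equality. *)
Definition tight n (M : lmodule (A n)) : Prop :=
  (\sum_(i < n.+1) C n i * rkm M i <= \dim {:M})%N.

Lemma tight_regular n : R n -> tight (regular (A n)).
Proof.
move=> h; apply: leq_trans (td_dim td h); rewrite -halfd_sum.
apply: leq_sum => i _; case: (leqP i.*2 n) => [ni|/halfd_gt-> //].
by rewrite leq_mul2l rkm_regular ?orbT.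
Qed.

(** Each globalisation shifts the ranks by one, and a module killed by e_n has only the rank r_0. *)
Lemma rkm_Delta n (l : Lambda e n) i : R n -> (rkm (Delta l) i <= (depth l == i) * top l)%N.
Proof.
elim: l i => {n} [n L sL aL|n l IH] i h /=.
  rewrite eq_sym; apply: (rkm_killed td) => // v; apply: aL; exact: mem_ideal_id.
case: i => [|i]; first by rewrite (rkm_glob0 td).
apply: leq_trans (rkm_glob td h _ i) _; rewrite eqSS.
exact: IH (in_rangeS (in_rangeS h)).
Qed.

Lemma sum_depth n (l : Lambda e n) (c : nat -> nat) :
  (\sum_(i < n.+1) c i * ((depth l == i) * top l) = c (depth l) * top l)%N.
Proof.
have := sum_wts [:: l] c; rewrite big_seq1 => ->.
by apply: eq_bigr => i _; rewrite wts_cons wts_nil addn0.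
Qed.

Lemma dim_Delta_le n (l : Lambda e n) : R n ->
  (\dim {: Delta l} <= C n (depth l) * top l)%N.
Proof.
move=> h; apply: leq_trans (dim_bound td h _) _; rewrite -sum_depth.
by apply: leq_sum => i _; rewrite leq_mul2l rkm_Delta ?orbT.
Qed.

Lemma qf_sums n (M : lmodule (A n)) s : R n -> tight M -> qf M s ->
  (forall i, (wts s i <= rkm M i)%N) ->
  \dim {:M} = (\sum_(l <- s) \dim {: Delta l})%N /\
  (\sum_(l <- s) C n (depth l) * top l <= \dim {:M})%N.
Proof.
move=> h gM qM ws.
have le1 : (\sum_(l <- s) \dim {: Delta l} <= \sum_(l <- s) C n (depth l) * top l)%N.
  by apply: leq_sum => l _; apply: dim_Delta_le.
have le2 : (\sum_(l <- s) C n (depth l) * top l <= \dim {:M})%N.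
  rewrite sum_wts; apply: leq_trans gM; apply: leq_sum => i _.
  by rewrite leq_mul2l ws orbT.
split=> //; apply/eqP; rewrite eqn_leq qf_dim //=.
exact: leq_trans le1 le2.
Qed.

(** Every label occurs in the regular module, where the upper bounds for the standard modules
    together do not exceed the total dimension; so each of them is attained. *)
Lemma dim_Delta n (l : Lambda e n) : R n -> \dim {: Delta l} = (C n (depth l) * top l)%N.
Proof.
move=> h; have [s1 [s2 [qs ws]]] := qf_occ h (occ_regular td l h).
have [dE] := qf_sums h (tight_regular h) qs ws.
rewrite dE !big_cat !big_cons /=.
have le (s : seq (Lambda e n)) :
    (\sum_(l <- s) \dim {: Delta l} <= \sum_(l <- s) C n (depth l) * top l)%N.
  by apply: leq_sum => l' _; apply: dim_Delta_le.
have := le s1; have := le s2; have := dim_Delta_le l h.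
move: (\sum_(l <- s1) _)%N (\sum_(l <- s2) _)%N (\sum_(l <- s1) _)%N (\sum_(l <- s2) _)%N.
by move=> a b c d; lia.
Qed.

Lemma dim_Delta_res n (l : Lambda e n.+1) : R n.+1 ->
  \dim {: Delta l} = (\sum_(i < n.+1) C n i *
    ((depth l == i) * top l + (n - i.*2) * m * ((depth l == i.+1) * top l)))%N.
Proof.
move=> h; rewrite dim_Delta // (halfd_adjoint m n (fun i => (depth l == i) * top l)%N).
by rewrite sum_depth.
Qed.

Lemma rkm_res_Delta n (h : R n.+1) (l : Lambda e n.+1) i :
  (rkm (res (iota h) (Delta l)) i <=
   (depth l == i) * top l + (n - i.*2) * m * ((depth l == i.+1) * top l))%N.
Proof.
apply: leq_trans (rkm_res td h _ i) _; apply: leq_add; first exact: rkm_Delta.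
by rewrite leq_mul2l rkm_Delta ?orbT.
Qed.

(** By [halfd_adjoint] the bounds for the restricted ranks add up to the dimension of the standard
    module over A_(n+1), which restriction does not change. *)
Lemma tight_res n (h : R n.+1) (l : Lambda e n.+1) : tight (res (iota h) (Delta l)).
Proof.
have dE : \dim {: res (iota h) (Delta l)} = \dim {: Delta l} by [].
rewrite /tight dE dim_Delta_res //; apply: leq_sum => i _.
by rewrite leq_mul2l rkm_res_Delta orbT.
Qed.

Lemma tight_filtered n (M : lmodule (A n)) s : R n -> tight M -> qf M s ->
  (forall i, (wts s i <= rkm M i)%N) -> filtered phi (fullv : {vspace M}) (rev s).
Proof. by move=> h gM qM ws; apply: qf_filtered => //; have [] := qf_sums h gM qM ws. Qed.

Lemma filtered_rkg n (M : lmodule (A n)) (V : {vspace M}) (s : seq (Lambda e n)) i :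
  R n -> filtered phi V s ->
  submodule V /\ (rkg (idem n i) (idem n i.+1) V <= wts s i)%N /\
  \dim V = (\sum_(l <- s) \dim {: Delta l})%N.
Proof.
move=> h; elim=> {V s} [|V1 V2 l s _ [hV1 [r1 d1]] hV2 V12 [f [fT fK fh]]].
  split; first by move=> a v; rewrite !memv0 => /eqP->; rewrite linear0.
  by rewrite /rkg limg0 !dimv0 big_nil.
split=> //; split.
  have := rkg_ext (idem n i.+1) (idem_idem td i h) hV1 hV2 V12 fh fK.
  rewrite fT wts_cons => /leq_trans; apply; rewrite addnC leq_add //.
  exact: rkm_Delta.
by rewrite big_cons -d1 -fK -(limg_ker_dim f V2) fT addnC.
Qed.

Lemma tower_A5 : axiom_A5 e phi iota.
Proof.
move=> n h l; have hn := in_rangeS h; split.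
  have [s qs ws] := qf_ex td hn (res (iota h) (Delta l)).
  by exists (rev s); apply: tight_filtered => //; apply: tight_res.
move=> mu [s1 [s2 fil]]; set M := res (iota h) (Delta l) in fil.
have dM := (filtered_rkg 0 hn fil).2.2.
have dM' : \dim {:M} = (\sum_(i < n.+1) C n i * wts (s1 ++ mu :: s2) i)%N.
  rewrite -(sum_wts _ (C n)) dM; elim: (s1 ++ mu :: s2) => [|l' s IH]; first by rewrite !big_nil.
  by rewrite !big_cons IH dim_Delta.
have r i : (rkm M i <= wts (s1 ++ mu :: s2) i)%N by have [_ []] := filtered_rkg i hn fil.
have dmu := layer_depth mu; have dl := layer_depth l.
have di : (depth mu < n.+1)%N by lia.
pose i := Ordinal di.
(* The weights of any filtration dominate the ranks, yet their sum with coefficients [C n i] is dim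
   M, which is at most that of the ranks. The coefficient at i being positive, there is equality at
   i. *)
have wE : wts (s1 ++ mu :: s2) i = rkm M i.
  apply/eqP; rewrite eqn_leq r andbT leqNgt; apply/negP => lt.
  have := dim_bound td hn M; rewrite dM' leqNgt => /negP; apply.
  rewrite (bigD1 i) //= [X in (_ < X)%N](bigD1 i) //=.
  rewrite -addSn leq_add //; last by apply: leq_sum => j _; rewrite leq_mul2l r orbT.
  rewrite ltn_mul2l lt andbT halfd_gt0 ?(td_m td) //; lia.
have : (0 < wts (s1 ++ mu :: s2) i)%N.
  by rewrite wts_cat wts_cons /= eqxx mul1n; have := top_gt0 mu; lia.
rewrite wE => lt0; have := leq_trans lt0 (rkm_res_Delta h l i) => /=.
case: eqP => [dE _|_]; first by left; lia.
case: eqP => [dE _|_]; first by right; lia.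
by rewrite mul0n muln0.
Qed.

Lemma tower_A6 : axiom_A6 e phi iota.
Proof.
move=> n h l n0 ln; have hn := in_rangeS h.
have [L [sL [aL lE]]] : exists (L : lmodule (A n)) (sL : simple_module L)
    (aL : annihilates (ideal (e n)) L), l = Lnew sL aL.
  case: l ln {h hn n0} => {n} [n L sL aL|n l] /=; first by exists L, sL, aL.
  by have := layer_depth l; lia.
case: n h l n0 ln hn L sL aL lE => // n h l _ ln hn L sL aL lE.
have [L0 _] := sL; have hn1 := in_rangeS hn.
(* Frobenius reciprocity: a simple submodule W of the restriction of L yields a nonzero map to L
   from the module induced from W. *)
pose X := res (iota hn) L.
have XT0 : (fullv : {vspace X}) != 0%VS by [].
have [W [hW _ W0] Wm] := simple_submodule_ex (@fullv_submodule _ _ X) XT0.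
have sW := simple_submod hW W0 Wm.
have Le v : lact L (e n.+1) v = 0 by rewrite aL // mem_ideal_id.
have aW : annihilates (ideal (e n)) (submod hW).
  move=> a v ae; apply: (lact_ideal0 (x := e n)) ae _ => {}v.
  apply: (@subvs_inj _ _ W); rewrite (@submodE _ _ X W hW) res_actE linear0.
  by apply: (lact_ideal0 Le); apply: (td_iota_e td).
pose mu : Lambda e n.+2 := Lold (Lnew sW aW); exists mu => //.
pose M := res (iota h) (Delta mu).
suff oM : occ td (Lnew sL aL) M.
  have [s1 [s2 [qs ws]]] := qf_occ hn oM.
  have := tight_filtered hn (tight_res h mu) qs ws.
  by rewrite rev_cat rev_cons cat_rcons lE => fil; exists (rev s2), (rev s1).
(* A_(n+2) e is identified with A_(n+1) by x |-> x e, so that M is induced from W. *)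
have flin : linear (fun x : A n.+1 => iota h x * e n.+2).
  by move=> c x y; rewrite linearP mulrDl scalerAl.
pose f := mkhom flin; have fE x : f x = iota h x * e n.+2 by rewrite mkhomE.
have f0 : lker f == 0%VS.
  by rewrite -subv0; apply/subvP => x; rewrite memv_ker memv0 fE => /eqP/(td_left_inj td)->.
(* [g b] is the unique x with b e = iota(x) e. *)
pose g b := (f^-1)%VF (b * e n.+2).
have ee := e_idem td h.
have gE x : g (iota h x) = x by rewrite /g -fE (lker0_lfunK f0).
have gex b : exists x, b * e n.+2 = iota h x * e n.+2 by apply: (td_left td).
have gM a b : g (iota h a * b) = a * g b.
  rewrite /g -mulrA; have [x ->] := gex b; rewrite mulrA -rmorphM -!fE.
  by rewrite !(lker0_lfunK f0).
have glin : linear g by move=> c x y; rewrite /g mulrDl -scalerAl linearP.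
have [F FE] : exists F : 'Hom(Delta mu, L), forall b v,
    F (gp (e n.+2) (phi n) b v) = lact L (g b) (vsval (v : subvs_of W)).
  apply: glob_lift => [v c a b|b c u v|b v|a b v].
  - by rewrite glin linearP add_lfunE scale_lfunE.
  - by rewrite !linearP.
  - by rewrite /g -mulrA ee.
  rewrite (@submodE _ _ X W hW) res_actE -lactME; congr (lact L _ _).
  rewrite /g (td_phi td hn h) -mulrA -mulrA ee (td_comm td) mulrA.
  have [x ->] := gex b; rewrite -mulrA -(td_comm td) mulrA -rmorphM -!fE.
  by rewrite !(lker0_lfunK f0).
have Fh : @mhom _ _ M L F.
  move=> a t; rewrite res_actE.
  suff /lfunP/(_ t) : (F \o lact (Delta mu) (iota h a) = lact L a \o F)%VF by rewrite !comp_lfunE.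
  apply: (glob_ext ee) => b v; rewrite !comp_lfunE [lact _ _ _]lact_gp !FE gM.
  by rewrite lactME.
exists F => //; apply: (simple_surj (M := M)) => //.
(* F sends e (x) w to w, so it is not zero. *)
apply/eqP => F0; case/negP: W0; rewrite -subv0; apply/subvP => w wW.
have := FE (iota h 1) (vsproj W w); rewrite F0 zero_lfunE gE lact1E vsprojK // => <-.
exact: mem0v.
Qed.

End Restrictions.

(** * The multiplication map and its source as a module *)

Section MultiplicationMapTools.

Variables (k : fieldType) (Q : falgType k) (e : Q).
Hypothesis ee : e * e = e.

Local Notation Qe := (subvs_of (lideal e)).
Local Notation eQ := (subvs_of (rideal e)).
Local Notation eQe := (subvs_of (corner e)).
Local Notation T := (tensor (lideal_ract e) (rideal_lact e)).
Local Notation tp := (tpure (lideal_ract e) (rideal_lact e)).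

Let Qe_mul b x : x \in lideal e -> b * x \in lideal e.
Proof. by case/lidealP=> y ->; apply/lidealP; exists (b * y); rewrite mulrA. Qed.

Let Qe_e x : x \in lideal e -> x * e = x.
Proof. by case/lidealP=> y ->; rewrite -mulrA ee. Qed.
Let eQ_e x : x \in rideal e -> e * x = x.
Proof. by case/ridealP=> y ->; rewrite mulrA ee. Qed.

Lemma lideal_ractE (r : eQe) (x : Qe) : vsval (lideal_ract e r x) = vsval x * vsval r.
Proof.
have hl (r' : eQe) : linear (fun x : Qe => vsproj (lideal e) (vsval x * vsval r')).
  by move=> c u v; rewrite -linearP; apply: congr1; rewrite linearP /= mulrDl -scalerAl.
rewrite /lideal_ract linfunE => [|c b d].
  rewrite linfunE // vsprojK //; have /cornerP[y ->] := subvsP r.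
  by apply/lidealP; exists (vsval x * (e * y)); rewrite !mulrA.
apply/lfunP => y; rewrite add_lfunE scale_lfunE !linfunE // -linearP.
by apply: congr1; rewrite linearP /= mulrDr -scalerAr.
Qed.

Lemma rideal_lactE (r : eQe) (y : eQ) : vsval (rideal_lact e r y) = vsval r * vsval y.
Proof.
have hl (r' : eQe) : linear (fun y : eQ => vsproj (rideal e) (vsval r' * vsval y)).
  by move=> c u v; rewrite -linearP; apply: congr1; rewrite linearP /= mulrDr -scalerAr.
rewrite /rideal_lact linfunE => [|c b d].
  rewrite linfunE // vsprojK //; have /cornerP[z ->] := subvsP r.
  by apply/ridealP; exists (z * e * vsval y); rewrite !mulrA.
apply/lfunP => z; rewrite add_lfunE scale_lfunE !linfunE // -linearP.
by apply: congr1; rewrite linearP /= mulrDl -scalerAl.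
Qed.

Lemma mult_mapE (x : Qe) (y : eQ) : mult_map e (tp x y) = vsval x * vsval y.
Proof.
apply: (tliftE (b := fun (x : Qe) (y : eQ) => vsval x * vsval y)) => [|r u v].
  by split=> [v c a b|u c a b]; rewrite linearP /= ?mulrDl ?mulrDr -?scalerAl -?scalerAr.
by rewrite lideal_ractE rideal_lactE mulrA.
Qed.

Lemma tensor_span (W : {vspace T}) : (forall x y, tp x y \in W) -> W = fullv.
Proof.
move=> tW; apply: eq_fullv => t; rewrite -qproj_eq0.
have /lfunP/(_ t) : linfun (qproj W) = (0 : 'Hom(T, qspace W)).
  by apply: tensor_ext => x v; rewrite lfunE zero_lfunE; apply/eqP; rewrite qproj_eq0.
by rewrite lfunE zero_lfunE => ->.
Qed.

Lemma limg_mult_map : limg (mult_map e) = ideal e.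
Proof.
apply/eqP; rewrite eqEsubv; apply/andP; split.
  apply: limg_subP => t _; rewrite memv_preim (_ : (_ @^-1: _)%VS = fullv) ?memvf //.
  apply: tensor_span => x y; rewrite -memv_preim mult_mapE.
  have /lidealP[a ->] := subvsP x; have /ridealP[b ->] := subvsP y.
  by rewrite mulrA -(mulrA a) ee mem_ideal.
apply: ideal_subP => a b; apply/memv_imgP.
exists (tp (vsproj _ (a * e)) (vsproj _ (e * b))); rewrite ?memvf // mult_mapE.
rewrite !vsprojK; [by rewrite [RHS]mulrA -[in RHS](mulrA a) ee | |].
  by apply/ridealP; exists b.
by apply/lidealP; exists a.
Qed.

Section Action.

Variables (B : falgType k) (pi : B -> Q).
Hypotheses (piL : linear pi) (pi1 : pi 1 = 1) (piM : forall a b, pi (a * b) = pi a * pi b).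

Let act a (t : T) : T := tlift (lideal_ract e) (rideal_lact e)
  (fun (x : Qe) (y : eQ) => tp (vsproj (lideal e) (pi a * vsval x)) y) t.

Let actE a x y : act a (tp x y) = tp (vsproj (lideal e) (pi a * vsval x)) y.
Proof.
have [linl linr] := tpure_bilinear (lideal_ract e) (rideal_lact e).
apply: (tliftE (b := fun x y => tp (vsproj (lideal e) (pi a * vsval x)) y)).
  split=> [v c u w|u]; last exact: linr.
  rewrite -linl; congr (tpure _ _ _ _); rewrite -linearP.
  by apply: congr1; rewrite linearP /= mulrDr -scalerAr.
move=> r u v; rewrite -tpure_balanced; congr (tpure _ _ _ _).
apply: subvs_inj; rewrite [LHS]vsprojK ?Qe_mul ?subvsP // !lideal_ractE.
by rewrite vsprojK ?Qe_mul ?subvsP // mulrA.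
Qed.

Let actL a : linear (act a).
Proof. by move=> c t u; rewrite /act linearP. Qed.

Let act_ext (f g : T -> T) : linear f -> linear g ->
  (forall x y, f (tp x y) = g (tp x y)) -> f =1 g.
Proof.
move=> fl gl fg t; suff /lfunP/(_ t) : mkhom fl = mkhom gl by rewrite !mkhomE.
by apply: tensor_ext => x y; rewrite !mkhomE fg.
Qed.

Let actA t : linear (act^~ t).
Proof.
move=> c a b; move: t; apply: act_ext => [||x y]; first exact: actL.
  move=> d u v; rewrite !actL !scalerDr !scalerA (mulrC c) addrACA.
  by [].
have [linl _] := tpure_bilinear (lideal_ract e) (rideal_lact e).
rewrite !actE -linl; congr (tpure _ _ _ _); rewrite -linearP; apply: congr1.
by rewrite piL mulrDl -scalerAl.
Qed.

Let act1 t : act 1 t = t.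
Proof.
move: t; apply: act_ext => [|//|x y]; first exact: actL.
by rewrite actE pi1 mul1r vsvalK.
Qed.

Let actM a b t : act (a * b) t = act a (act b t).
Proof.
move: t; apply: (@act_ext _ (fun t => act a (act b t))) => [|c u v|x y].
- exact: actL.
- by rewrite !actL.
by rewrite !actE piM vsprojK ?Qe_mul ?subvsP // mulrA.
Qed.

(** The action goes through pi on the left factor. With B = A_n and Q = A_(n,i), the tensor product
    becomes an A_n-module, to which [dim_bound] applies. *)
Definition tensor_mod : lmodule B := mklmod actL actA act1 actM.

Lemma tensor_modE a x y :
  lact tensor_mod a (tp x y) = tp (vsproj (lideal e) (pi a * vsval x)) y.
Proof. by rewrite mklmodE actE. Qed.

Let ve : Qe := vsproj (lideal e) e.
Let veE : vsval ve = e.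
Proof. by rewrite vsprojK //; apply/lidealP; exists 1; rewrite mul1r. Qed.

(** In e x (x) y the factor e x = e (e x e) belongs to e Q e and crosses the tensor sign; hence y ->
    e (x) y maps e Q onto the image of e. *)
Lemma dim_tensor_lact f : pi f = e ->
  (\dim (lact tensor_mod f @: fullv) <= \dim (rideal e))%N.
Proof.
move=> fe; have [linl linr] := tpure_bilinear (lideal_ract e) (rideal_lact e).
pose g := mkhom (linr ve).
have dE : \dim {: eQ} = \dim (rideal e) by rewrite dimvf.
rewrite -dE; apply: leq_trans (dim_limg_le g fullv); apply: dimvS.
apply: limg_subP => t _; rewrite memv_preim (_ : (_ @^-1: _)%VS = fullv) ?memvf //.
apply: tensor_span => x y; rewrite -memv_preim tensor_modE fe.
have rc : e * vsval x * e \in corner e by apply/cornerP; exists (vsval x).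
have -> : tp (vsproj (lideal e) (e * vsval x)) y = g (rideal_lact e (vsproj (corner e) (e * vsval x * e)) y).
  rewrite mkhomE -tpure_balanced; congr (tpure _ _ _ _).
  apply: subvs_inj; rewrite lideal_ractE veE !vsprojK ?Qe_mul ?subvsP //.
  by rewrite !mulrA ee -[RHS]mulrA Qe_e ?subvsP.
by rewrite memv_img ?memvf.
Qed.

(** z e (x) y is z applied to e (x) y, which e fixes. *)
Lemma tensor_gen f : pi f = e -> (forall q, exists b, q = pi b) ->
  gen (lact tensor_mod f @: fullv) = fullv.
Proof.
move=> fe piT; apply: tensor_span => x y; have /lidealP[z xE] := subvsP x.
have [b bE] := piT z.
have E1 : lact tensor_mod f (tp ve y) = tp ve y by rewrite tensor_modE fe veE ee.
have -> : tp x y = lact tensor_mod b (tp ve y) by rewrite tensor_modE veE -bE -xE vsvalK.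
by apply: (@mem_gen _ _ tensor_mod); rewrite -E1 memv_img ?memvf.
Qed.

End Action.

End MultiplicationMapTools.

(** * Dimensions of the layers; axiom (A2)(ii) *)

Section LayerDimensions.

Variables (k : fieldType) (m : nat) (N : option nat) (A : nat -> falgType k).
Variables (e : forall n, A n) (phi : forall n, 'Hom(A n, A n.+2)).
Variable iota : forall n, in_range N n.+1 -> 'AHom(A n, A n.+1).
Hypothesis td : tower_data m e phi iota.

Local Notation idem := (idem phi).
Local Notation R := (in_range N).
Local Notation C := (halfd m).
Local Notation rkm := (rkm phi).

Lemma rkm_submod n (M : lmodule (A n)) (V : {vspace M}) (hV : submodule V) i :
  rkm (submod hV) i = rkg (idem n i) (idem n i.+1) V.
Proof.
pose v : 'Hom(submod hV, M) := linfun (@vsval _ _ V).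
have vE w : v w = vsval w by rewrite lfunE.
have vh : mhom v by move=> a w; rewrite !vE submodE.
have v0 : lker v = 0%VS by apply/eqP/lker0P => x y; rewrite !vE => /val_inj.
have vT : limg v = V.
  apply: limg_eq => [w _|w wV]; first by rewrite vE subvsP.
  by exists (vsproj V w); rewrite ?memvf // vE vsprojK.
have dimv (W : {vspace submod hV}) : \dim W = \dim (v @: W) by rewrite limg_dim_eq // v0 capv0.
rewrite /rkm /rkg !dimv !(limg_lact _ (mhom_homon vh)).
rewrite (limg_gen (V := fullv) (mhom_homon vh)) ?subvf // (limg_lact _ (mhom_homon vh)).
by rewrite [(v @: fullv)%VS]vT.
Qed.

Lemma idem_sub n (M : lmodule (A n)) (V : {vspace M}) i j : R n -> (i <= j)%N ->
  submodule V -> (lact M (idem n j) @: V <= lact M (idem n i) @: V)%VS.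
Proof.
move=> h ij hV; have [E _] := idem_mul td h ij.
by apply: limg_subP => v Vv; rewrite -E lactME memv_img // hV.
Qed.

Let J n i : {vspace regular (A n)} := gen (lact (regular (A n)) (idem n i) @: fullv).

Let hJ n i : submodule (J n i). Proof. exact: gen_submodule. Qed.

Lemma gen_ideal n i : J n i = ideal (idem n i).
Proof.
apply/eqP; rewrite eqEsubv; apply/andP; split.
  apply: gen_sub => a _ /memv_imgP[v _ ->]; rewrite ![lact (regular _) _ _]regularE mulrA.
  exact: mem_ideal.
apply: ideal_subP => a b; rewrite -mulrA.
have := @mem_gen _ _ (regular (A n)) _ a _
  (memv_img (lact (regular (A n)) (idem n i)) (memvf (b : regular (A n)))).
by rewrite ![lact (regular _) _ _]regularE.
Qed.

(** The dimension bound is applied to A / J_i, whose ranks sit below i, and to J_(i+1), whose ranks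
    sit above i. The weighted ranks of A add up to at most dim A, so the share C(n,i) r_i is left
    for J_i / J_(i+1). *)
Lemma layer_dim n i : R n -> (i <= n)%N ->
  (\dim (ideal (idem n i.+1)) + C n i * rkm (regular (A n)) i <= \dim (ideal (idem n i)))%N.
Proof.
move=> h ni; rewrite -!gen_ideal; set r := rkm (regular (A n)).
have g := tight_regular td h; rewrite /tight -/r in g.
have up : (\dim {: regular (A n)} - \dim (J n i) <= \sum_(t < n.+1) C n t * ((t < i) * r t))%N.
  have := dim_bound td h (quomod (@hJ n i)).
  have := limg_ker_dim (quomap (@hJ n i)) fullv; rewrite lker_quomap capfv limg_quomap => dE.
  move=> bnd; apply: leq_trans (_ : _ <= \dim {: quomod (@hJ n i)})%N _; first by lia.
  apply: leq_trans bnd _; apply: leq_sum => t _; rewrite leq_mul2l; apply/orP; right.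
  case: ltnP => [_|it]; first by rewrite mul1n; apply: rkm_surj (@quomapP _ _ _ _ _) (limg_quomap _).
  rewrite /rkm /rkg (_ : lact _ _ = 0) ?lim0g ?dimv0 //; apply/lfunP => w.
  have [v ->] := limg_fullP w (limg_quomap (@hJ n i)); rewrite -quomapP zero_lfunE.
  apply/eqP; rewrite -memv_ker lker_quomap; apply: (subvP (sub_gen _)).
  by apply: (subvP (idem_sub h it (@fullv_submodule _ _ _))); rewrite memv_img ?memvf.
have dn : (\dim (J n i.+1) <= \sum_(t < n.+1) C n t * ((i < t) * r t))%N.
  have -> : \dim (J n i.+1) = \dim {: submod (@hJ n i.+1)} by rewrite [RHS]dimvf.
  apply: leq_trans (dim_bound td h (submod (@hJ n i.+1))) _; apply: leq_sum => t _.
  rewrite leq_mul2l rkm_submod; apply/orP; right.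
  (* J_(i+1) is generated by e_(i+1) = e_t' e_(i+1), which makes its ranks r_t with t <= i
     vanish. *)
  have sub t' : (t' <= i.+1)%N -> (J n i.+1 <= gen (lact (regular (A n)) (idem n t') @: J n i.+1))%VS.
    move=> ti; apply: gen_min; first exact: gen_submodule.
    apply: subv_trans (sub_gen _); apply: limg_subP => v _.
    have [E _] := idem_mul td h ti; rewrite -E lactME memv_img //.
    by apply: (subvP (sub_gen _)); exact: memv_img (memvf _).
  case: ltnP => ti; last first.
    by rewrite mul0n leqn0 subn_eq0 dimvS // limgS // sub.
  rewrite mul1n; apply: leq_sub; first by apply: dimvS; apply: limgS; apply: subvf.
  apply: dimvS; apply: limgS; apply: genS; apply: limg_subP => v _.
  have it : (i.+1 <= t.+1)%N by lia.
  have [_ E] := idem_mul td h it.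
  have -> : lact (regular (A n)) (idem n t.+1) v =
    lact (regular (A n)) (idem n t.+1) (lact (regular (A n)) (idem n i.+1) v) by rewrite -lactME E.
  apply: memv_img.
  by apply: (subvP (sub_gen _)); exact: memv_img (memvf _).
have sumE : (\sum_(t < n.+1) C n t * r t = \sum_(t < n.+1) C n t * ((t < i) * r t) +
    C n i * r i + \sum_(t < n.+1) C n t * ((i < t) * r t))%N.
  have -> : (C n i * r i = \sum_(t < n.+1) (t == i :> nat) * (C n t * r t))%N.
    have li : (i < n.+1)%N by [].
    rewrite (bigD1 (Ordinal li)) //= eqxx mul1n big1 ?addn0 // => t nt.
    by rewrite (_ : (t == i :> nat) = false) //; apply: contraNF nt => /eqP E; apply/eqP/val_inj.
  rewrite -!big_split; apply: eq_bigr => t _ /=.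
  by case: ltngtP => _ /=; rewrite ?mul0n ?muln0 ?mul1n ?addn0.
move: up dn g; rewrite sumE.
by move: (\dim _) (\dim _) (\dim _) (\sum_(_ < _) _)%N (\sum_(_ < _) _)%N => a b c d f; lia.
Qed.

(** The multiplication map is onto Q e Q, and dim T <= C(n,i) dim eQ <= C(n,i) r_i(A_n) <= dim Q e Q
    makes it injective. *)
Lemma tower_A2ii : axiom_A2ii N phi.
Proof.
move=> n i h ni I IE; set E := quo I (idem n i).
have EE : E * E = E by rewrite /E -quoM (idem_idem td).
split; last exact: limg_mult_map.
have quoL : linear (quo I) by apply: quo_is_linear.
pose T := tensor_mod E quoL (erefl _) (@quoM _ _ I).
have quoJ j : (i < j)%N -> quo I (idem n j) = 0.
  move=> ij; apply/eqP; rewrite quo_eq0 IE.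
  have [<- _] := idem_mul td h ij; rewrite -[_ * _]mul1r mulrA; exact: mem_ideal.
have TT : gen (lact T (idem n i) @: fullv) = fullv by apply: tensor_gen (@quo_surj _ _ I).
(* Only the rank of T at i survives: below i because e_i generates T, above i because e_t is 0 in
   Q. *)
have dT : (\dim {:T} <= C n i * \dim (rideal E))%N.
  apply: leq_trans (dim_bound td h T) _.
  have li : (i < n.+1)%N by move: ni; lia.
  rewrite (bigD1 (Ordinal li)) //= [X in (_ + X)%N]big1 ?addn0 => [|t nt].
    rewrite leq_mul2l; apply/orP; right; apply: leq_trans (leq_subr _ _) _.
    exact: dim_tensor_lact.
  case: (ltngtP t i) => [ti|it|tE]; last by case/eqP: nt; apply: val_inj.
    rewrite /rkm /rkg (_ : gen _ = fullv) ?subnn ?muln0 //; apply/eqP.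
    rewrite eqEsubv subvf /=.
    apply: subv_trans (_ : gen (lact T (idem n i) @: fullv) <= _)%VS; first by rewrite TT.
    apply: genS.
    exact: (idem_sub h ti (@fullv_submodule _ _ _)).
  rewrite /rkm /rkg (_ : lact T (idem n t) = 0) ?lim0g ?dimv0 ?muln0 //.
  apply/lfunP => x; rewrite zero_lfunE; apply/eqP; rewrite -memv_ker.
  rewrite (_ : lker _ = fullv) ?memvf //; apply: tensor_span => u v.
  rewrite memv_ker tensor_modE quoJ // mul0r linear0.
  have [linl _] := tpure_bilinear (lideal_ract E) (rideal_lact E).
  by rewrite -(mkhomE (linl v)) linear0.
pose q := mkhom quoL.
have qk : lker q = I by apply/vspaceP => x; rewrite memv_ker mkhomE quo_eq0.
(* eQ is e_i A_n modulo its intersection with the ideal of e_(i+1), and this intersection contains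
   e_i A_n e_(i+1) A_n. *)
have dR : (\dim (rideal E) <= rkm (regular (A n)) i)%N.
  have eA : (lact (regular (A n)) (idem n i) @: fullv)%VS = rideal (idem n i).
    by rewrite -limg_amull; apply: eq_in_limg => v _; rewrite [LHS]regularE lfunE.
  have -> : rideal E = (q @: rideal (idem n i))%VS.
    apply/esym/limg_eq => [v /ridealP[y ->]|w /ridealP[y ->]].
      by rewrite mkhomE quoM; apply/ridealP; exists (quo I y).
    have [a ->] := quo_surj y; exists (idem n i * a); last by rewrite mkhomE quoM.
    by apply/ridealP; exists a.
  rewrite /rkm /rkg eA -(limg_ker_dim q (rideal (idem n i))).
  set K := (_ @: gen _)%VS.
  have KK : (K <= rideal (idem n i) :&: lker q)%VS.
    rewrite subv_cap; apply/andP; split; first by rewrite -eA limgS ?subvf.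
    apply: subv_trans (lact_sub _ _) _; first exact: gen_submodule.
    by rewrite qk IE -gen_ideal.
  have := dimvS KK; rewrite addnC => le; apply: leq_trans (leq_sub2l _ le).
  by rewrite addnK.
have dJ : (C n i * rkm (regular (A n)) i <= \dim (ideal E))%N.
  have -> : ideal E = (q @: ideal (idem n i))%VS.
    apply/eqP; rewrite eqEsubv; apply/andP; split.
      apply: ideal_subP => a b; have [a' ->] := quo_surj a; have [b' ->] := quo_surj b.
      have -> : quo I a' * E * quo I b' = q (a' * idem n i * b') by rewrite mkhomE !quoM.
      by apply: memv_img; apply: mem_ideal.
    apply: limg_subP => v vI; rewrite memv_preim; apply: subvP vI.
    apply: ideal_subP => a b; rewrite -memv_preim mkhomE !quoM; exact: mem_ideal.
  have := limg_ker_dim q (ideal (idem n i)).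
  have : (\dim (ideal (idem n i) :&: lker q) <= \dim (ideal (idem n i.+1)))%N.
    by rewrite qk IE dimvS // capvSr.
  have := @layer_dim n i h _; rewrite (_ : (i <= n)%N) => [|]; last by move: ni; lia.
  move=> /(_ isT).
  by move: (\dim _) (\dim _) (\dim _) (\dim _) => a b c d; lia.
apply/eqP; rewrite -dimv_eq0.
have := limg_ker_dim (mult_map E) fullv; rewrite capfv limg_mult_map //.
have le : (\dim {: tensor (lideal_ract E) (rideal_lact E)} <= \dim (ideal E))%N.
  by apply: leq_trans dT _; apply: leq_trans dJ; rewrite leq_mul2l dR orbT.
by move: le; move: (\dim _) (\dim _) (\dim _) => a b c; lia.
Qed.

End LayerDimensions.

(** * Following strands in a stack of two diagrams *)

Section Paths.

Variables (m n : nat) (x y : diagram m n).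
Local Notation snode := (bool * node n)%type.

Lemma diagram_ext (z z' : diagram m n) :
  (forall v, mate z v = mate z' v /\ label z v = label z' v) -> z = z'.
Proof.
case: z z' => [[dm dl] dP] [[dm' dl'] dP'] eqv; apply/val_inj => /=.
by congr (_, _); apply/ffunP => v; have [] := eqv v.
Qed.

(* [run s t c]: the strand of the stacked diagrams x over y entered at s leaves at the
   outer node t with total label c. *)
Inductive run : snode -> snode -> Zm m -> Prop :=
| run_end s t c : smate x y s = t -> outer t -> slabel x y s = c -> run s t c
| run_step s u t b c : smate x y s = u -> ~~ outer u -> slabel x y s = b ->
    run (glue u) t c -> run s t (b + c).

Lemma run_net_path s t c : run s t c ->
  net_path (smate x y) (@glue n) (slabel x y) s t c.
Proof.
elim=> {s t c} [s t c <- ot <-|s u t b c <- nu <- _ [Q [Q0 QE ot min_Q ->]]].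
  exists 1%N; split=> //.
  - by apply/eqP; rewrite /net_step glue_outer.
  - by apply/eqP; rewrite glue_outer.
  - by case=> [|[]].
  by rewrite big_ord1.
exists Q.+1; split=> //.
- by rewrite iterSr.
- case=> // -[_|i]; first by rewrite /= /net_step glueK eq_sym glue_outer.
  by move=> iQ; rewrite iterSr; apply: min_Q.
by rewrite big_ord_recl /=; congr (_ + _); apply: eq_bigr => i _; rewrite -iterSr.
Qed.

Lemma dcomp_eq (z : diagram m n) :
  (forall v, run (embed v) (embed (mate z v)) (label z v)) -> dcomp x y = z.
Proof.
move=> rz; apply: diagram_ext => v.
have [eqm eql] := net_path_uniq (comp_net_path x y v) (run_net_path (rz v)).
by rewrite /mate /label /= !ffunE eql -[comp_mate _ _ _]embedK eqm embedK.
Qed.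

Lemma dcomp_run v w c : run (embed v) (embed w) c ->
  mate (dcomp x y) v = w /\ label (dcomp x y) v = c.
Proof.
move=> /run_net_path/(net_path_uniq (comp_net_path x y v))[eqm eql].
by rewrite /mate /label /= !ffunE eql -[comp_mate _ _ _]embedK eqm embedK.
Qed.

Lemma run_not_closed s t c : run s t c -> ~~ net_closed (smate x y) (@glue n) s.
Proof.
move/run_net_path=> [Q [Q0 QE ot _ _]]; apply/negP => /net_closedP/(_ t).
by rewrite -{1}QE fconnect_iter ot eqxx => /(_ isT).
Qed.

(** A central node whose strand, followed in one of its two directions, leaves the stack is not on a
    loop. *)
Lemma no_loops (k : fieldType) (delta : {ffun Zm m -> k}) :
  (forall c, (exists t l, run (true, inl c) t l) \/ (exists t l, run (false, inr c) t l)) ->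
  loop_scalar x y delta = 1.
Proof.
move=> rc; rewrite /loop_scalar big_pred0 // => c; apply/negP => /leftmostP[cl _].
case: (rc c) => -[t [l /run_not_closed/negP]]; apply=> //.
apply: net_closed_conn cl; [exact: smateK | exact: glueK |].
by rewrite /net_conn connect0 orbT.
Qed.

End Paths.

(** * Diagrams with one strand added *)

Section Extension.

(* An injection of the nodes of an n-diagram missing exactly the nodes p and q, which
   [ext] below joins by a strand. *)
Record embedding (n : nat) := Embedding {
  en_f : node n -> node n.+1;
  en_g : node n.+1 -> option (node n);
  en_p : node n.+1;
  en_q : node n.+1;
  en_fK : pcancel en_f en_g;
  en_gK : forall u w, en_g u = Some w -> u = en_f w;
  en_gp : en_g en_p = None;
  en_gq : en_g en_q = None;
  en_pq : forall u, en_g u = None -> u = en_p \/ u = en_q;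
  en_neq : en_p != en_q }.

Lemma en_inj n (E : embedding n) : injective (en_f E).
Proof. by move=> u v /(congr1 (en_g E)); rewrite !en_fK => -[]. Qed.

Lemma en_case n (E : embedding n) u :
  [\/ exists w, u = en_f E w, u = en_p E | u = en_q E].
Proof.
case Eu: (en_g E u) => [w|]; first by constructor 1; exists w; apply: en_gK.
by have [->|->] := en_pq Eu; [constructor 2 | constructor 3].
Qed.

(* T twists the label of a strand at its ends: this is how j is absorbed in [foldt]. *)
Variables (m n : nat) (E : embedding n) (T : node n -> Zm m) (c : Zm m).
Local Notation f := (en_f E).
Local Notation g := (en_g E).
Local Notation p := (en_p E).
Local Notation q := (en_q E).

Let ext_mate (d : diagram m n) u :=
  if g u is Some w then f (mate d w) else if u == p then q else p.
Let ext_label (d : diagram m n) u : Zm m :=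
  if g u is Some w then label d w + T w - T (mate d w) else if u == p then c else - c.

Fact ext_is_diagram d : is_diagram ([ffun u => ext_mate d u], [ffun u => ext_label d u]).
Proof.
have qp : (q == p) = false by rewrite eq_sym (negPf (en_neq E)).
apply/forallP => u; rewrite /= !ffunE /ext_mate /ext_label.
case: (en_case E u) => [[w ->]|->|->].
- rewrite !en_fK !mateK label_mate (inj_eq (@en_inj _ E)) mate_neq !eqxx /=.
  by rewrite opprD opprK opprD addrAC.
- by rewrite en_gp eqxx en_gq qp !eqxx.
by rewrite en_gq qp en_gp eqxx opprK !eqxx en_neq.
Qed.

Definition ext d : diagram m n.+1 := Sub _ (ext_is_diagram d).

Lemma ext_mate_f d v : mate (ext d) (f v) = f (mate d v).
Proof. by rewrite /mate /= ffunE /ext_mate en_fK. Qed.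
Lemma ext_mate_p d : mate (ext d) p = q.
Proof. by rewrite /mate /= ffunE /ext_mate en_gp eqxx. Qed.
Lemma ext_mate_q d : mate (ext d) q = p.
Proof. by rewrite /mate /= ffunE /ext_mate en_gq eq_sym (negPf (en_neq E)). Qed.
Lemma ext_label_f d v : label (ext d) (f v) = label d v + T v - T (mate d v).
Proof. by rewrite /label /= ffunE /ext_label en_fK. Qed.
Lemma ext_label_p d : label (ext d) p = c.
Proof. by rewrite /label /= ffunE /ext_label en_gp eqxx. Qed.
Lemma ext_label_q d : label (ext d) q = - c.
Proof. by rewrite /label /= ffunE /ext_label en_gq eq_sym (negPf (en_neq E)). Qed.

Lemma ext_inj : injective ext.
Proof.
move=> d d' dd'; apply: diagram_ext => v.
have mE : mate d v = mate d' v.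
  by apply: (@en_inj _ E); rewrite -!ext_mate_f dd'.
split=> //; have := congr1 (fun z => label z (f v)) dd'.
by rewrite /= !ext_label_f mE => /addIr/addIr.
Qed.

Let restr_mate (z : diagram m n.+1) v := odflt v (g (mate z (f v))).
Let restr_label (z : diagram m n.+1) v : Zm m :=
  label z (f v) - T v + T (restr_mate z v).

Lemma ext_surj z : mate z p = q -> label z p = c -> exists d, z = ext d.
Proof.
move=> zp zc.
have fr v : f (restr_mate z v) = mate z (f v).
  rewrite /restr_mate; case: (en_case E (mate z (f v))) => [[w wE]|E1|E1].
  - by rewrite wE en_fK.
  - have := congr1 (mate z) E1; rewrite mateK zp => /(congr1 g).
    by rewrite en_fK en_gq.
  have := congr1 (mate z) E1; rewrite -zp !mateK => /(congr1 g).
  by rewrite en_fK en_gp.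
have dP : is_diagram ([ffun v => restr_mate z v], [ffun v => restr_label z v]).
  apply/forallP => v; rewrite /= !ffunE.
  have rK : restr_mate z (restr_mate z v) = v.
    by apply: (@en_inj _ E); rewrite !fr mateK.
  rewrite rK eqxx -(inj_eq (@en_inj _ E)) fr mate_neq /= /restr_label rK fr label_mate.
  by rewrite !opprD opprK addrAC.
pose d : diagram m n := Sub _ dP; exists d; apply: diagram_ext => u.
have dm v : mate d v = restr_mate z v by rewrite /mate ffunE.
have dl v : label d v = restr_label z v by rewrite /label ffunE.
case: (en_case E u) => [[v ->]|->|->].
- rewrite ext_mate_f ext_label_f dm dl fr; split=> //.
  by rewrite /restr_label addrAC addrK subrK.
- by rewrite ext_mate_p ext_label_p.
by rewrite ext_mate_q ext_label_q -zp mateK label_mate zc.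
Qed.

End Extension.

Lemma inl_eq n (a b : 'I_n) : (inl a == inl b :> node n) = (a == b). Proof. by []. Qed.
Lemma inr_eq n (a b : 'I_n) : (inr a == inr b :> node n) = (a == b). Proof. by []. Qed.

Section Embeddings.

Variable n : nat.

Definition wid (i : 'I_n) : 'I_n.+1 := lift ord_max i.

Lemma wid_val i : wid i = i :> nat.
Proof. exact: lift_max. Qed.

Lemma wid_case (c : 'I_n.+1) : (exists i, c = wid i) \/ c = ord_max.
Proof. by case: (unliftP ord_max c) => [i ->|->]; [left; exists i | right]. Qed.

Lemma wid_inj : injective wid. Proof. exact: lift_inj. Qed.

Lemma wid_max i : (wid i == ord_max) = false.
Proof. by rewrite eq_sym (negPf (neq_lift _ _)). Qed.

Definition nwid (v : node n) : node n.+1 :=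
  match v with inl i => inl (wid i) | inr i => inr (wid i) end.
Let nunw (v : node n.+1) : option (node n) :=
  match v with inl j => omap inl (unlift ord_max j) | inr j => omap inr (unlift ord_max j) end.

Fact nwidK : pcancel nwid nunw.
Proof. by case=> i; rewrite /= liftK. Qed.
Fact nunwK u w : nunw u = Some w -> u = nwid w.
Proof. by case: u => j /=; case: unliftP => //= i -> [<-]. Qed.
Fact nunw_p : nunw (inl ord_max) = None. Proof. by rewrite /= unlift_none. Qed.
Fact nunw_q : nunw (inr ord_max) = None. Proof. by rewrite /= unlift_none. Qed.
Fact nunw_pq u : nunw u = None -> u = inl ord_max \/ u = inr ord_max.
Proof. by case: u => j /=; case: unliftP => //= ->; [left | right]. Qed.

Definition emb_wid : embedding n :=
  @Embedding n nwid nunw (inl ord_max) (inr ord_max) nwidK nunwK nunw_p nunw_q nunw_pq isT.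

Section Perm.
Variables (s : node n.+1 -> node n.+1) (sK : involutive s) (E : embedding n).

Let f v := s (en_f E v).
Let g u := en_g E (s u).
Fact perm_fK : pcancel f g. Proof. by move=> v; rewrite /f /g sK en_fK. Qed.
Fact perm_gK u w : g u = Some w -> u = f w.
Proof. by move=> /en_gK gu; rewrite /f -gu sK. Qed.
Fact perm_p : g (s (en_p E)) = None. Proof. by rewrite /g sK en_gp. Qed.
Fact perm_q : g (s (en_q E)) = None. Proof. by rewrite /g sK en_gq. Qed.
Fact perm_pq u : g u = None -> u = s (en_p E) \/ u = s (en_q E).
Proof. by move=> /en_pq[<-|<-]; rewrite sK; [left | right]. Qed.
Fact perm_neq : s (en_p E) != s (en_q E).
Proof. by rewrite (inj_eq (inv_inj sK)) en_neq. Qed.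

(** An involution of the nodes moves the two missing ones, so that every placement of the new strand
    is derived from [emb_wid]. *)
Definition emb_perm : embedding n :=
  Embedding perm_fK perm_gK perm_p perm_q perm_pq perm_neq.

End Perm.

End Embeddings.

(** * The cup-cap diagram and its products with A_(n+1) *)

Section CupCap.

Variables (m : nat) (j : Zm m).

Section AddStrand.

Variable n : nat.

Definition addst (d : diagram m n) : diagram m n.+1 := ext (emb_wid n) (fun=> 0) 0 d.

Lemma addst_mate d v : mate (addst d) (nwid v) = nwid (mate d v).
Proof. exact: (ext_mate_f (emb_wid n)). Qed.
Lemma addst_label d v : label (addst d) (nwid v) = label d v.
Proof. by rewrite (ext_label_f (emb_wid n)) addr0 subr0. Qed.
Lemma addst_mate_l d : mate (addst d) (inl ord_max) = inr ord_max.
Proof. exact: (ext_mate_p (emb_wid n)). Qed.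
Lemma addst_mate_r d : mate (addst d) (inr ord_max) = inl ord_max.
Proof. exact: (ext_mate_q (emb_wid n)). Qed.
Lemma addst_label_l d : label (addst d) (inl ord_max) = 0.
Proof. exact: (ext_label_p (emb_wid n)). Qed.
Lemma addst_label_r d : label (addst d) (inr ord_max) = 0.
Proof. by rewrite (ext_label_q (emb_wid n)) oppr0. Qed.

Lemma addst_inj : injective addst. Proof. exact: ext_inj. Qed.

Lemma addst_surj z : mate z (inl ord_max) = inr ord_max -> label z (inl ord_max) = 0 ->
  exists d, z = addst d.
Proof. exact: (ext_surj (E := emb_wid n)). Qed.

End AddStrand.

Lemma addst_did n : addst (did m n) = did m n.+1.
Proof.
have dm (k : nat) v : mate (did m k) v = id_mate v by rewrite /mate ffunE.
have dl (k : nat) v : label (did m k) v = 0 by rewrite /label ffunE.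
apply: diagram_ext => u; rewrite dm dl; case: (en_case (emb_wid n) u) => [[v ->]|->|->] /=.
- by rewrite addst_mate addst_label dm dl; case: v.
- by rewrite addst_mate_l addst_label_l.
by rewrite addst_mate_r addst_label_r.
Qed.

Variable n : nat.
Local Notation P := (wid ord_max : 'I_n.+2).
Local Notation Q := (ord_max : 'I_n.+2).
Local Notation w i := (wid (wid i) : 'I_n.+2).

Lemma ord2_case (c : 'I_n.+2) : [\/ exists i, c = w i, c = P | c = Q].
Proof.
case: (wid_case c) => [[i ->]|->]; last by constructor 3.
by case: (wid_case i) => [[i' ->]|->]; [constructor 1; exists i' | constructor 2].
Qed.

Let PQ : (P == Q) = false. Proof. exact: wid_max. Qed.
Let wP i : (w i == P) = false.
Proof. by rewrite (inj_eq (@wid_inj _)) wid_max. Qed.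
Let wQ i : (w i == Q) = false. Proof. exact: wid_max. Qed.

(** The transposition turns the vertical strand at the last node Q into the southern arc from P to
    Q, and sends the last southern node of the small diagram to the northern node Q. *)
Definition emb_bot : embedding n.+1 := emb_perm (tpermK (inl Q) (inr P)) (emb_wid n.+1).
Definition emb_top : embedding n.+1 := emb_perm (tpermK (inr Q) (inl P)) (emb_wid n.+1).

(* [foldb d] and [foldt d] are the diagrams of d, with one strand added, times [cap] on
   the right and on the left: the last southern (northern) node of d is bent round. *)
Definition foldb (d : diagram m n.+1) : diagram m n.+2 := ext emb_bot (fun=> 0) (- j) d.
Definition tw (v : node n.+1) : Zm m := if v == inl ord_max then j else 0.
Definition foldt (d : diagram m n.+1) : diagram m n.+2 := ext emb_top tw 0 d.

Lemma bot_l i : en_f emb_bot (inl i) = inl (wid i).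
Proof. by rewrite /= tpermD // eq_sym ?inl_eq ?inr_eq wid_max. Qed.
Lemma bot_r i : en_f emb_bot (inr (wid i)) = inr (w i).
Proof. by rewrite /= tpermD // eq_sym ?inl_eq ?inr_eq wP. Qed.
Lemma bot_rmax : en_f emb_bot (inr ord_max) = inl Q.
Proof. by rewrite /= tpermR. Qed.
Lemma bot_p : en_p emb_bot = inr P. Proof. by rewrite /= tpermL. Qed.
Lemma bot_q : en_q emb_bot = inr Q.
Proof. by rewrite /= tpermD // ?inl_eq ?inr_eq PQ. Qed.

Lemma top_r i : en_f emb_top (inr i) = inr (wid i).
Proof. by rewrite /= tpermD // eq_sym ?inl_eq ?inr_eq wid_max. Qed.
Lemma top_l i : en_f emb_top (inl (wid i)) = inl (w i).
Proof. by rewrite /= tpermD // eq_sym ?inl_eq ?inr_eq wP. Qed.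
Lemma top_lmax : en_f emb_top (inl ord_max) = inr Q.
Proof. by rewrite /= tpermR. Qed.
Lemma top_p : en_p emb_top = inl Q.
Proof. by rewrite /= tpermD // ?inl_eq ?inr_eq PQ. Qed.
Lemma top_q : en_q emb_top = inl P. Proof. by rewrite /= tpermL. Qed.

(** The loop in the square of [cap], oriented downwards at its leftmost central node P, traverses
    the southern arc from Q to P; the label - j read from P makes its total j. *)
Definition cap : diagram m n.+2 := foldb (did m n.+1).

Let did_mate v : mate (did m n.+1) v = id_mate v. Proof. by rewrite /mate ffunE. Qed.
Let did_label v : label (did m n.+1) v = 0. Proof. by rewrite /label ffunE. Qed.

Lemma cap_l i : mate cap (inl (w i)) = inr (w i).
Proof. by rewrite -bot_l (ext_mate_f emb_bot) did_mate bot_r. Qed.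
Lemma cap_r i : mate cap (inr (w i)) = inl (w i).
Proof. by rewrite -bot_r (ext_mate_f emb_bot) did_mate bot_l. Qed.
Lemma cap_lP : mate cap (inl P) = inl Q.
Proof. by rewrite -bot_l (ext_mate_f emb_bot) did_mate bot_rmax. Qed.
Lemma cap_lQ : mate cap (inl Q) = inl P.
Proof. by rewrite -cap_lP mateK. Qed.
Lemma cap_rP : mate cap (inr P) = inr Q.
Proof. by rewrite -bot_p (ext_mate_p emb_bot) bot_q. Qed.
Lemma cap_rQ : mate cap (inr Q) = inr P.
Proof. by rewrite -cap_rP mateK. Qed.
Lemma cap_label_l i : label cap (inl i) = 0.
Proof.
case: (wid_case i) => [[i' ->]|->].
  by rewrite -bot_l (ext_label_f emb_bot) did_label subr0 addr0.
by rewrite -bot_rmax (ext_label_f emb_bot) did_label subr0 addr0.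
Qed.
Lemma cap_label_r i : label cap (inr (w i)) = 0.
Proof. by rewrite -bot_r (ext_label_f emb_bot) did_label subr0 addr0. Qed.
Lemma cap_label_P : label cap (inr P) = - j.
Proof. by rewrite -bot_p (ext_label_p emb_bot). Qed.
Lemma cap_label_Q : label cap (inr Q) = j.
Proof. by rewrite -cap_rP label_mate cap_label_P opprK. Qed.

Section CapProducts.

Variable d : diagram m n.+1.
Local Notation x := (addst d).

Lemma addst_cap : dcomp x cap = foldb d.
Proof.
(* [exit] follows a strand from a node of d to the outside, and [entry] from the outside to a node
   of d. The last southern node of d is connected through the northern arc of [cap] and the added
   strand. *)
have exit s u : smate x cap s = (false, nwid u) ->
    run x cap s (embed (en_f emb_bot u)) (slabel x cap s).
  move=> sE; case: u sE => i sE; first by rewrite bot_l; apply: run_end.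
  case: (wid_case i) sE => [[i' ->]|->] sE.
    rewrite bot_r -[slabel _ _ _]addr0; apply: run_step sE _ _ _ => //=.
    by apply: run_end; rewrite /smate /= ?cap_l // /slabel /= cap_label_l.
  rewrite bot_rmax -[slabel _ _ _]addr0; apply: run_step sE _ _ _ => //=.
  rewrite -[0]addr0; apply: (run_step (u := (true, inl Q))) => //=.
  - by rewrite /smate /= cap_lP.
  - by rewrite /slabel /= cap_label_l.
  by apply: run_end; rewrite /smate /= ?addst_mate_r // /slabel /= addst_label_r.
have entry u t c : run x cap (false, nwid u) t c -> run x cap (embed (en_f emb_bot u)) t c.
  case: u => i; first by rewrite bot_l.
  case: (wid_case i) => [[i' ->]|->] r.
    rewrite bot_r -[c]add0r; apply: (run_step (u := (true, inl (w i')))) r => //.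
    - by rewrite /smate /= cap_r.
    by rewrite /slabel /= cap_label_r.
  rewrite bot_rmax -[c]add0r; apply: (run_step (u := (false, inr Q))) => //.
  - by rewrite /smate /= addst_mate_l.
  - by rewrite /slabel /= addst_label_l.
  rewrite -[c]add0r; apply: (run_step (u := (true, inl P))) r => //.
  - by rewrite /smate /= cap_lQ.
  by rewrite /slabel /= cap_label_l.
apply: dcomp_eq => v; case: (en_case emb_bot v) => [[u ->]|->|->].
- rewrite (ext_mate_f emb_bot) (ext_label_f emb_bot) addr0 subr0; apply: entry.
  have := exit (false, nwid u) (mate d u); rewrite /slabel /= addst_label; apply.
  by rewrite /smate /= addst_mate.
- rewrite (ext_mate_p emb_bot) (ext_label_p emb_bot) bot_p bot_q.
  by apply: run_end; rewrite /smate /= ?cap_rP // /slabel /= cap_label_P.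
rewrite (ext_mate_q emb_bot) (ext_label_q emb_bot) bot_p bot_q opprK.
by apply: run_end; rewrite /smate /= ?cap_rQ // /slabel /= cap_label_Q.
Qed.

Lemma addst_cap_scalar (k : fieldType) (delta : {ffun Zm m -> k}) :
  loop_scalar x cap delta = 1.
Proof.
apply: no_loops => c; case: (ord2_case c) => [[i ->]|->|->].
- by left; eexists; eexists; apply: run_end; rewrite ?/smate /= ?cap_l.
- left; eexists; eexists; apply: (run_step (u := (true, inl Q))) => //.
    by rewrite /smate /= cap_lP.
  by apply: run_end; rewrite ?/smate /= ?addst_mate_r.
by right; eexists; eexists; apply: run_end; rewrite ?/smate /= ?addst_mate_r.
Qed.

Lemma cap_addst : dcomp cap x = foldt d.
Proof.
have exit s u : smate cap x s = (true, nwid u) ->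
    run cap x s (embed (en_f emb_top u)) (slabel cap x s - tw u).
  move=> sE; case: u sE => i sE; last by rewrite subr0 top_r; apply: run_end.
  case: (wid_case i) sE => [[i' ->]|->] sE.
    rewrite top_l; apply: run_step sE _ _ _ => //=.
    apply: run_end; rewrite /smate /= ?cap_r // /slabel /= cap_label_r /tw.
    by rewrite inl_eq wid_max oppr0.
  rewrite top_lmax; apply: run_step sE _ _ _ => //=.
  rewrite /tw eqxx -[- j]addr0; apply: (run_step (u := (false, inr Q))) => //=.
  - by rewrite /smate /= cap_rP.
  - by rewrite /slabel /= cap_label_P.
  by apply: run_end; rewrite /smate /= ?addst_mate_l // /slabel /= addst_label_l.
have entry u t c : run cap x (true, nwid u) t c ->
    run cap x (embed (en_f emb_top u)) t (tw u + c).
  case: u => i; last by rewrite top_r add0r.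
  case: (wid_case i) => [[i' ->]|->] r.
    rewrite top_l; apply: (run_step (u := (false, inr (w i')))) r => //.
    - by rewrite /smate /= cap_l.
    rewrite /slabel /= cap_label_l /tw.
    by rewrite inl_eq wid_max.
  rewrite top_lmax -[_ + c]add0r; apply: (run_step (u := (true, inl Q))) => //.
  - by rewrite /smate /= addst_mate_r.
  - by rewrite /slabel /= addst_label_r.
  rewrite /tw eqxx; apply: (run_step (u := (false, inr P))) r => //.
  - by rewrite /smate /= cap_rQ.
  by rewrite /slabel /= cap_label_Q.
apply: dcomp_eq => v; case: (en_case emb_top v) => [[u ->]|->|->].
- rewrite (ext_mate_f emb_top) (ext_label_f emb_top).
  rewrite [label d u + _]addrC -addrA; apply: entry.
  have := exit (true, nwid u) (mate d u); rewrite /slabel /= addst_label; apply.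
  by rewrite /smate /= addst_mate.
- rewrite (ext_mate_p emb_top) (ext_label_p emb_top) top_p top_q.
  by apply: run_end; rewrite /smate /= ?cap_lQ // /slabel /= cap_label_l.
rewrite (ext_mate_q emb_top) (ext_label_q emb_top) top_p top_q oppr0.
by apply: run_end; rewrite /smate /= ?cap_lP // /slabel /= cap_label_l.
Qed.

Lemma cap_addst_scalar (k : fieldType) (delta : {ffun Zm m -> k}) :
  loop_scalar cap x delta = 1.
Proof.
apply: no_loops => c; case: (ord2_case c) => [[i ->]|->|->].
- by right; eexists; eexists; apply: run_end; rewrite ?/smate /= ?cap_r.
- right; eexists; eexists; apply: (run_step (u := (false, inr Q))) => //.
    by rewrite /smate /= cap_rP.
  by apply: run_end; rewrite ?/smate /= ?addst_mate_l.
by left; eexists; eexists; apply: run_end; rewrite ?/smate /= ?addst_mate_l.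
Qed.

End CapProducts.

(** Both sides are d with the two arcs of [cap] at the last two nodes; this is why e_(n+2) commutes
    with A_n. *)
Lemma fold_addst (d : diagram m n) : foldb (addst d) = foldt (addst d).
Proof.
have twE v : tw (nwid v) = 0.
  by rewrite /tw; case: v => i //=; rewrite inl_eq wid_max.
have inner v : mate (foldb (addst d)) (nwid (nwid v)) = nwid (nwid (mate d v)) /\
    label (foldb (addst d)) (nwid (nwid v)) = label d v.
  have botE u : en_f emb_bot (nwid u) = nwid (nwid u) by case: u => i; rewrite ?bot_l ?bot_r.
  rewrite -botE (ext_mate_f emb_bot) (ext_label_f emb_bot) addst_mate addst_label botE.
  by rewrite addr0 subr0.
have inner' v : mate (foldt (addst d)) (nwid (nwid v)) = nwid (nwid (mate d v)) /\
    label (foldt (addst d)) (nwid (nwid v)) = label d v.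
  have topE u : en_f emb_top (nwid u) = nwid (nwid u) by case: u => i; rewrite ?top_l ?top_r.
  rewrite -topE (ext_mate_f emb_top) (ext_label_f emb_top) addst_mate addst_label topE.
  by rewrite !twE addr0 subr0.
apply: diagram_ext => -[] c; case: (ord2_case c) => [[i ->]|->|->].
- by have [-> ->] := inner (inl i); have [-> ->] := inner' (inl i).
- have [-> ->] : mate (foldb (addst d)) (inl P) = inl Q /\ label (foldb (addst d)) (inl P) = 0.
    rewrite -bot_l (ext_mate_f emb_bot) (ext_label_f emb_bot) addst_mate_l addst_label_l.
    by rewrite bot_rmax subr0 addr0.
  rewrite -top_q (ext_mate_q emb_top) (ext_label_q emb_top) top_p oppr0.
  by [].
- have [-> ->] : mate (foldb (addst d)) (inl Q) = inl P /\ label (foldb (addst d)) (inl Q) = 0.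
    rewrite -bot_rmax (ext_mate_f emb_bot) (ext_label_f emb_bot) addst_mate_r addst_label_r.
    by rewrite bot_l subr0 addr0.
  by rewrite -top_p (ext_mate_p emb_top) (ext_label_p emb_top) top_q.
- by have [-> ->] := inner (inr i); have [-> ->] := inner' (inr i).
- have [-> ->] : mate (foldt (addst d)) (inr P) = inr Q /\ label (foldt (addst d)) (inr P) = - j.
    rewrite -top_r (ext_mate_f emb_top) (ext_label_f emb_top) addst_mate_r addst_label_r.
    by rewrite top_lmax /tw /= eqxx addr0 sub0r.
  by rewrite -bot_p (ext_mate_p emb_bot) (ext_label_p emb_bot) bot_q.
have [-> ->] : mate (foldt (addst d)) (inr Q) = inr P /\ label (foldt (addst d)) (inr Q) = j.
  rewrite -top_lmax (ext_mate_f emb_top) (ext_label_f emb_top) addst_mate_l addst_label_l.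
  by rewrite top_r /tw /= eqxx subr0 add0r.
by rewrite -bot_q (ext_mate_q emb_bot) (ext_label_q emb_bot) bot_p opprK.
Qed.

(** Recognises A_(n+2) e: a product with [cap] below keeps the southern arc of [cap]. *)
Lemma foldb_surj z : mate z (inr P) = inr Q -> label z (inr P) = - j ->
  exists d, z = foldb d.
Proof. by move=> zP zl; apply: (ext_surj (E := emb_bot)); rewrite ?bot_p ?bot_q. Qed.

Lemma foldt_surj z : mate z (inl Q) = inl P -> label z (inl Q) = 0 ->
  exists d, z = foldt d.
Proof. by move=> zQ zl; apply: (ext_surj (E := emb_top)); rewrite ?top_p ?top_q. Qed.

Lemma foldb_inj : injective foldb. Proof. exact: ext_inj. Qed.

(** Recognises the corner e A_(n+2) e: with both arcs prescribed, a diagram on the first n nodes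
    remains. *)
Lemma foldb_addst_surj z : mate z (inr P) = inr Q -> label z (inr P) = - j ->
  mate z (inl P) = inl Q -> label z (inl P) = 0 -> exists d, z = foldb (addst d).
Proof.
move=> zP zl zP' zl'; have [d dE] := foldb_surj zP zl.
have [||d' d'E] := @addst_surj _ d.
- apply: (@en_inj _ emb_bot); rewrite -(ext_mate_f emb_bot (fun=> 0) (- j)) -/(foldb d) -dE.
  by rewrite bot_l zP' bot_rmax.
- have := ext_label_f emb_bot (fun=> 0) (- j) d (inl ord_max).
  by rewrite -/(foldb d) -dE bot_l zl' addr0 subr0.
by exists d'; rewrite dE d'E.
Qed.

End CupCap.

Lemma orbit_map (S S' : finType) (f : S -> S) (g : S' -> S') (h : S -> S') s :
  injective h -> (forall s, g (h s) = h (f s)) -> orbit g (h s) = map h (orbit f s).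
Proof.
move=> h_inj gh.
have it i u : iter i g (h u) = h (iter i f u) by elim: i => //= i ->.
have tr i u : traject g (h u) i = map h (traject f u i).
  by elim: i u => //= i IH u; rewrite gh IH.
rewrite /orbit tr; suff -> : fingraph.order g (h s) = fingraph.order f s by [].
rewrite /fingraph.order -(card_image h_inj); apply: eq_card => t.
apply/idP/imageP => [/iter_findex <-|[u /iter_findex <- ->]].
  by exists (iter (findex g (h s) t) f s); rewrite ?it // inE fconnect_iter.
by rewrite -it inE fconnect_iter.
Qed.

(** * Arcs of a product, and multiplicativity of adding a strand *)

Section RunTools.

Variables (m n : nat) (x y : diagram m n).

Lemma net_path_run s t c :
  net_path (smate x y) (@glue n) (slabel x y) s t c -> run x y s t c.
Proof.
case=> Q [Q0 QE ot min_Q ->]; elim: Q s Q0 QE min_Q => // Q IH s _ QE min_Q.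
case: (posnP Q) => [Q0|Q0].
  rewrite Q0 big_ord1 /=; have tE : t = smate x y s.
    by rewrite -ot -QE Q0 /= /net_step glueK.
  by apply: run_end; rewrite // -glue_outer ot.
rewrite big_ord_recl /=.
have nu : ~~ outer (smate x y s).
  by have := min_Q 1%N; rewrite /= ltnS Q0 => /(_ isT); rewrite /net_step glueK eq_sym glue_outer.
apply: (run_step (u := smate x y s)) => //.
rewrite (eq_bigr (fun i : 'I_Q => slabel x y (iter i (net_step (smate x y) (@glue n)) (glue (smate x y s))))).
  apply: IH => // [|i /andP[i0 iQ]]; first by rewrite -QE iterSr.
  by have := min_Q i.+1; rewrite iterSr; apply; rewrite /= ltnS.
by move=> i _; rewrite -[_ (glue _)]iterSr.
Qed.

Lemma dcomp_runP v : run x y (embed v) (embed (mate (dcomp x y) v)) (label (dcomp x y) v).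
Proof.
by apply: net_path_run; have := comp_net_path x y v; rewrite /mate /label /= !ffunE.
Qed.

Lemma top_arc a b : mate x (inl a) = inl b ->
  mate (dcomp x y) (inl a) = inl b /\ label (dcomp x y) (inl a) = label x (inl a).
Proof. by move=> ab; apply: dcomp_run; apply: run_end; rewrite ?/smate /= ?ab. Qed.

Lemma bot_arc a b : mate y (inr a) = inr b ->
  mate (dcomp x y) (inr a) = inr b /\ label (dcomp x y) (inr a) = label y (inr a).
Proof. by move=> ab; apply: dcomp_run; apply: run_end; rewrite ?/smate /= ?ab. Qed.

End RunTools.

Section AddStrandMorphism.

Variables (m n : nat) (x y : diagram m n).

Let h (s : bool * node n) : bool * node n.+1 := (s.1, nwid s.2).
Let x' := addst x.
Let y' := addst y.

Let h_inj : injective h.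
Proof.
move=> [b v] [b' v'] [-> E]; congr (_, _).
by apply: (@en_inj _ (emb_wid n)).
Qed.
Let smate_h s : smate x' y' (h s) = h (smate x y s).
Proof. by case: s => [[] v]; rewrite /smate /h /= addst_mate. Qed.
Let slabel_h s : slabel x' y' (h s) = slabel x y s.
Proof. by case: s => [[] v]; rewrite /slabel /h /= addst_label. Qed.
Let glue_h s : glue (h s) = h (glue s).
Proof. by case: s => [[] []]. Qed.
Let outer_h s : outer (h s) = outer s.
Proof. by case: s => [[] []]. Qed.
Let embed_h v : embed (nwid v) = h (embed v).
Proof. by case: v. Qed.

Let run_h s t c : run x y s t c -> run x' y' (h s) (h t) c.
Proof.
elim=> {s t c} [s t c <- ot <-|s u t b c <- nu <- _ IH].
  by apply: run_end; rewrite ?smate_h ?outer_h ?slabel_h.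
by apply: (run_step (u := h (smate x y s))); rewrite ?smate_h ?outer_h ?slabel_h ?glue_h.
Qed.

Lemma addstM : dcomp (addst x) (addst y) = addst (dcomp x y).
Proof.
apply: dcomp_eq => v; case: (en_case (emb_wid n) v) => [[u ->]|->|->] /=.
- by rewrite addst_mate addst_label !embed_h; apply: run_h; apply: dcomp_runP.
- rewrite addst_mate_l addst_label_l -[0]addr0.
  apply: (run_step (u := (false, inr ord_max))) => //.
  - by rewrite /smate /= addst_mate_l.
  - by rewrite /slabel /= addst_label_l.
  by apply: run_end; rewrite /smate /= ?addst_mate_l // /slabel /= addst_label_l.
rewrite addst_mate_r addst_label_r -[0]addr0.
apply: (run_step (u := (true, inl ord_max))) => //.
- by rewrite /smate /= addst_mate_r.
- by rewrite /slabel /= addst_label_r.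
by apply: run_end; rewrite /smate /= ?addst_mate_r // /slabel /= addst_label_r.
Qed.

Lemma addst_scalar (k : fieldType) (delta : {ffun Zm m -> k}) :
  loop_scalar (addst x) (addst y) delta = loop_scalar x y delta.
Proof.
have step_h s : step x' y' (h s) = h (step x y s) by rewrite /step smate_h glue_h.
have orb c : orbit (step x' y') (true, inl (wid c)) = map h (orbit (step x y) (true, inl c)).
  by rewrite -(orbit_map _ h_inj step_h).
have posh s : position (h s) = position s :> nat by case: s => b [] i; apply: wid_val.
have lmE c : leftmost_on_loop x' y' (wid c) = leftmost_on_loop x y c.
  rewrite /leftmost_on_loop /= orb has_map all_map; congr (~~ _ && _).
    by apply: eq_has => s; apply: outer_h.
  by apply: eq_all => s; rewrite -[LHS]/(wid c <= position (h s))%N (wid_val c) posh.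
have ll c : loop_label x' y' (wid c) = loop_label x y c.
  by rewrite /loop_label orb big_map; apply: eq_bigr => s _; rewrite slabel_h.
(* The last central node lies on the added vertical strand. *)
have lmax : leftmost_on_loop x' y' ord_max = false.
  apply/negP => /leftmostP[cl _]; move: cl; apply/negP.
  apply: (run_not_closed (t := (true, inr ord_max)) (c := 0)).
  by apply: run_end; rewrite /smate /= ?addst_mate_l // /slabel /= addst_label_l.
rewrite /loop_scalar big_mkcond big_ord_recr /= lmax mulr1 [RHS]big_mkcond.
apply: eq_bigr => c _; have -> : widen_ord (leqnSn n) c = wid c.
  by apply/val_inj/esym/wid_val.
by rewrite lmE ll.
Qed.

End AddStrandMorphism.

(** * The square of the cup-cap diagram *)

Section CapSquare.

Variables (m n : nat) (j : Zm m).
Local Notation P := (wid ord_max : 'I_n.+2).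
Local Notation Q := (ord_max : 'I_n.+2).
Local Notation w i := (wid (wid i) : 'I_n.+2).
Local Notation d := (cap j n).

Lemma cap_cap : dcomp d d = d.
Proof.
apply: dcomp_eq => -[] c; case: (ord2_case c) => [[i ->]|->|->].
- rewrite cap_l cap_label_l -[0]addr0; apply: (run_step (u := (false, inr (w i)))) => //.
  + by rewrite /smate /= cap_l.
  + by rewrite /slabel /= cap_label_l.
  by apply: run_end; rewrite /smate /= ?cap_l // /slabel /= cap_label_l.
- by rewrite cap_lP; apply: run_end; rewrite /smate /= ?cap_lP.
- by rewrite cap_lQ; apply: run_end; rewrite /smate /= ?cap_lQ.
- rewrite cap_r cap_label_r -[0]addr0; apply: (run_step (u := (true, inl (w i)))) => //.
  + by rewrite /smate /= cap_r.
  + by rewrite /slabel /= cap_label_r.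
  by apply: run_end; rewrite /smate /= ?cap_r // /slabel /= cap_label_r.
- by rewrite cap_rP; apply: run_end; rewrite /smate /= ?cap_rP.
by rewrite cap_rQ; apply: run_end; rewrite /smate /= ?cap_rQ.
Qed.

(** The single loop passes through the central nodes P and Q, of which P is leftmost; the other
    central nodes lie on vertical strands. *)
Lemma cap_cap_scalar (k : fieldType) (delta : {ffun Zm m -> k}) :
  loop_scalar d d delta = delta j.
Proof.
pose s1 : bool * node n.+2 := (true, inl P).
pose s2 : bool * node n.+2 := (false, inr Q).
have st1 : step d d s1 = s2 by rewrite /step /smate /= cap_lP.
have st2 : step d d s2 = s1 by rewrite /step /smate /= cap_rQ.
have cyc : fcycle (step d d) [:: s1; s2] by rewrite /= st1 st2 !eqxx.
have o1 : orbit (step d d) s1 = [:: s1; s2].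
  by rewrite /orbit (order_cycle cyc) ?inE ?eqxx //= st1.
have lP : leftmost_on_loop d d P.
  by rewrite /leftmost_on_loop o1 /= leqnn -ltnS /= andbT (ltn_ord P).
have lo c : leftmost_on_loop d d c = (c == P).
  case: (ord2_case c) => [[i ->]|->|->]; last first.
  - rewrite (_ : (Q == P) = false); last by rewrite eq_sym wid_max.
    apply/negP => /leftmostP[_ /(_ (glue s1))].
    suff -> : fconnect (step d d) (true, inl Q) (glue s1).
      by move=> /(_ isT); rewrite -[position _]/P (wid_val ord_max) ltnn.
    by apply: connect1; rewrite /= /step /smate /= cap_lQ.
  - by rewrite lP eqxx.
  rewrite (_ : (w i == P) = false); last by rewrite (inj_eq (@wid_inj _)) wid_max.
  apply/negP => /leftmostP[cl _]; move: cl; apply/negP.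
  apply: (run_not_closed (t := (true, inr (w i))) (c := 0)).
  by apply: run_end; rewrite /smate /= ?cap_l // /slabel /= cap_label_l.
rewrite /loop_scalar (big_pred1 P) // /loop_label o1 !big_cons big_nil.
by rewrite /slabel /= cap_label_l cap_label_Q add0r addr0.
Qed.

End CapSquare.

(** * Diagrams without arcs: the group Z/m wr S_n and its cosets *)

Section Wreath.

Variables (m n : nat).
Local Notation W := ('S_n * {ffun 'I_n -> Zm m})%type.

Let wr_mate (g : W) (v : node n) : node n :=
  match v with inl i => inr (g.1 i) | inr i => inl ((g.1^-1)%g i) end.
Let wr_label (g : W) (v : node n) : Zm m :=
  match v with inl i => g.2 i | inr i => - g.2 ((g.1^-1)%g i) end.

Fact wr_is_diagram g : is_diagram ([ffun v => wr_mate g v], [ffun v => wr_label g v]).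
Proof.
apply/forallP => -[] i; rewrite /= !ffunE /= ?permK ?permKV ?opprK !eqxx //.
Qed.

Definition wr (g : W) : diagram m n := Sub _ (wr_is_diagram g).

Lemma wr_l g i : mate (wr g) (inl i) = inr (g.1 i). Proof. by rewrite /mate ffunE. Qed.
Lemma wr_r g i : mate (wr g) (inr i) = inl ((g.1^-1)%g i). Proof. by rewrite /mate ffunE. Qed.
Lemma wr_ll g i : label (wr g) (inl i) = g.2 i. Proof. by rewrite /label ffunE. Qed.
Lemma wr_lr g i : label (wr g) (inr i) = - g.2 ((g.1^-1)%g i).
Proof. by rewrite /label ffunE. Qed.

Lemma wr_eq z (g : W) : (forall i, mate z (inl i) = inr (g.1 i) /\ label z (inl i) = g.2 i) -> z = wr g.
Proof.
move=> zg; apply: diagram_ext => -[] i; first by rewrite wr_l wr_ll.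
rewrite wr_r wr_lr; have [zm zl] := zg ((g.1^-1)%g i).
by move: zm; rewrite permKV => zm; rewrite -zl -zm mateK label_mate.
Qed.

Definition wmul (g h : W) : W := ((g.1 * h.1)%g, [ffun i => g.2 i + h.2 (g.1 i)]).
Definition winv (g : W) : W := ((g.1^-1)%g, [ffun i => - g.2 ((g.1^-1)%g i)]).
Definition wone : W := (1%g, [ffun=> 0]).

Lemma wmulA g h l : wmul g (wmul h l) = wmul (wmul g h) l.
Proof.
rewrite /wmul mulgA; congr (_, _); apply/ffunP => i.
by rewrite !ffunE permM addrA.
Qed.
Lemma wmul1 g : wmul wone g = g.
Proof.
case: g => s t; rewrite /wmul /= mul1g; congr (_, _); apply/ffunP => i.
by rewrite !ffunE perm1 add0r.
Qed.
Lemma wmulV g : wmul (winv g) g = wone.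
Proof. by rewrite /wmul /= mulVg; congr (_, _); apply/ffunP => i; rewrite !ffunE addNr. Qed.
Lemma wmulVr g : wmul g (winv g) = wone.
Proof.
by rewrite /wmul /= mulgV; congr (_, _); apply/ffunP => i; rewrite !ffunE permK subrr.
Qed.

Lemma wr1 : wr wone = did m n.
Proof.
by apply/esym/wr_eq => i; rewrite /mate /label !ffunE /= perm1.
Qed.

Lemma wrM g h : dcomp (wr g) (wr h) = wr (wmul g h).
Proof.
apply: wr_eq => i; apply: dcomp_run; rewrite /= ffunE permM.
apply: (run_step (u := (false, inr (g.1 i)))) => //.
- by rewrite /smate /= wr_l.
- by rewrite /slabel /= wr_ll.
by apply: run_end; rewrite /smate /= ?wr_l // /slabel /= wr_ll.
Qed.

Lemma wr_scalar_l g x (k : fieldType) (delta : {ffun Zm m -> k}) :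
  loop_scalar (wr g) x delta = 1.
Proof.
by apply: no_loops => c; right; eexists; eexists; apply: run_end; rewrite ?/smate /= ?wr_r.
Qed.

Lemma wr_scalar_r g x (k : fieldType) (delta : {ffun Zm m -> k}) :
  loop_scalar x (wr g) delta = 1.
Proof.
by apply: no_loops => c; left; eexists; eexists; apply: run_end; rewrite ?/smate /= ?wr_l.
Qed.

Lemma wr_top_arc (g : W) z a b : mate z (inl (g.1 a)) = inl (g.1 b) ->
  mate (dcomp (wr g) z) (inl a) = inl b /\
  label (dcomp (wr g) z) (inl a) = g.2 a + (label z (inl (g.1 a)) - g.2 b).
Proof.
move=> zab; apply: dcomp_run.
apply: (run_step (u := (false, inr (g.1 a)))) => //.
- by rewrite /smate /= wr_l.
- by rewrite /slabel /= wr_ll.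
apply: (run_step (u := (true, inl (g.1 b)))) => //.
- by rewrite /smate /= zab.
by apply: run_end; rewrite /smate /= ?wr_r ?permK // /slabel /= wr_lr permK.
Qed.

Lemma wr_bot_arc (g : W) z a b : mate z (inr a) = inr b ->
  mate (dcomp z (wr g)) (inr (g.1 a)) = inr (g.1 b) /\
  label (dcomp z (wr g)) (inr (g.1 a)) = - g.2 a + (label z (inr a) + g.2 b).
Proof.
move=> zab; apply: dcomp_run.
apply: (run_step (u := (true, inl a))) => //.
- by rewrite /smate /= wr_r permK.
- by rewrite /slabel /= wr_lr permK.
apply: (run_step (u := (false, inr b))) => //.
- by rewrite /smate /= zab.
by apply: run_end; rewrite /smate /= ?wr_l // /slabel /= wr_ll.
Qed.

(** A northern arc leaves fewer than n northern nodes for the n southern ones, which forces a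
    southern arc. *)
Lemma wr_or_arcs (z : diagram m n) : (exists g, z = wr g) \/
  ((exists a b, mate z (inl a) = inl b) /\ (exists a b, mate z (inr a) = inr b)).
Proof.
case: (boolP [forall i, if mate z (inl i) is inr _ then true else false]) => [/forallP fz|].
  left; pose f i := if mate z (inl i) is inr c then c else i.
  have fE i : mate z (inl i) = inr (f i) by have := fz i; rewrite /f; case: (mate z _).
  have f_inj : injective f.
    by move=> i i' E; have := fE i; rewrite E -fE => /(inv_inj (@mateK _ _ z))[].
  exists (perm f_inj, [ffun i => label z (inl i)]); apply: wr_eq => i.
  by rewrite /= permE ffunE fE.
rewrite negb_forall => /existsP[a]; case Ea: (mate z (inl a)) => [b|//] _; right.
split; first by exists a, b.
case: (boolP [forall i, if mate z (inr i) is inl _ then true else false]) => [/forallP fz|].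
  pose f i := if mate z (inr i) is inl c then c else i.
  have fE i : mate z (inr i) = inl (f i) by have := fz i; rewrite /f; case: (mate z _).
  have f_inj : injective f.
    by move=> i i' E; have := fE i; rewrite E -fE => /(inv_inj (@mateK _ _ z))[].
  (* Otherwise the mates of the southern nodes would form a permutation, and the end a of the
     northern arc would be among them. *)
  have := fE ((perm f_inj)^-1%g a); rewrite -[f _](permE f_inj) permKV => /(congr1 (mate z)).
  by rewrite mateK Ea.
rewrite negb_forall => /existsP[a']; case Ea': (mate z (inr a')) => [//|b'] _.
by exists a', b'.
Qed.

Lemma perm2_ex (a b a' b' : 'I_n) : a != b -> a' != b' -> exists s : 'S_n, s a = a' /\ s b = b'.
Proof.
move=> ab ab'; pose s1 := tperm a a'; exists (s1 * tperm (s1 b) b')%g; rewrite !permM tpermL.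
rewrite tpermL tpermD //; last by rewrite eq_sym.
by rewrite -[a' in X in _ != X](tpermL a a') (inj_eq perm_inj) eq_sym.
Qed.

End Wreath.

Section Cosets.

Variables (m n : nat).

(** u.1 is the node sent to the last place and u.2 the label of its strand; dividing by this element
    leaves a last strand that is vertical with label 0. *)
Definition coset_rep (u : 'I_n.+1 * Zm m) : 'S_n.+1 * {ffun 'I_n.+1 -> Zm m} :=
  (tperm u.1 ord_max, [ffun i => if i == u.1 then u.2 else 0]).

Lemma coset_dec g : exists u d, wr g = dcomp (wr (coset_rep u)) (addst d) :> diagram m n.+1.
Proof.
pose i := (g.1^-1)%g ord_max; pose u := (i, g.2 i).
pose h := wmul (winv (coset_rep u)) g.
have [||d dE] := @addst_surj m n (wr h).
- by rewrite wr_l /= permM tpermV tpermR permKV.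
- by rewrite wr_ll !ffunE /= tpermV tpermR eqxx addNr.
by exists u, d; rewrite -dE wrM /h wmulA wmulVr wmul1.
Qed.

End Cosets.

Section ArcReduction.

Variables (m n : nat) (j : Zm m).
Local Notation P := (wid ord_max : 'I_n.+2).
Local Notation Q := (ord_max : 'I_n.+2).

(** Permutations move one arc on each side to the last two nodes, and the labels of g and h correct
    the labels of these arcs. *)
Lemma arc_reduction (z : diagram m n.+2) :
  (exists a b, mate z (inl a) = inl b) -> (exists a b, mate z (inr a) = inr b) ->
  exists g h (d : diagram m n), dcomp (dcomp (wr g) z) (wr h) = foldb j (addst d).
Proof.
move=> [a [b zab]] [a' [b' zab']].
have nab : a != b by have := mate_neq z (inl a); rewrite zab eq_sym.
have nab' : a' != b' by have := mate_neq z (inr a'); rewrite zab' eq_sym.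
have PQ : P != Q by rewrite wid_max.
have [s [sP sQ]] := perm2_ex PQ nab.
have [s' [sa sb]] := perm2_ex nab' PQ.
(* With l the label of the arc in z, these labels solve g(P) + l - g(Q) = 0 with g(P) = 0 and,
   below, - h(a') + l + h(b') = - j with h(a') = 0. *)
pose g := (s, [ffun i => if i == Q then label z (inl a) else 0] : {ffun _ -> Zm m}).
pose h := (s', [ffun i => if i == b' then - j - label z (inr a') else 0] : {ffun _ -> Zm m}).
exists g, h; pose z1 := dcomp (wr g) z.
have [m1 l1] : mate z1 (inl P) = inl Q /\ label z1 (inl P) = 0.
  have [|-> ->] := @wr_top_arc m _ g z P Q; first by rewrite /= sP sQ.
  by rewrite /= !ffunE (negPf PQ) eqxx sP subrr addr0.
have [m2 l2] := bot_arc (wr g) zab'.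
have [m3 l3] := top_arc (wr h) m1.
have [m4 l4] := wr_bot_arc h m2.
apply: foldb_addst_surj => //; last by rewrite l3.
  by move: m4; rewrite /= sa sb.
move: l4; rewrite /= sa => ->; rewrite l2 !ffunE (negPf nab') eqxx.
by rewrite oppr0 add0r addrC subrK.
Qed.

End ArcReduction.

(** * The number of diagrams *)

Section CardDiagrams.

Variables (m : nat).
Hypothesis m_gt0 : (0 < m)%N.

(** A diagram is built from the mate of the last southern node, the label of their strand and a
    smaller diagram; all three can be read off the result. *)
Lemma card_diagramS n : (n.*2.+1 * m * #|{: diagram m n}| <= #|{: diagram m n.+1}|)%N.
Proof.
pose U := {u : node n.+1 | u != inr ord_max}.
pose E (u : U) := emb_perm (tpermK (inl ord_max) (val u)) (emb_wid n).
pose f (x : U * Zm m * diagram m n) := ext (E x.1.1) (fun=> 0) x.1.2 x.2.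
have cU : #|{: U}| = n.*2.+1.
  rewrite card_sig -[#|_|]/(#|predC1 (inr ord_max : node n.+1)|) cardC1 card_sum !card_ord.
  by rewrite addnS /= addSn addnn.
have -> : (n.*2.+1 * m * #|{: diagram m n}|)%N = #|{: U * Zm m * diagram m n}|.
  have cZ : #|{: Zm m}| = m by rewrite card_ord prednK.
  by rewrite !card_prod cU cZ.
have Ep u : en_p (E u) = val u by rewrite /= tpermL.
have Eq u : en_q (E u) = inr ord_max by rewrite /= tpermD // (valP u).
apply: (@leq_card _ _ f) => -[[u c] d] [[u' c'] d'] fE.
have uu' : u = u'.
  apply: val_inj; rewrite -!Ep -(ext_mate_q (E u) (fun=> 0) c d) -(ext_mate_q (E u') (fun=> 0) c' d').
  by rewrite !Eq -[ext (E u) _ _ _]/(f (u, c, d)) fE.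
move: fE; rewrite -{}uu' /f /= => fE.
have cc' : c = c' by rewrite -(ext_label_p (E u) (fun=> 0) c d) fE ext_label_p.
by move: fE; rewrite -{}cc' => /ext_inj->.
Qed.

Lemma card_diagram n : (freed m n.*2 0 <= #|{: diagram m n}|)%N.
Proof.
elim: n => [|n IH]; first by apply/card_gt0P; exists (did m 0).
by rewrite freed_double; apply: leq_trans (card_diagramS n); rewrite leq_mul2l IH orbT.
Qed.

Lemma card_diagram0 : #|{: diagram m 0}| = 1%N.
Proof.
apply/eqP; rewrite eqn_leq; apply/andP; split; last by apply/card_gt0P; exists (did m 0).
by apply/card_le1P => z _ z'; rewrite !inE; apply/esym/eqP/diagram_ext => -[] [].
Qed.

End CardDiagrams.

(** * Maschke's theorem for an algebra spanned by the image of a finite group *)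

Section Maschke.

Variables (k : fieldType) (A : falgType k) (G : finType) (u : G -> A).
Variables (mul : G -> G -> G) (inv : G -> G).
Hypotheses (mul_inj : forall g, injective (mul g)).
Hypotheses (uM : forall g h, u (mul g h) = u g * u h).
Hypotheses (uV : forall g, u (inv g) * u g = 1) (uVr : forall g, u g * u (inv g) = 1).
Hypothesis u_span : forall W : {vspace A}, (forall g, u g \in W) -> W = fullv.
Hypothesis cardG : #|G|%:R != 0 :> k.

Lemma maschke : semisimple_algebra A.
Proof.
move=> U hU; pose P : 'End(A) := projv U.
(* The average of the conjugates of a projection onto U; it is again a projection onto U, and
   A-linear. *)
pose p' (x : A) : A := #|G|%:R^-1 *: \sum_g u g * P (u (inv g) * x).
have pl : linear p'.
  move=> c x y; rewrite /p' scalerA [c * _]mulrC -scalerA -scalerDr; congr (_ *: _).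
  rewrite scaler_sumr -big_split; apply: eq_bigr => g _ /=.
  by rewrite mulrDr -scalerAr linearP mulrDr -scalerAr.
pose p := mkhom pl.
have hU' a v : v \in U -> a * v \in U by move=> vU; rewrite -[a * v]regularE hU.
have pU x : p x \in U.
  rewrite mkhomE; apply: memvZ; apply: memv_suml => g _; apply: hU'; exact: memv_proj.
have pid x : x \in U -> p x = x.
  move=> xU; rewrite mkhomE /p' (eq_bigr (fun=> x)) => [|g _].
    by rewrite sumr_const -scaler_nat scalerA mulVf // scale1r.
  by rewrite [P _]projv_id ?hU' // mulrA uVr mul1r.
have pu h x : p (u h * x) = u h * p x.
  rewrite !mkhomE /p' -scalerAr mulr_sumr; congr (_ *: _).
  rewrite (reindex_inj (@mul_inj h)); apply: eq_bigr => g _ /=.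
  rewrite uM -mulrA; congr (_ * (_ * P _)); rewrite mulrA; congr (_ * _).
  (* u(inv (h g)) u(h) is the inverse of u(g): u(g) u(inv g) is inserted on the right and u(h) u(g)
     is combined. *)
  rewrite -[LHS]mulr1 -(uVr g) !mulrA -(mulrA (u (inv _))) -uM uV mul1r.
  by [].
have pM a x : p (a * x) = a * p x.
  have WT : lker (p \o amulr x - amulr (p x))%VF = fullv.
    apply: u_span => g; rewrite memv_ker add_lfunE opp_lfunE comp_lfunE !lfunE /= pu.
    by rewrite subrr.
  have := memvf a; rewrite -WT memv_ker add_lfunE opp_lfunE comp_lfunE !lfunE /= subr_eq0.
  by move/eqP.
exists (lker p); split.
- by move=> a v; rewrite !memv_ker [lact _ _ _]regularE pM => /eqP->; rewrite mulr0.
- apply: eq_fullv => x; rewrite -[x](subrK (p x)) addrC; apply: memv_add; first exact: pU.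
  by rewrite memv_ker linearB /= (pid (p x)) ?pU // subrr.
apply/eqP; rewrite -subv0; apply/subvP => x /memv_capP[xU].
by rewrite memv_ker (pid _ xU) memv0.
Qed.

End Maschke.

(** * Coordinates and linear maps on a basis indexed by a finite type *)

Section IndexedBasis.

Variables (k : fieldType) (D : finType) (V : vectType k) (b : D -> V).

Definition bcoef (d : D) (u : V) : k := coord (codom_tuple b) (enum_rank d) u.
Definition blift (W : vectType k) (f : D -> W) : 'Hom(V, W) :=
  linfun (fun u => \sum_d bcoef d u *: f d).

Hypothesis b_basis : basis_of {:V} (codom b).

Let nthE (i : 'I_#|{: D}|) : (codom_tuple b)`_i = b (enum_val i).
Proof. by rewrite (nth_map (enum_val i)) -?enum_val_nth // -cardE. Qed.

Lemma bcoefE d d' : bcoef d (b d') = (d' == d)%:R.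
Proof.
rewrite /bcoef -[b d'](_ : (codom_tuple b)`_(enum_rank d') = _); last by rewrite nthE enum_rankK.
by rewrite coord_free ?(basis_free b_basis) // (inj_eq enum_rank_inj) eq_sym.
Qed.

Lemma bcoef_linear d : linear (bcoef d : V -> k^o).
Proof. by move=> c u v; rewrite /bcoef linearP. Qed.

Lemma bcoefZ d c u : bcoef d (c *: u) = c * bcoef d u.
Proof. by rewrite /bcoef linearZ. Qed.

Lemma bcoef0 d : bcoef d 0 = 0.
Proof. by rewrite /bcoef linear0. Qed.

Lemma blift_linear (W : vectType k) (f : D -> W) :
  linear (fun u => \sum_d bcoef d u *: f d).
Proof.
move=> c u v; rewrite scaler_sumr -big_split; apply: eq_bigr => d _ /=.
by rewrite [bcoef _ _]bcoef_linear scalerDl scalerA.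
Qed.

Lemma bliftE (W : vectType k) (f : D -> W) d : blift f (b d) = f d.
Proof.
rewrite /blift linfunE; last exact: blift_linear.
rewrite (bigD1 d) //= bcoefE eqxx scale1r big1 ?addr0 // => d' nd.
by rewrite bcoefE eq_sym (negPf nd) scale0r.
Qed.

Lemma basis_full (W : {vspace V}) : (forall d, b d \in W) -> W = fullv.
Proof.
move=> bW; apply/eqP; rewrite eqEsubv subvf -(span_basis b_basis).
by apply/span_subvP => _ /codomP[d ->].
Qed.

Lemma basis_ext (W : vectType k) (f g : 'Hom(V, W)) :
  (forall d, f (b d) = g (b d)) -> f = g.
Proof.
move=> fg; apply/lfunP => v; apply/eqP; rewrite -subr_eq0 -opp_lfunE -add_lfunE -memv_ker.
rewrite (_ : lker _ = fullv) ?memvf //; apply: basis_full => d.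
by rewrite memv_ker add_lfunE opp_lfunE fg subrr.
Qed.

Lemma bcoef_eq0 u : (forall d, bcoef d u = 0) -> u = 0.
Proof.
move=> u0; have -> : u = blift b u.
  suff -> : blift b = \1%VF by rewrite id_lfunE.
  by apply: basis_ext => d; rewrite bliftE id_lfunE.
by rewrite /blift linfunE ?big1 // => [d _|]; [rewrite u0 scale0r | apply: blift_linear].
Qed.

Lemma dim_basis : \dim {:V} = #|{: D}|.
Proof. by rewrite (size_basis (n := #|{: D}|) (X := codom_tuple b)). Qed.

End IndexedBasis.

(** * The tower data of the cyclotomic Brauer algebras *)

Section BrauerTower.

Variables (k : fieldType) (m : nat) (delta : {ffun Zm m -> k}) (j : Zm m).
Hypotheses (m_gt0 : (0 < m)%N) (deltaj : delta j != 0).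
Variables (N : option nat) (B : nat -> falgType k) (b : forall n, diagram m n -> B n).
Arguments b {n}.
Local Notation R := (in_range N).
Hypothesis bB : forall n, R n -> basis_of {: B n} (codom (@b n)).
Hypothesis bM : forall n, R n -> forall x y : diagram m n,
  b x * b y = loop_scalar x y delta *: b (dcomp x y).

(** Left multiplication by the identity diagram fixes every basis element, hence also the unit. *)
Lemma b1 n : R n -> b (did m n) = 1.
Proof.
move=> h; have /lfunP/(_ 1) : amull (b (did m n)) = \1%VF.
  apply: (basis_ext (bB h)) => d.
  by rewrite lfunE id_lfunE /= bM // loop_scalar1 scale1r dcomp1.
by rewrite lfunE id_lfunE /= mulr1.
Qed.

Definition iot n : 'Hom(B n, B n.+1) := blift (@b n) (fun d => b (addst d)).

Lemma iotE n d : R n.+1 -> iot n (b d) = b (addst d).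
Proof. by move=> h; rewrite /iot bliftE //; apply: bB; apply: in_rangeS h. Qed.

Fact iot_ahom n (h : R n.+1) : ahom_in {: B n} (iot n).
Proof.
have hn := in_rangeS h; have bb := bB hn.
apply/ahomP_tmp; split=> [|x y].
  by rewrite -(b1 hn) iotE // addst_did b1.
have xl : linear (fun x => iot n (x * y)) by move=> c u v; rewrite mulrDl -scalerAl linearP.
have xl' : linear (fun x => iot n x * iot n y) by move=> c u v; rewrite linearP mulrDl -scalerAl.
suff /lfunP/(_ x) : mkhom xl = mkhom xl' by rewrite !mkhomE.
apply: (basis_ext bb) => d; rewrite !mkhomE.
have yl : linear (fun y => iot n (b d * y)) by move=> c u v; rewrite mulrDr -scalerAr linearP.
have yl' : linear (fun y => iot n (b d) * iot n y) by move=> c u v; rewrite linearP mulrDr -scalerAr.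
suff /lfunP/(_ y) : mkhom yl = mkhom yl' by rewrite !mkhomE.
apply: (basis_ext bb) => d'; rewrite !mkhomE bM // linearZ /= !iotE // bM //.
by rewrite addst_scalar addstM.
Qed.

Definition iota n (h : R n.+1) : 'AHom(B n, B n.+1) := AHom (iot_ahom h).

Lemma iotaE n (h : R n.+1) x : iota h x = iot n x. Proof. by []. Qed.

Lemma iotaM n (h : R n.+1) x y : iot n (x * y) = iot n x * iot n y.
Proof. exact: (rmorphM (iota h)). Qed.
Lemma iota1 n (h : R n.+1) : iot n 1 = 1.
Proof. exact: (rmorph1 (iota h)). Qed.

(** [delta j] is the scalar of the loop in the square of [cap], so the quotient is idempotent. *)
Definition ide n : B n :=
  match n with n'.+2 => (delta j)^-1 *: b (cap j n') | _ => 0 end.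

Fact phi_linear n : linear (fun x : B n => iot n.+1 (iot n x) * ide n.+2).
Proof. by move=> c x y; rewrite !linearP mulrDl -scalerAl. Qed.
Definition phi n : 'Hom(B n, B n.+2) := mkhom (@phi_linear n).
Lemma phiE n x : phi n x = iot n.+1 (iot n x) * ide n.+2. Proof. exact: mkhomE. Qed.

Section Relations.

Variables (n : nat) (h : R n.+2).
Let h1 : R n.+1 := in_rangeS h.
Let h0 : R n := in_rangeS h1.
Local Notation E := (ide n.+2).
Local Notation bcap := (b (cap j n)).

Let bcapE : bcap = delta j *: E.
Proof. by rewrite /ide scalerA mulfV // scale1r. Qed.

Lemma ide_idem : E * E = E.
Proof.
rewrite /ide -scalerAl -scalerAr bM // cap_cap cap_cap_scalar !scalerA.
by rewrite -mulrA mulVf // mulr1.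
Qed.

Lemma iot_cap d : b (foldb j d) = iot n.+1 (b d) * bcap.
Proof. by rewrite iotE // bM // addst_cap addst_cap_scalar scale1r. Qed.

Lemma cap_iot d : b (foldt j d) = bcap * iot n.+1 (b d).
Proof. by rewrite iotE // bM // cap_addst cap_addst_scalar scale1r. Qed.

Lemma iot2_comm x : iot n.+1 (iot n x) * E = E * iot n.+1 (iot n x).
Proof.
have l1 : linear (fun x => iot n.+1 (iot n x) * E) by move=> c u v; rewrite !linearP mulrDl -scalerAl.
have l2 : linear (fun x => E * iot n.+1 (iot n x)) by move=> c u v; rewrite !linearP mulrDr -scalerAr.
suff /lfunP/(_ x) : mkhom l1 = mkhom l2 by rewrite !mkhomE.
apply: (basis_ext (bB h0)) => d; rewrite !mkhomE (iotE _ h1) /ide -scalerAr -scalerAl.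
by rewrite -iot_cap -cap_iot fold_addst.
Qed.

(** For a diagram z the product with [cap] has the southern arc of [cap]; it is therefore some
    [foldb j d], which is iota(d) times [cap]. *)
Lemma left_ex x : exists y, x * E = iot n.+1 y * E.
Proof.
have fl : linear (fun y => iot n.+1 y * E) by move=> c u v; rewrite linearP mulrDl -scalerAl.
suff : x * E \in limg (mkhom fl) by case/memv_imgP=> y _ ->; exists y; rewrite mkhomE.
have -> : x * E = amulr E x by rewrite lfunE.
rewrite memv_preim (_ : (_ @^-1: _)%VS = fullv) ?memvf //; apply: (basis_full (bB h)) => z.
rewrite -memv_preim lfunE /=.
have -> : b z * E = ((delta j)^-1 * loop_scalar z (cap j n) delta) *: b (dcomp z (cap j n)).
  by rewrite /ide -scalerAr bM // scalerA.
have [mP lP] := bot_arc z (cap_rP j n).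
have [|d ->] := @foldb_surj _ j _ (dcomp z (cap j n)) mP; first by rewrite lP cap_label_P.
have -> : b (foldb j d) = delta j *: (iot n.+1 (b d) * E) by rewrite scalerAr -bcapE iot_cap.
do 2!apply: memvZ.
by apply/memv_imgP; exists (b d); rewrite ?memvf ?mkhomE.
Qed.

Lemma right_ex x : exists y, E * x = E * iot n.+1 y.
Proof.
have fl : linear (fun y => E * iot n.+1 y) by move=> c u v; rewrite linearP mulrDr -scalerAr.
suff : E * x \in limg (mkhom fl) by case/memv_imgP=> y _ ->; exists y; rewrite mkhomE.
have -> : E * x = amull E x by rewrite lfunE.
rewrite memv_preim (_ : (_ @^-1: _)%VS = fullv) ?memvf //; apply: (basis_full (bB h)) => z.
rewrite -memv_preim lfunE /=.
have -> : E * b z = ((delta j)^-1 * loop_scalar (cap j n) z delta) *: b (dcomp (cap j n) z).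
  by rewrite /ide -scalerAl bM // scalerA.
have [mP lP] := top_arc z (cap_lQ j n).
have [|d ->] := @foldt_surj _ j _ (dcomp (cap j n) z) mP; first by rewrite lP cap_label_l.
have -> : b (foldt j d) = delta j *: (E * iot n.+1 (b d)) by rewrite scalerAl -bcapE cap_iot.
do 2!apply: memvZ.
by apply/memv_imgP; exists (b d); rewrite ?memvf ?mkhomE.
Qed.

(** As [foldb] is injective on diagrams, the coefficient of iota(y) e at [foldb j d] is that of y at
    d divided by [delta j]. *)
Lemma left_inj y : iot n.+1 y * E = 0 -> y = 0.
Proof.
move=> y0; apply: (bcoef_eq0 (bB h1)) => d.
have l1 : linear (fun y => bcoef (@b n.+2) (foldb j d) (iot n.+1 y * E) : k^o).
  by move=> c u v; rewrite linearP mulrDl -scalerAl [LHS]bcoef_linear.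
have l2 : linear (fun y => (delta j)^-1 * bcoef (@b n.+1) d y : k^o).
  by move=> c u v; rewrite [bcoef _ _ _](bcoef_linear (@b n.+1)) mulrDr mulrCA.
have /lfunP/(_ y) : mkhom l1 = mkhom l2.
  apply: (basis_ext (bB h1)) => d'; rewrite !mkhomE /ide -scalerAr -iot_cap.
  by rewrite bcoefZ (bcoefE (bB h)) (bcoefE (bB h1)) (inj_eq (@foldb_inj _ _ _)).
rewrite !mkhomE y0 bcoef0 => /esym/eqP; rewrite mulf_eq0 invr_eq0 (negPf deltaj) /=.
by move/eqP.
Qed.

End Relations.

Lemma b_wrK n (h : R n) g : b (wr (winv g)) * b (wr g) = 1 :> B n.
Proof. by rewrite bM // wr_scalar_l scale1r wrM wmulV wr1 b1. Qed.
Lemma b_wrKr n (h : R n) g : b (wr g) * b (wr (winv g)) = 1 :> B n.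
Proof. by rewrite bM // wr_scalar_l scale1r wrM wmulVr wr1 b1. Qed.

(** By [arc_reduction], multiplying z on both sides by invertible group elements gives a multiple of
    iota(iota(d)) e. For n < 2 there are no arcs. *)
Lemma arc_ideal n (h : R n) (z : diagram m n) :
  (exists u v, mate z (inl u) = inl v) -> (exists u v, mate z (inr u) = inr v) ->
  b z \in ideal (ide n).
Proof.
case: n h z => [|[|n]] h z tz bz.
- by case: tz => -[].
- case: tz => u [v]; have -> : v = u by rewrite (ord1 u) (ord1 v).
  by move/eqP; rewrite (negPf (mate_neq _ _)).
have [g [l [d zE]]] := arc_reduction j tz bz.
have h1 := in_rangeS h.
have bE : b (wr g) * b z * b (wr l) = delta j *: (iot n.+1 (iot n (b d)) * ide n.+2).
  rewrite bM // wr_scalar_l scale1r bM // wr_scalar_r scale1r zE iot_cap // iotE //.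
  by rewrite /= -scalerAr scalerA mulfV // scale1r !iotE.
have -> : b z = b (wr (winv g)) * (b (wr g) * b z * b (wr l)) * b (wr (winv l)).
  by rewrite !mulrA b_wrK // mul1r -mulrA b_wrKr // mulr1.
apply: ideal_mulr_closed; apply: ideal_mull_closed; rewrite bE; apply: memvZ.
by apply: ideal_mull_closed; apply: mem_ideal_id.
Qed.

Lemma iot_ide n (h : R n.+1) : iot n (ide n) \in ideal (ide n.+1).
Proof.
case: n h => [|[|n]] h; try by rewrite linear0 mem0v.
rewrite [ide n.+2]/= linearZ /=; apply: memvZ; rewrite iotE //; apply: arc_ideal => //.
  have := addst_mate (cap j n) (inl ord_max); rewrite cap_lQ => aE.
  by exists (wid ord_max), (wid (wid ord_max)); exact: aE.
have := addst_mate (cap j n) (inr ord_max); rewrite cap_rQ => aE.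
by exists (wid ord_max), (wid (wid ord_max)); exact: aE.
Qed.

(** A diagram with arcs lies in the ideal, and one without is a coset representative times a diagram
    of A_n. *)
Lemma coset_ex n (h : R n.+1) : exists g : 'I_(n.+1 * m) -> B n.+1,
  forall x, exists y : 'I_(n.+1 * m) -> B n,
  x - \sum_a g a * iota h (y a) \in ideal (ide n.+1).
Proof.
have cE : #|{: 'I_n.+1 * Zm m}| = (n.+1 * m)%N.
  have cZ : #|{: Zm m}| = m by rewrite card_ord prednK.
  by rewrite card_prod card_ord cZ.
pose c (a : 'I_(n.+1 * m)) := enum_val (cast_ord (esym cE) a) : 'I_n.+1 * Zm m.
pose g a := b (wr (coset_rep (c a))).
have fl a : linear (fun y => g a * iot n y).
  by move=> s u v; rewrite linearP mulrDr -scalerAr.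
exists g => x.
pose W := (\sum_a limg (mkhom (fl a)) + ideal (ide n.+1))%VS.
have WT : W = fullv.
  apply: (basis_full (bB h)) => z; case: (wr_or_arcs z) => [[w ->]|[tz bz]]; last first.
    by apply: (subvP (addvSr _ _)); apply: arc_ideal.
  have [u [d ->]] := coset_dec w.
  apply: (subvP (addvSl _ _)); pose a := cast_ord cE (enum_rank u).
  apply: (subvP (sumv_sup a _ (subvv _))) => //.
  apply/memv_imgP; exists (b d); rewrite ?memvf // mkhomE iotE //.
  rewrite /g /c /a cast_ordK enum_rankK bM // wr_scalar_l scale1r.
  by [].
have : x \in W by rewrite WT memvf.
case/memv_addP=> v vs [w wI xE]; case/memv_sumP: vs => vs vsP vE.
have /fin_all_exists[y yE] a : exists y, vs a = g a * iot n y.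
  by have /memv_imgP[y _ ->] := vsP a isT; exists y; rewrite mkhomE.
exists y; rewrite xE vE (eq_bigr _ (fun a _ => yE a)) addrAC subrr add0r.
exact: wI.
Qed.

Lemma phi_ide n (h : R n.+2) x : ide n.+2 * phi n x = phi n x /\ phi n x * ide n.+2 = phi n x.
Proof.
rewrite phiE; split; last by rewrite -mulrA ide_idem.
by rewrite mulrA -(iot2_comm h) -mulrA ide_idem.
Qed.

Lemma iot_inj n (h : R n.+1) : lker (iot n) = 0%VS.
Proof.
have hn := in_rangeS h.
apply/eqP; rewrite -subv0; apply/subvP => x; rewrite memv_ker memv0 => /eqP x0.
apply/eqP/(bcoef_eq0 (bB hn)) => d.
have l1 : linear (fun y => bcoef (@b n.+1) (addst d) (iot n y) : k^o).
  by move=> c u v; rewrite linearP [LHS]bcoef_linear.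
have /lfunP/(_ x) : mkhom l1 = mkhom (bcoef_linear (@b n) d).
  apply: (basis_ext (bB hn)) => d'; rewrite !mkhomE iotE //.
  by rewrite (bcoefE (bB h)) (bcoefE (bB hn)) (inj_eq (@addst_inj _ _)).
by rewrite !mkhomE x0 bcoef0.
Qed.

Lemma brauer_A1 : axiom_A1 N ide phi.
Proof.
split=> // n h; have h1 := in_rangeS h; have h0 := in_rangeS h1.
have ee := ide_idem h; split=> //.
- by rewrite phiE (iota1 h1) (iota1 h) mul1r.
- move=> x y; rewrite !phiE (iotaM h1) (iotaM h) -!mulrA; congr (_ * _).
  by rewrite mulrA -(iot2_comm h) -mulrA ee.
- apply/eqP; rewrite -subv0; apply/subvP => x; rewrite memv_ker memv0 phiE => /eqP.
  by move/(left_inj h)/eqP; rewrite -memv_ker iot_inj // memv0.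
apply: limg_eq => [x _|w /cornerP[y ->]].
  by apply/cornerP; exists (phi n x); have [-> ->] := phi_ide h x.
suff : y \in (amulr (ide n.+2) @^-1: (amull (ide n.+2) @^-1: limg (phi n)))%VS.
  by rewrite -!memv_preim !lfunE /= mulrA => /memv_imgP.
rewrite (_ : (_ @^-1: _)%VS = fullv) ?memvf //; apply: (basis_full (bB h)) => z.
rewrite -!memv_preim !lfunE /=.
have -> : (delta j)^-1 *: b (cap j n) * (b z * ((delta j)^-1 *: b (cap j n))) =
   ((delta j)^-1 * (delta j)^-1 * loop_scalar z (cap j n) delta *
    loop_scalar (cap j n) (dcomp z (cap j n)) delta) *:
   b (dcomp (cap j n) (dcomp z (cap j n))).
  by rewrite -scalerAl -!scalerAr bM // -!scalerAr bM // !scalerA !mulrA.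
apply: memvZ.
(* With [cap] above and below z, the product has both arcs of [cap] with their labels, so it is a
   multiple of some [phi n (b d)]. *)
have [m1 l1] := bot_arc z (cap_rP j n).
have [m2 l2] := bot_arc (cap j n) m1.
have [m3 l3] := top_arc (dcomp z (cap j n)) (cap_lP j n).
have [||d ->] := @foldb_addst_surj _ j _ _ m2 _ m3.
- by rewrite l2 l1 cap_label_P.
- by rewrite l3 cap_label_l.
have -> : b (foldb j (addst d)) = delta j *: phi n (b d).
  by rewrite iot_cap // phiE (iotE _ h1) /= -scalerAr scalerA mulfV // scale1r !iotE.
by apply: memvZ; exact: memv_img (memvf _).
Qed.

Lemma brauer_tower_data : tower_data m ide phi iota.
Proof.
split=> //.
- exact: brauer_A1.
- by move=> n h1 h2 x; rewrite phiE.
- by move=> n h1 h2 x; apply: iot2_comm.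
- by move=> n h x; apply: left_ex.
- by move=> n h y; apply: left_inj.
- by move=> n h x; apply: right_ex.
- by move=> n h; apply: iot_ide.
- exact: coset_ex.
- have h0 : R 0 by rewrite /in_range; case: (N).
  by rewrite (dim_basis (bB h0)) card_diagram0.
by move=> n h; rewrite (dim_basis (bB h)) card_diagram.
Qed.

Lemma brauer_A4 : axiom_A4 ide phi iota.
Proof.
move=> n h1 h2.
have fl : linear (fun y => iot n.+1 y * ide n.+2) by move=> c u v; rewrite linearP mulrDl -scalerAl.
exists (mkhom fl); split.
- apply/eqP; rewrite -subv0; apply/subvP => y; rewrite memv_ker memv0 mkhomE => /eqP.
  by move/(left_inj h2)/eqP.
- apply: limg_eq => [y _|w /lidealP[x ->]].
    by rewrite mkhomE; apply/lidealP; exists (iot n.+1 y).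
  by have [y ->] := left_ex h2 x; exists y; rewrite ?memvf ?mkhomE.
- by move=> a x; rewrite !mkhomE (iotaM h2) mulrA.
move=> x y; rewrite !(mkhomE fl) phiE (iotaM h2) !iotaE -!mulrA; congr (_ * _).
by rewrite mulrA -(iot2_comm h2) -mulrA ide_idem.
Qed.

(** Modulo the ideal of e_n all diagrams with arcs vanish, so the images of the elements of Z/m wr
    S_n span the quotient; n! m^n is the order of this group. *)
Lemma brauer_A2i : (forall n, R n -> (n`! * m ^ n)%:R != 0 :> k) -> axiom_A2i N ide.
Proof.
move=> cn n h I IE; pose u g := quo I (b (wr g)).
apply: (@maschke _ (quoalg I) _ u (@wmul m n) (@winv m n)).
- move=> g l l' /(congr1 (wmul (winv g))); by rewrite !wmulA wmulV !wmul1.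
- by move=> g l; rewrite /u -quoM bM // wr_scalar_l scale1r wrM.
- by move=> g; rewrite /u -quoM b_wrK.
- by move=> g; rewrite /u -quoM b_wrKr.
- move=> W uW; apply: eq_fullv => q; have [x ->] := quo_surj q.
  have ql := @quo_is_linear _ _ I; rewrite -[quo I x](mkhomE ql) memv_preim.
  rewrite (_ : (_ @^-1: _)%VS = fullv) ?memvf //; apply: (basis_full (bB h)) => z.
  rewrite -memv_preim mkhomE; case: (wr_or_arcs z) => [[w ->]|[tz bz]]; first exact: uW.
  suff /eqP-> : quo I (b z) == 0 by exact: mem0v.
  by rewrite quo_eq0 IE arc_ideal.
have cZ : #|{: Zm m}| = m by rewrite card_ord prednK.
have -> : #|{: 'S_n * {ffun 'I_n -> Zm m}}| = (n`! * m ^ n)%N.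
  by rewrite card_prod card_ffun cZ card_ord card_Sn.
exact: cn.
Qed.

End BrauerTower.

Lemma wreath_order_neq0 (k : fieldType) (p m n : nat) : has_characteristic k p ->
  m%:R != 0 :> k -> p = 0%N \/ (n < p)%N -> (n`! * m ^ n)%:R != 0 :> k.
Proof.
move=> char_k m0 np; rewrite natrM natrX mulf_neq0 ?expf_neq0 //.
have pos i : (0 < i <= n)%N -> i%:R != 0 :> k.
  case/andP=> i0 ni; case: p char_k np => [|p] /= char_k np.
    by apply/negP => /(natf0_pchar i0)[q]; rewrite char_k.
  rewrite -(dvdn_pcharf char_k); apply/negP => /(dvdn_leq i0).
  by case: np => // np; lia.
elim: n pos {np} => [|n IH] pos; first by rewrite fact0 oner_neq0.
rewrite factS natrM; apply: mulf_neq0; first by rewrite pos /=.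
apply: IH => i /andP[i0 ni].
by rewrite pos // i0 ltnW.
Qed.

Theorem theorem3p3p3 (k : closedFieldType) (p m : nat)
    (char_k : has_characteristic k p)
    (m_gt0 : (0 < m)%N) (m_inv : m%:R != 0 :> k)
    (delta : {ffun Zm m -> k}) (N : option nat)
    (hN : forall n : nat, in_range N n ->
       (~~ odd n -> delta <> 0) /\
       (p = 0%N \/ ((n < p)%N /\ ~~ (p %| m)%N)))
    (B : nat -> falgType k)
    (hB : forall n : nat, in_range N n -> is_cyclotomic_brauer delta n (B n)) :
  tower_of_recollement N B.
Proof.
(* 0 is even and belongs to every range, so the hypothesis at n = 0 gives delta <> 0. *)
have [j dj] : exists j, delta j != 0.
  have [|d0 _] := hN 0%N; first by case: (N).
  apply/existsP; rewrite -negb_forall; apply/negP => /forallP d0'; apply: d0 => //.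
  by apply/ffunP => j; rewrite ffunE; apply/eqP; have := d0' j.
(* The bases are only known to exist for each n. Stated as a boolean predicate on finite functions,
   their existence allows a simultaneous choice by [xchoose]; outside the range [b n] is set to
   0. *)
pose isb n (f : {ffun diagram m n -> B n}) := basis_of {: B n} (codom f) &&
  [forall x, forall y, f x * f y == loop_scalar x y delta *: f (dcomp x y)].
have exb n : in_range N n -> exists f, @isb n f.
  move=> /hB[f fB fM]; exists [ffun x => f x]; apply/andP; split.
    by rewrite (eq_codom (ffunE f)).
  by apply/forallP => x; apply/forallP => y; rewrite !ffunE fM.
pose b n : diagram m n -> B n := match @idP (in_range N n) with
  | ReflectT h => xchoose (exb n h) | _ => fun=> 0 end.
have bP n : in_range N n -> basis_of {: B n} (codom (b n)) /\
    forall x y, b n x * b n y = loop_scalar x y delta *: b n (dcomp x y).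
  move=> h; rewrite /b; case: {-}_ / idP => [h'|//]; have /andP[fB /forallP fM] := xchooseP (exb n h').
  by split=> // x y; apply/eqP; apply: (forallP (fM x)).
have bB n h := (bP n h).1; have bM n h := (bP n h).2.
have td := brauer_tower_data m_gt0 dj bB bM.
exists (ide delta j b), (phi delta j b), (iota bB bM); split.
- exact: brauer_A1.
- split; last exact: tower_A2ii td.
  apply: brauer_A2i => // n h; apply: (wreath_order_neq0 char_k) => //.
  by have [_ []] := hN n h; [left | case; right].
- by move=> n h; exact: (iot_inj bB h).
- exact: brauer_A4.
by split; [exact: tower_A5 td | exact: tower_A6 td].
Qed.
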